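(* (a) Let $R$ and $S$ be commutative associative unitary rings and $p:R\to S$ a (unital) ring homomorphism. If $p$ is an effective codescent morphism in the category of commutative associative unitary rings, then $p$ is an effective codescent morphism in the category of ternary rings. (b) The converse is not true in general: there exist commutative associative unitary rings $R$, $S$ and a homomorphism $R\to S$ which is an effective codescent morphism in the category of ternary rings but not in the category of commutative associative unitary rings. (c) The converse is true if either $R$ is a principal ideal domain or $S$ is projective as an $R$-module: if $p:R\to S$ is a homomorphism of commutative associative unitary rings satisfying one of these two conditions, and $p$ is an effective codescent morphism in the category of ternary rings, then $p$ is an effective codescent morphism in the category of commutative associative unitary rings.
   Context: A ternary ring is an algebra with two ternary operations $t,q$ and two constants $0,1$ satisfying $t(0,x,y)=y$, $t(x,0,y)=y$, $t(1,x,0)=x$, $t(x,1,0)=x$, $q(x,y,t(x,y,z))=z$, $t(x,y,q(x,y,z))=z$. Homomorphisms preserve all operations. Every unitary ring is regarded as a ternary ring with the same $0,1$ and $t(a,b,c)=ab+c$ (so $q(a,b,c)=c-ab$); in this way commutative associative unitary rings form a full subcategory of the category of ternary rings. $S$ is regarded as an $R$-module via $p$. Codescent: for a category $\mathcal{C}$ with pushouts and a morphism $p:B\to E$, the change-of-cobase functor $p_*:B/\mathcal{C}\to E/\mathcal{C}$ between coslice categories sends $\varphi:B\to C$ to the pushout of $\varphi$ along $p$ (as an object under $E$). It has a right adjoint $p^!:E/\mathcal{C}\to B/\mathcal{C}$, $\psi\mapsto\psi p$. The morphism $p$ is an effective codescent morphism in $\mathcal{C}$ if $p_*$ is comonadic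 (the comparison functor from $B/\mathcal{C}$ to the category of coalgebras of the comonad $p_*p^!$ on $E/\mathcal{C}$ is an equivalence); equivalently, $p$ is an effective descent morphism in $\mathcal{C}^{\mathrm{op}}$. Pushouts are taken in the category $\mathcal{C}$ in question (commutative rings or ternary rings, respectively). *)

(* Defs.v *)
From HB Require Import structures.
From mathcomp Require Import all_boot all_order all_algebra.
From mathcomp Require Import boolp.

Set Implicit Arguments.
Unset Strict Implicit.
Unset Printing Implicit Defensive.

Import GRing.Theory.
Local Open Scope ring_scope.

Declare Scope cat_scope.
Delimit Scope cat_scope with cat.
Local Open Scope cat_scope.

Record category := Category {
  obj :> Type;
  hom : obj -> obj -> Type;
  idm : forall X, hom X X;
  cmp : forall X Y Z, hom Y Z -> hom X Y -> hom X Z;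
  cmp1m : forall X Y (f : hom X Y), cmp (idm Y) f = f;
  cmpm1 : forall X Y (f : hom X Y), cmp f (idm X) = f;
  cmpA : forall X Y Z T (h : hom Z T) (g : hom Y Z) (f : hom X Y),
    cmp h (cmp g f) = cmp (cmp h g) f }.

Arguments hom {c} X Y.
Arguments idm {c} X.
Arguments cmp {c X Y Z} g f.
Notation "g ∘ f" := (cmp g f) (at level 40, left associativity) : cat_scope.

Definition is_iso (C : category) (X Y : C) (f : hom X Y) : Prop :=
  exists g : hom Y X, g ∘ f = idm X /\ f ∘ g = idm Y.

Record functor (C D : category) := Functor {
  fobj :> C -> D;
  fmap : forall X Y, hom X Y -> hom (fobj X) (fobj Y);
  fmap_id : forall X, fmap (idm X) = idm (fobj X);
  fmap_cmp : forall X Y Z (g : hom Y Z) (f : hom X Y),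
    fmap (g ∘ f) = fmap g ∘ fmap f }.

Arguments fmap {C D} F {X Y} f : rename.

Definition functor_id (C : category) : functor C C :=
  @Functor C C (fun X => X) (fun X Y f => f) (fun X => erefl)
    (fun X Y Z g f => erefl).

Lemma functor_cmp_id (C D E : category) (G : functor D E) (F : functor C D) X :
  fmap G (fmap F (idm X)) = idm (G (F X)).
Proof. by rewrite !fmap_id. Qed.

Lemma functor_cmp_cmp (C D E : category) (G : functor D E) (F : functor C D)
    (X Y Z : C) (g : hom Y Z) (f : hom X Y) :
  fmap G (fmap F (g ∘ f)) = fmap G (fmap F g) ∘ fmap G (fmap F f).
Proof. by rewrite !fmap_cmp. Qed.

Definition functor_cmp (C D E : category) (G : functor D E) (F : functor C D) :
    functor C E :=
  @Functor C E (fun X => G (F X)) (fun X Y f => fmap G (fmap F f))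
    (functor_cmp_id G F) (functor_cmp_cmp G F).

Record nattrans (C D : category) (F G : functor C D) := NatTrans {
  ncomp :> forall X, hom (F X) (G X);
  naturality : forall X Y (f : hom X Y),
    ncomp Y ∘ fmap F f = fmap G f ∘ ncomp X }.

Definition naturally_isomorphic (C D : category) (F G : functor C D) : Prop :=
  exists a : nattrans F G, forall X, is_iso (a X).

Definition is_equivalence (C D : category) (F : functor C D) : Prop :=
  exists G : functor D C,
    naturally_isomorphic (functor_cmp G F) (functor_id C) /\
    naturally_isomorphic (functor_cmp F G) (functor_id D).

Record adjunction (C D : category) (F : functor C D) (G : functor D C) :=
  Adjunction {
    adj_unit : nattrans (functor_id C) (functor_cmp G F);
    adj_counit : nattrans (functor_cmp F G) (functor_id D);
    adj_triangleL : forall X, adj_counit (F X) ∘ fmap F (adj_unit X) = idm (F X);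
    adj_triangleR : forall Y, fmap G (adj_counit Y) ∘ adj_unit (G Y) = idm (G Y) }.

Record comonad (C : category) := Comonad {
  cofun :> functor C C;
  extract : nattrans cofun (functor_id C);
  duplicate : nattrans cofun (functor_cmp cofun cofun);
  extract_duplicate : forall X, extract (cofun X) ∘ duplicate X = idm (cofun X);
  fmap_extract_duplicate : forall X,
    fmap cofun (extract X) ∘ duplicate X = idm (cofun X);
  duplicate_duplicate : forall X,
    duplicate (cofun X) ∘ duplicate X
    = fmap cofun (duplicate X) ∘ duplicate X }.

Record coalgebra (C : category) (W : comonad C) := Coalgebra {
  carrier : C;
  coact : hom carrier (W carrier);
  coact_extract : extract W carrier ∘ coact = idm carrier;
  coact_duplicate : duplicate W carrier ∘ coact = fmap W coact ∘ coact }.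

Record coalgebra_hom (C : category) (W : comonad C) (A B : coalgebra W) :=
  CoalgebraHom {
    cohom_val :> hom (carrier A) (carrier B);
    cohom_coact : coact B ∘ cohom_val = fmap W cohom_val ∘ coact A }.

Lemma coalgebra_hom_eq (C : category) (W : comonad C) (A B : coalgebra W)
    (f g : coalgebra_hom A B) : cohom_val f = cohom_val g -> f = g.
Proof.
case: f g => [f Hf] [g Hg] /= e; case: _ / e Hg => Hg.
by congr CoalgebraHom; apply: Prop_irrelevance.
Qed.

Section CoalgebraCategory.
Variables (C : category) (W : comonad C).

Lemma coalgebra_id_coact (A : coalgebra W) :
  coact A ∘ idm _ = fmap W (idm _) ∘ coact A.
Proof. by rewrite fmap_id cmp1m cmpm1. Qed.

Lemma coalgebra_cmp_coact (X Y Z : coalgebra W)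
    (g : coalgebra_hom Y Z) (f : coalgebra_hom X Y) :
  coact Z ∘ (g ∘ f) = fmap W (g ∘ f) ∘ coact X.
Proof. by rewrite fmap_cmp cmpA cohom_coact -cmpA cohom_coact cmpA. Qed.

Definition coalgebra_category : category.
Proof.
refine (@Category (coalgebra W) (@coalgebra_hom C W)
  (fun A => CoalgebraHom (coalgebra_id_coact A))
  (fun X Y Z g f => CoalgebraHom (coalgebra_cmp_coact g f)) _ _ _).
- by move=> X Y f; apply: coalgebra_hom_eq; apply: cmp1m.
- by move=> X Y f; apply: coalgebra_hom_eq; apply: cmpm1.
- by move=> X Y Z T h g f; apply: coalgebra_hom_eq; apply: cmpA.
Defined.

End CoalgebraCategory.

Section Comparison.
Variables (C D : category) (F : functor C D) (G : functor D C).
Variable adj : adjunction F G.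

Definition adj_duplicate :
  nattrans (functor_cmp F G) (functor_cmp (functor_cmp F G) (functor_cmp F G)).
Proof.
refine (@NatTrans D D (functor_cmp F G)
          (functor_cmp (functor_cmp F G) (functor_cmp F G))
          (fun Y => fmap F (adj_unit adj (G Y))) _).
by move=> X Y f /=; rewrite -!fmap_cmp -(naturality (adj_unit adj)).
Defined.

Definition adj_comonad : comonad D.
Proof.
refine (@Comonad D (functor_cmp F G) (adj_counit adj) adj_duplicate _ _ _).
- by move=> Y /=; rewrite adj_triangleL.
- by move=> Y /=; rewrite -fmap_cmp adj_triangleR fmap_id.
- by move=> Y /=; rewrite -!fmap_cmp -(naturality (adj_unit adj)).
Defined.

Definition comparison_obj (X : C) : coalgebra adj_comonad.
Proof.
refine (@Coalgebra D adj_comonad (F X) (fmap F (adj_unit adj X)) _ _).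
- exact: adj_triangleL.
- by rewrite /= -!fmap_cmp -(naturality (adj_unit adj)).
Defined.

Definition comparison_fmap (X Y : C) (f : hom X Y) :
  coalgebra_hom (comparison_obj X) (comparison_obj Y).
Proof.
refine (@CoalgebraHom D adj_comonad (comparison_obj X) (comparison_obj Y)
          (fmap F f) _).
by rewrite /= -!fmap_cmp -(naturality (adj_unit adj)).
Defined.

Definition comparison : functor C (coalgebra_category adj_comonad).
Proof.
refine (@Functor C (coalgebra_category adj_comonad)
          comparison_obj comparison_fmap _ _).
- by move=> X; apply: coalgebra_hom_eq; apply: fmap_id.
- by move=> X Y Z g f; apply: coalgebra_hom_eq; apply: fmap_cmp.
Defined.

Definition is_comonadic : Prop := is_equivalence comparison.

End Comparison.

Record coslice_obj (C : category) (B : C) := CosliceObj {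
  under : C;
  arrow : hom B under }.

Arguments CosliceObj {C B under} arrow.

Record coslice_hom (C : category) (B : C) (X Y : coslice_obj B) := CosliceHom {
  cosl_val :> hom (under X) (under Y);
  cosl_arrow : cosl_val ∘ arrow X = arrow Y }.

Lemma coslice_hom_eq (C : category) (B : C) (X Y : coslice_obj B)
    (f g : coslice_hom X Y) : cosl_val f = cosl_val g -> f = g.
Proof.
case: f g => [f Hf] [g Hg] /= e; case: _ / e Hg => Hg.
by congr CosliceHom; apply: Prop_irrelevance.
Qed.

Section Coslice.
Variables (C : category) (B : C).

Lemma coslice_cmp_arrow (X Y Z : coslice_obj B)
    (g : coslice_hom Y Z) (f : coslice_hom X Y) : (g ∘ f) ∘ arrow X = arrow Z.
Proof. by rewrite -cmpA !cosl_arrow. Qed.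

Definition coslice : category.
Proof.
refine (@Category (coslice_obj B) (@coslice_hom C B)
  (fun X => CosliceHom (cmp1m (arrow X)))
  (fun X Y Z g f => CosliceHom (coslice_cmp_arrow g f)) _ _ _).
- by move=> X Y f; apply: coslice_hom_eq; apply: cmp1m.
- by move=> X Y f; apply: coslice_hom_eq; apply: cmpm1.
- by move=> X Y Z T h g f; apply: coslice_hom_eq; apply: cmpA.
Defined.

End Coslice.

Record pushout (C : category) (B E D : C) (p : hom B E) (f : hom B D) :=
  Pushout {
    po_obj : C;
    po_inl : hom E po_obj;
    po_inr : hom D po_obj;
    po_square : po_inl ∘ p = po_inr ∘ f;
    po_desc : forall (X : C) (u : hom E X) (v : hom D X),
      u ∘ p = v ∘ f -> hom po_obj X;
    po_desc_inl : forall X u v e, @po_desc X u v e ∘ po_inl = u;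
    po_desc_inr : forall X u v e, @po_desc X u v e ∘ po_inr = v;
    po_unique : forall (X : C) (w w' : hom po_obj X),
      w ∘ po_inl = w' ∘ po_inl -> w ∘ po_inr = w' ∘ po_inr -> w = w' }.

Arguments po_desc {C B E D p f} _ {X u v} e.

(* A choice of pushouts; the functors [cobase] for two choices are naturally
   isomorphic. *)
Definition has_pushouts (C : category) : Type :=
  forall (B E D : C) (p : hom B E) (f : hom B D), pushout p f.

Section Codescent.
Variables (C : category) (po : has_pushouts C) (B E : C) (p : hom B E).

Definition cobase_obj (X : coslice B) : coslice E :=
  CosliceObj (po_inl (po p (arrow X))).

Lemma cobase_fmap_proof (X Y : coslice B) (f : hom X Y) :
  po_inl (po p (arrow Y)) ∘ p
  = (po_inr (po p (arrow Y)) ∘ cosl_val f) ∘ arrow X.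
Proof. by rewrite -cmpA cosl_arrow po_square. Qed.

Definition cobase_fmap (X Y : coslice B) (f : hom X Y) :
  hom (cobase_obj X) (cobase_obj Y) :=
  @CosliceHom C E (cobase_obj X) (cobase_obj Y)
    (po_desc (po p (arrow X)) (cobase_fmap_proof f)) (po_desc_inl _ _).

(* p_* : B/C -> E/C *)
Definition cobase : functor (coslice B) (coslice E).
Proof.
refine (@Functor (coslice B) (coslice E) cobase_obj cobase_fmap _ _).
- move=> X; apply: coslice_hom_eq; apply: po_unique => /=.
  + by rewrite po_desc_inl cmp1m.
  + by rewrite po_desc_inr cmp1m cmpm1.
- move=> X Y Z g f; apply: coslice_hom_eq; apply: po_unique => /=.
  + by rewrite po_desc_inl -cmpA !po_desc_inl.
  + rewrite po_desc_inr -[RHS]cmpA (po_desc_inr _ (cobase_fmap_proof f)).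
    by rewrite [RHS]cmpA (po_desc_inr _ (cobase_fmap_proof g)) cmpA.
Defined.

Definition precompose_obj (Y : coslice E) : coslice B :=
  CosliceObj (arrow Y ∘ p).

Lemma precompose_fmap_proof (X Y : coslice E) (f : hom X Y) :
  cosl_val f ∘ (arrow X ∘ p) = arrow Y ∘ p.
Proof. by rewrite cmpA cosl_arrow. Qed.

(* p^! : E/C -> B/C *)
Definition precompose : functor (coslice E) (coslice B).
Proof.
refine (@Functor (coslice E) (coslice B) precompose_obj
  (fun X Y f => @CosliceHom C B (precompose_obj X) (precompose_obj Y)
                  (cosl_val f) (precompose_fmap_proof f)) _ _).
- by move=> X; apply: coslice_hom_eq.
- by move=> X Y Z g f; apply: coslice_hom_eq.
Defined.

Definition cobase_unit :
  nattrans (functor_id (coslice B)) (functor_cmp precompose cobase).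
Proof.
refine (@NatTrans _ _ (functor_id (coslice B)) (functor_cmp precompose cobase)
  (fun X => @CosliceHom C B X (precompose_obj (cobase_obj X))
              (po_inr (po p (arrow X))) (esym (po_square _))) _).
by move=> X Y f; apply: coslice_hom_eq; rewrite /= po_desc_inr.
Defined.

Lemma cobase_counit_proof (Y : coslice E) :
  arrow Y ∘ p = idm (under Y) ∘ (arrow Y ∘ p).
Proof. by rewrite cmp1m. Qed.

Definition cobase_counit :
  nattrans (functor_cmp cobase precompose) (functor_id (coslice E)).
Proof.
refine (@NatTrans _ _ (functor_cmp cobase precompose) (functor_id (coslice E))
  (fun Y => @CosliceHom C E (cobase_obj (precompose_obj Y)) Y
      (po_desc (po p (arrow Y ∘ p)) (cobase_counit_proof Y))
      (po_desc_inl _ _)) _).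
move=> X Y f; apply: coslice_hom_eq; apply: po_unique => /=.
- by rewrite -!cmpA !po_desc_inl cosl_arrow.
- by rewrite -!cmpA !po_desc_inr cmpA po_desc_inr cmp1m cmpm1.
Defined.

Definition cobase_adjunction : adjunction cobase precompose.
Proof.
refine (@Adjunction _ _ cobase precompose cobase_unit cobase_counit _ _).
- move=> X; apply: coslice_hom_eq; apply: po_unique => /=.
  + by rewrite -cmpA !po_desc_inl cmp1m.
  + by rewrite -cmpA !po_desc_inr cmpA po_desc_inr.
- by move=> Y; apply: coslice_hom_eq; rewrite /= po_desc_inr.
Defined.

Definition effective_codescent : Prop := is_comonadic cobase_adjunction.

End Codescent.

Lemma rmorphism_eq (R S : pzRingType) (f g : {rmorphism R -> S}) :
  f =1 g -> f = g.
Proof.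
case: f g => [f [[Hf1] [Hf2]]] [g [[Hg1] [Hg2]]] /= /funext e.
case: _ / e Hg1 Hg2 => Hg1 Hg2.
by rewrite (Prop_irrelevance Hf1 Hg1) (Prop_irrelevance Hf2 Hg2).
Qed.

(* comPzRingType rather than comNzRingType: the zero ring is an object, and it
   does occur as a pushout of nonzero rings. *)
Definition comring : category.
Proof.
refine (@Category comPzRingType (fun R S => {rmorphism R -> S})
  (fun R => idfun : {rmorphism R -> R})
  (fun R S T g f => (g \o f)%FUN : {rmorphism R -> T}) _ _ _).
- by move=> R S f; apply: rmorphism_eq.
- by move=> R S f; apply: rmorphism_eq.
- by move=> R S T U h g f; apply: rmorphism_eq.
Defined.

Section ComringPushout.
Variables (B E D : comPzRingType) (p : {rmorphism B -> E})
  (f : {rmorphism B -> D}).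

(* Formal ring expressions in the elements of E and D; their quotient by
   [comring_cong] is E \otimes_B D. *)
Inductive comring_term :=
  | CRl of E
  | CRr of D
  | CRadd of comring_term & comring_term
  | CRopp of comring_term
  | CRmul of comring_term & comring_term.

Inductive comring_cong : comring_term -> comring_term -> Prop :=
  | cr_refl x : comring_cong x x
  | cr_sym x y : comring_cong x y -> comring_cong y x
  | cr_trans x y z : comring_cong x y -> comring_cong y z -> comring_cong x z
  | cr_add x x' y y' : comring_cong x x' -> comring_cong y y' ->
      comring_cong (CRadd x y) (CRadd x' y')
  | cr_opp x x' : comring_cong x x' -> comring_cong (CRopp x) (CRopp x')
  | cr_mul x x' y y' : comring_cong x x' -> comring_cong y y' ->
      comring_cong (CRmul x y) (CRmul x' y')
  | cr_addA x y z :
      comring_cong (CRadd x (CRadd y z)) (CRadd (CRadd x y) z)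
  | cr_addC x y : comring_cong (CRadd x y) (CRadd y x)
  | cr_add0 x : comring_cong (CRadd (CRl 0) x) x
  | cr_addN x : comring_cong (CRadd (CRopp x) x) (CRl 0)
  | cr_mulA x y z :
      comring_cong (CRmul x (CRmul y z)) (CRmul (CRmul x y) z)
  | cr_mulC x y : comring_cong (CRmul x y) (CRmul y x)
  | cr_mul1 x : comring_cong (CRmul (CRl 1) x) x
  | cr_mulD x y z : comring_cong (CRmul (CRadd x y) z)
      (CRadd (CRmul x z) (CRmul y z))
  | cr_lD a b : comring_cong (CRl (a + b)) (CRadd (CRl a) (CRl b))
  | cr_lM a b : comring_cong (CRl (a * b)) (CRmul (CRl a) (CRl b))
  | cr_rD a b : comring_cong (CRr (a + b)) (CRadd (CRr a) (CRr b))
  | cr_rM a b : comring_cong (CRr (a * b)) (CRmul (CRr a) (CRr b))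
  | cr_r1 : comring_cong (CRr 1) (CRl 1)
  | cr_glue b : comring_cong (CRl (p b)) (CRr (f b)).

Definition comring_rel : rel {classic comring_term} :=
  fun x y => `[< comring_cong x y >].

Lemma comring_rel_equiv : equiv_class_of comring_rel.
Proof.
split.
- by move=> x; apply/asboolP; apply: cr_refl.
- by move=> x y; apply: asbool_equiv_eq; split; apply: cr_sym.
- move=> y x z /asboolP xy /asboolP yz; apply/asboolP; exact: cr_trans xy yz.
Qed.

Canonical comring_equiv := EquivRelPack comring_rel_equiv.

Definition comring_tensor := {eq_quot comring_equiv}%qT.
HB.instance Definition _ := Choice.on comring_tensor.
HB.instance Definition _ := EqQuotient.on comring_tensor.

Definition cr_pi (x : comring_term) : comring_tensor :=
  \pi_comring_tensor%qT (x : {classic comring_term}).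

Lemma cr_piP x y : comring_cong x y -> cr_pi x = cr_pi y.
Proof. by move=> h; apply/eqmodP/asboolP. Qed.

Lemma cr_pi_eq x y : cr_pi x = cr_pi y -> comring_cong x y.
Proof. by move/eqmodP/asboolP. Qed.

Definition cr_repr (x : comring_tensor) : comring_term := repr x.

Lemma cr_reprK x : cr_pi (cr_repr x) = x.
Proof. exact: reprK. Qed.

Lemma cr_repr_pi x : comring_cong (cr_repr (cr_pi x)) x.
Proof. by apply: cr_pi_eq; apply: cr_reprK. Qed.

Definition cr_addq (x y : comring_tensor) := cr_pi (CRadd (cr_repr x) (cr_repr y)).
Definition cr_mulq (x y : comring_tensor) := cr_pi (CRmul (cr_repr x) (cr_repr y)).
Definition cr_oppq (x : comring_tensor) := cr_pi (CRopp (cr_repr x)).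

Lemma cr_addqE x y : cr_addq (cr_pi x) (cr_pi y) = cr_pi (CRadd x y).
Proof. by apply: cr_piP; apply: cr_add; apply: cr_repr_pi. Qed.
Lemma cr_mulqE x y : cr_mulq (cr_pi x) (cr_pi y) = cr_pi (CRmul x y).
Proof. by apply: cr_piP; apply: cr_mul; apply: cr_repr_pi. Qed.
Lemma cr_oppqE x : cr_oppq (cr_pi x) = cr_pi (CRopp x).
Proof. by apply: cr_piP; apply: cr_opp; apply: cr_repr_pi. Qed.

Let crE := (cr_addqE, cr_mulqE, cr_oppqE).

Lemma cr_addqA : associative cr_addq.
Proof.
move=> x y z; rewrite -(cr_reprK x) -(cr_reprK y) -(cr_reprK z) !crE.
by apply: cr_piP; apply: cr_addA.
Qed.
Lemma cr_addqC : commutative cr_addq.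
Proof. by move=> x y; apply: cr_piP; apply: cr_addC. Qed.
Lemma cr_add0q : left_id (cr_pi (CRl 0)) cr_addq.
Proof.
by move=> x; rewrite -(cr_reprK x) crE; apply: cr_piP; apply: cr_add0.
Qed.
Lemma cr_addNq : left_inverse (cr_pi (CRl 0)) cr_oppq cr_addq.
Proof.
by move=> x; rewrite -(cr_reprK x) !crE; apply: cr_piP; apply: cr_addN.
Qed.

HB.instance Definition _ := GRing.isZmodule.Build comring_tensor
  cr_addqA cr_addqC cr_add0q cr_addNq.

Lemma cr_mulqA : associative cr_mulq.
Proof.
move=> x y z; rewrite -(cr_reprK x) -(cr_reprK y) -(cr_reprK z) !crE.
by apply: cr_piP; apply: cr_mulA.
Qed.
Lemma cr_mulqC : commutative cr_mulq.
Proof. by move=> x y; apply: cr_piP; apply: cr_mulC. Qed.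
Lemma cr_mul1q : left_id (cr_pi (CRl 1)) cr_mulq.
Proof.
by move=> x; rewrite -(cr_reprK x) crE; apply: cr_piP; apply: cr_mul1.
Qed.
Lemma cr_mulqDl : left_distributive cr_mulq cr_addq.
Proof.
move=> x y z; rewrite -(cr_reprK x) -(cr_reprK y) -(cr_reprK z) !crE.
by apply: cr_piP; apply: cr_mulD.
Qed.

HB.instance Definition _ := GRing.Zmodule_isComPzRing.Build comring_tensor
  cr_mulqA cr_mulqC cr_mul1q cr_mulqDl.

Definition cr_inl (x : E) : comring_tensor := cr_pi (CRl x).
Definition cr_inr (x : D) : comring_tensor := cr_pi (CRr x).

Lemma cr_inl_zmod : zmod_morphism cr_inl.
Proof.
have addE x y : cr_inl (x + y) = cr_inl x + cr_inl y.
  by rewrite [RHS]cr_addqE; apply: cr_piP; apply: cr_lD.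
by move=> x y; apply: (addIr (cr_inl y)); rewrite subrK -addE subrK.
Qed.
Lemma cr_inl_monoid : monoid_morphism cr_inl.
Proof.
split=> // x y; rewrite [RHS]cr_mulqE; apply: cr_piP; exact: cr_lM.
Qed.
HB.instance Definition _ :=
  GRing.isZmodMorphism.Build E comring_tensor cr_inl cr_inl_zmod.
HB.instance Definition _ :=
  GRing.isMonoidMorphism.Build E comring_tensor cr_inl cr_inl_monoid.

Lemma cr_inr_zmod : zmod_morphism cr_inr.
Proof.
have addE x y : cr_inr (x + y) = cr_inr x + cr_inr y.
  by rewrite [RHS]cr_addqE; apply: cr_piP; apply: cr_rD.
by move=> x y; apply: (addIr (cr_inr y)); rewrite subrK -addE subrK.
Qed.
Lemma cr_inr_monoid : monoid_morphism cr_inr.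
Proof.
split=> [|x y]; first by apply: cr_piP; apply: cr_r1.
by rewrite [RHS]cr_mulqE; apply: cr_piP; apply: cr_rM.
Qed.
HB.instance Definition _ :=
  GRing.isZmodMorphism.Build D comring_tensor cr_inr cr_inr_zmod.
HB.instance Definition _ :=
  GRing.isMonoidMorphism.Build D comring_tensor cr_inr cr_inr_monoid.

Section Desc.
Variables (X : comPzRingType) (u : {rmorphism E -> X}) (v : {rmorphism D -> X}).
Hypothesis uv : forall b, u (p b) = v (f b).

Fixpoint cr_eval (x : comring_term) : X :=
  match x with
  | CRl a => u a
  | CRr a => v a
  | CRadd x y => cr_eval x + cr_eval y
  | CRopp x => - cr_eval x
  | CRmul x y => cr_eval x * cr_eval y
  end.

Lemma cr_eval_cong x y : comring_cong x y -> cr_eval x = cr_eval y.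
Proof.
elim=> //=.
- by move=> {}x {}y z _ -> _ ->.
- by move=> {}x x' {}y y' _ -> _ ->.
- by move=> {}x x' _ ->.
- by move=> {}x x' {}y y' _ -> _ ->.
- by move=> *; rewrite addrA.
- by move=> *; rewrite addrC.
- by move=> *; rewrite rmorph0 add0r.
- by move=> *; rewrite rmorph0 addNr.
- by move=> *; rewrite mulrA.
- by move=> *; rewrite mulrC.
- by move=> *; rewrite rmorph1 mul1r.
- by move=> *; rewrite mulrDl.
- by move=> *; rewrite rmorphD.
- by move=> *; rewrite rmorphM.
- by move=> *; rewrite rmorphD.
- by move=> *; rewrite rmorphM.
- by rewrite !rmorph1.
Qed.

Definition cr_desc (x : comring_tensor) : X := cr_eval (cr_repr x).

Lemma cr_descE x : cr_desc (cr_pi x) = cr_eval x.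
Proof. by apply: cr_eval_cong; apply: cr_repr_pi. Qed.

Lemma cr_desc_zmod : zmod_morphism cr_desc.
Proof.
move=> x y; rewrite -(cr_reprK x) -(cr_reprK y).
by rewrite [X in cr_desc (_ + X)]cr_oppqE [X in cr_desc X]cr_addqE !cr_descE.
Qed.
Lemma cr_desc_monoid : monoid_morphism cr_desc.
Proof.
split=> [|x y]; first by rewrite [LHS]cr_descE /= rmorph1.
rewrite -(cr_reprK x) -(cr_reprK y).
by rewrite [X in cr_desc X]cr_mulqE !cr_descE.
Qed.
Definition cr_desc_rmorphism : {rmorphism comring_tensor -> X} :=
  HB.pack cr_desc
    (GRing.isZmodMorphism.Build comring_tensor X cr_desc cr_desc_zmod)
    (GRing.isMonoidMorphism.Build comring_tensor X cr_desc cr_desc_monoid).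

End Desc.

Lemma cr_unique (X : comPzRingType) (w w' : {rmorphism comring_tensor -> X}) :
  (forall x, w (cr_inl x) = w' (cr_inl x)) ->
  (forall x, w (cr_inr x) = w' (cr_inr x)) -> w =1 w'.
Proof.
move=> hl hr x; rewrite -(cr_reprK x).
elim: (cr_repr x) => [a|a|y IHy z IHz|y IHy|y IHy z IHz].
- exact: hl.
- exact: hr.
- by rewrite -cr_addqE [LHS](rmorphD w) [RHS](rmorphD w') IHy IHz.
- by rewrite -cr_oppqE [LHS](rmorphN w) [RHS](rmorphN w') IHy.
- by rewrite -cr_mulqE [LHS](rmorphM w) [RHS](rmorphM w') IHy IHz.
Qed.

End ComringPushout.

Arguments CRl {E D} _.
Arguments CRr {E D} _.

Lemma comring_hom_app (R S : comring) (f g : hom R S) (x : (R : comPzRingType)) :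
  f = g -> (f : {rmorphism _ -> _}) x = (g : {rmorphism _ -> _}) x.
Proof. by move->. Qed.

Definition comring_pushouts : has_pushouts comring.
Proof.
move=> B E D p f.
refine (@Pushout comring B E D p f (comring_tensor p f : comPzRingType)
  (cr_inl p f : {rmorphism _ -> _}) (cr_inr p f : {rmorphism _ -> _}) _
  (fun X u v e => cr_desc_rmorphism (fun b => comring_hom_app b e)) _ _ _).
- by apply: rmorphism_eq => b; apply: cr_piP; apply: cr_glue.
- move=> X u v e; apply: rmorphism_eq => x.
  exact: (cr_descE (fun b => comring_hom_app b e) (CRl x)).
- move=> X u v e; apply: rmorphism_eq => x.
  exact: (cr_descE (fun b => comring_hom_app b e) (CRr x)).
- move=> X w w' el er; apply: rmorphism_eq; apply: cr_unique => x.
  + exact: comring_hom_app el.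
  + exact: comring_hom_app er.
Defined.

Record ternary_ring := TernaryRing {
  tcarrier :> Type;
  tt : tcarrier -> tcarrier -> tcarrier -> tcarrier;
  tq : tcarrier -> tcarrier -> tcarrier -> tcarrier;
  tzero : tcarrier;
  tone : tcarrier;
  tt0l : forall x y, tt tzero x y = y;
  tt0r : forall x y, tt x tzero y = y;
  tt1l : forall x, tt tone x tzero = x;
  tt1r : forall x, tt x tone tzero = x;
  tqt : forall x y z, tq x y (tt x y z) = z;
  ttq : forall x y z, tt x y (tq x y z) = z }.

Arguments tt {t} x y z : rename.
Arguments tq {t} x y z : rename.
Arguments tzero {t}.
Arguments tone {t}.

Record ternary_hom (A B : ternary_ring) := TernaryHom {
  tfun :> A -> B;
  tfun_t : forall x y z, tfun (tt x y z) = tt (tfun x) (tfun y) (tfun z);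
  tfun_q : forall x y z, tfun (tq x y z) = tq (tfun x) (tfun y) (tfun z);
  tfun_0 : tfun tzero = tzero;
  tfun_1 : tfun tone = tone }.

Lemma ternary_hom_eq (A B : ternary_ring) (f g : ternary_hom A B) :
  f =1 g -> f = g.
Proof.
case: f g => [f f1 f2 f3 f4] [g g1 g2 g3 g4] /= /funext e.
case: _ / e g1 g2 g3 g4 => g1 g2 g3 g4.
by congr TernaryHom; apply: Prop_irrelevance.
Qed.

Definition ternary_id (A : ternary_ring) : ternary_hom A A.
Proof. by refine (@TernaryHom A A (fun x => x) _ _ _ _). Defined.

Definition ternary_cmp (A B C : ternary_ring) (g : ternary_hom B C)
  (f : ternary_hom A B) : ternary_hom A C.
Proof.
refine (@TernaryHom A C (fun x => g (f x)) _ _ _ _).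
- by move=> x y z; rewrite !tfun_t.
- by move=> x y z; rewrite !tfun_q.
- by rewrite !tfun_0.
- by rewrite !tfun_1.
Defined.

Definition ternary : category.
Proof.
refine (@Category ternary_ring ternary_hom ternary_id ternary_cmp _ _ _).
- by move=> A B f; apply: ternary_hom_eq.
- by move=> A B f; apply: ternary_hom_eq.
- by move=> A B C D h g f; apply: ternary_hom_eq.
Defined.

Section TernaryPushout.
Variables (B E D : ternary_ring) (p : ternary_hom B E) (f : ternary_hom B D).

Inductive ternary_term :=
  | TRl of E
  | TRr of D
  | TRt of ternary_term & ternary_term & ternary_term
  | TRq of ternary_term & ternary_term & ternary_term.

Inductive ternary_cong : ternary_term -> ternary_term -> Prop :=
  | tr_refl x : ternary_cong x x
  | tr_sym x y : ternary_cong x y -> ternary_cong y x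
  | tr_trans x y z : ternary_cong x y -> ternary_cong y z -> ternary_cong x z
  | tr_t x x' y y' z z' :
      ternary_cong x x' -> ternary_cong y y' -> ternary_cong z z' ->
      ternary_cong (TRt x y z) (TRt x' y' z')
  | tr_q x x' y y' z z' :
      ternary_cong x x' -> ternary_cong y y' -> ternary_cong z z' ->
      ternary_cong (TRq x y z) (TRq x' y' z')
  | tr_t0l x y : ternary_cong (TRt (TRl tzero) x y) y
  | tr_t0r x y : ternary_cong (TRt x (TRl tzero) y) y
  | tr_t1l x : ternary_cong (TRt (TRl tone) x (TRl tzero)) x
  | tr_t1r x : ternary_cong (TRt x (TRl tone) (TRl tzero)) x
  | tr_qt x y z : ternary_cong (TRq x y (TRt x y z)) z
  | tr_tq x y z : ternary_cong (TRt x y (TRq x y z)) z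
  | tr_lt a b c :
      ternary_cong (TRl (tt a b c)) (TRt (TRl a) (TRl b) (TRl c))
  | tr_lq a b c :
      ternary_cong (TRl (tq a b c)) (TRq (TRl a) (TRl b) (TRl c))
  | tr_rt a b c :
      ternary_cong (TRr (tt a b c)) (TRt (TRr a) (TRr b) (TRr c))
  | tr_rq a b c :
      ternary_cong (TRr (tq a b c)) (TRq (TRr a) (TRr b) (TRr c))
  | tr_r0 : ternary_cong (TRr tzero) (TRl tzero)
  | tr_r1 : ternary_cong (TRr tone) (TRl tone)
  | tr_glue b : ternary_cong (TRl (p b)) (TRr (f b)).

Definition ternary_rel : rel {classic ternary_term} :=
  fun x y => `[< ternary_cong x y >].

Lemma ternary_rel_equiv : equiv_class_of ternary_rel.
Proof.
split.
- by move=> x; apply/asboolP; apply: tr_refl.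
- by move=> x y; apply: asbool_equiv_eq; split; apply: tr_sym.
- move=> y x z /asboolP xy /asboolP yz; apply/asboolP; exact: tr_trans xy yz.
Qed.

Canonical ternary_equiv := EquivRelPack ternary_rel_equiv.

Definition ternary_quot := {eq_quot ternary_equiv}%qT.
HB.instance Definition _ := Choice.on ternary_quot.
HB.instance Definition _ := EqQuotient.on ternary_quot.

Definition tr_pi (x : ternary_term) : ternary_quot :=
  \pi_ternary_quot%qT (x : {classic ternary_term}).

Lemma tr_piP x y : ternary_cong x y -> tr_pi x = tr_pi y.
Proof. by move=> h; apply/eqmodP/asboolP. Qed.

Lemma tr_pi_eq x y : tr_pi x = tr_pi y -> ternary_cong x y.
Proof. by move/eqmodP/asboolP. Qed.

Definition tr_repr (x : ternary_quot) : ternary_term := repr x.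

Lemma tr_reprK x : tr_pi (tr_repr x) = x.
Proof. exact: reprK. Qed.

Lemma tr_repr_pi x : ternary_cong (tr_repr (tr_pi x)) x.
Proof. by apply: tr_pi_eq; apply: tr_reprK. Qed.

Definition tr_tquot (x y z : ternary_quot) :=
  tr_pi (TRt (tr_repr x) (tr_repr y) (tr_repr z)).
Definition tr_qquot (x y z : ternary_quot) :=
  tr_pi (TRq (tr_repr x) (tr_repr y) (tr_repr z)).

Lemma tr_tquotE x y z :
  tr_tquot (tr_pi x) (tr_pi y) (tr_pi z) = tr_pi (TRt x y z).
Proof. by apply: tr_piP; apply: tr_t; apply: tr_repr_pi. Qed.
Lemma tr_qquotE x y z :
  tr_qquot (tr_pi x) (tr_pi y) (tr_pi z) = tr_pi (TRq x y z).
Proof. by apply: tr_piP; apply: tr_q; apply: tr_repr_pi. Qed.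

Let trE := (tr_tquotE, tr_qquotE).

Definition ternary_po : ternary_ring.
Proof.
refine (@TernaryRing ternary_quot tr_tquot tr_qquot
  (tr_pi (TRl tzero)) (tr_pi (TRl tone)) _ _ _ _ _ _).
- move=> x y; rewrite -(tr_reprK x) -(tr_reprK y) !trE.
  by apply: tr_piP; apply: tr_t0l.
- move=> x y; rewrite -(tr_reprK x) -(tr_reprK y) !trE.
  by apply: tr_piP; apply: tr_t0r.
- move=> x; rewrite -(tr_reprK x) !trE.
  by apply: tr_piP; apply: tr_t1l.
- move=> x; rewrite -(tr_reprK x) !trE.
  by apply: tr_piP; apply: tr_t1r.
- move=> x y z; rewrite -(tr_reprK x) -(tr_reprK y) -(tr_reprK z) !trE.
  by apply: tr_piP; apply: tr_qt.
- move=> x y z; rewrite -(tr_reprK x) -(tr_reprK y) -(tr_reprK z) !trE.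
  by apply: tr_piP; apply: tr_tq.
Defined.

Definition tr_inl : ternary_hom E ternary_po.
Proof.
refine (@TernaryHom E ternary_po (fun x => tr_pi (TRl x)) _ _ _ _) => //.
- by move=> x y z; rewrite [RHS]tr_tquotE; apply: tr_piP; apply: tr_lt.
- by move=> x y z; rewrite [RHS]tr_qquotE; apply: tr_piP; apply: tr_lq.
Defined.

Definition tr_inr : ternary_hom D ternary_po.
Proof.
refine (@TernaryHom D ternary_po (fun x => tr_pi (TRr x)) _ _ _ _).
- by move=> x y z; rewrite [RHS]tr_tquotE; apply: tr_piP; apply: tr_rt.
- by move=> x y z; rewrite [RHS]tr_qquotE; apply: tr_piP; apply: tr_rq.
- by apply: tr_piP; apply: tr_r0.
- by apply: tr_piP; apply: tr_r1.
Defined.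

Section Desc.
Variables (X : ternary_ring) (u : ternary_hom E X) (v : ternary_hom D X).
Hypothesis uv : forall b, u (p b) = v (f b).

Fixpoint tr_eval (x : ternary_term) : X :=
  match x with
  | TRl a => u a
  | TRr a => v a
  | TRt x y z => tt (tr_eval x) (tr_eval y) (tr_eval z)
  | TRq x y z => tq (tr_eval x) (tr_eval y) (tr_eval z)
  end.

Lemma tr_eval_cong x y : ternary_cong x y -> tr_eval x = tr_eval y.
Proof.
elim=> //=.
- by move=> {}x {}y z _ -> _ ->.
- by move=> {}x x' {}y y' z z' _ -> _ -> _ ->.
- by move=> {}x x' {}y y' z z' _ -> _ -> _ ->.
- by move=> *; rewrite tfun_0 tt0l.
- by move=> *; rewrite tfun_0 tt0r.
- by move=> *; rewrite tfun_0 tfun_1 tt1l.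
- by move=> *; rewrite tfun_0 tfun_1 tt1r.
- by move=> *; rewrite tqt.
- by move=> *; rewrite ttq.
- by move=> *; rewrite tfun_t.
- by move=> *; rewrite tfun_q.
- by move=> *; rewrite tfun_t.
- by move=> *; rewrite tfun_q.
- by rewrite !tfun_0.
- by rewrite !tfun_1.
Qed.

Lemma tr_evalE x : tr_eval (tr_repr (tr_pi x)) = tr_eval x.
Proof. by apply: tr_eval_cong; apply: tr_repr_pi. Qed.

Definition tr_desc : ternary_hom ternary_po X.
Proof.
refine (@TernaryHom ternary_po X (fun x => tr_eval (tr_repr x)) _ _ _ _).
- by move=> x y z; rewrite [LHS]tr_evalE.
- by move=> x y z; rewrite [LHS]tr_evalE.
- by rewrite [LHS]tr_evalE /= tfun_0.
- by rewrite [LHS]tr_evalE /= tfun_1.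
Defined.

End Desc.

Lemma tr_unique (X : ternary_ring) (w w' : ternary_hom ternary_po X) :
  (forall x, w (tr_inl x) = w' (tr_inl x)) ->
  (forall x, w (tr_inr x) = w' (tr_inr x)) -> w =1 w'.
Proof.
move=> hl hr x; rewrite -(tr_reprK x).
elim: (tr_repr x) => [a|a|a IHa b IHb c IHc|a IHa b IHb c IHc].
- exact: hl.
- exact: hr.
- by rewrite -tr_tquotE [LHS](tfun_t w) [RHS](tfun_t w') IHa IHb IHc.
- by rewrite -tr_qquotE [LHS](tfun_q w) [RHS](tfun_q w') IHa IHb IHc.
Qed.

End TernaryPushout.

Arguments TRl {E D} _.
Arguments TRr {E D} _.

Lemma ternary_hom_app (A B : ternary_ring) (f g : ternary_hom A B) (x : A) :
  f = g -> f x = g x.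
Proof. by move->. Qed.

Definition ternary_pushouts : has_pushouts ternary.
Proof.
move=> B E D p f.
refine (@Pushout ternary B E D p f (ternary_po p f) (tr_inl p f) (tr_inr p f) _
  (fun X u v e => tr_desc (fun b => ternary_hom_app b e)) _ _ _).
- by apply: ternary_hom_eq => b; apply: tr_piP; apply: tr_glue.
- move=> X u v e; apply: ternary_hom_eq => x.
  exact: (tr_evalE (fun b => ternary_hom_app b e) (TRl x)).
- move=> X u v e; apply: ternary_hom_eq => x.
  exact: (tr_evalE (fun b => ternary_hom_app b e) (TRr x)).
- move=> X w w' el er; apply: ternary_hom_eq; apply: tr_unique => x.
  + exact: ternary_hom_app el.
  + exact: ternary_hom_app er.
Defined.

Definition ternary_of_ring (R : pzRingType) : ternary_ring.
Proof.
refine (@TernaryRing R (fun a b c => a * b + c) (fun a b c => c - a * b) 0 1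
  _ _ _ _ _ _).
- by move=> x y; rewrite mul0r add0r.
- by move=> x y; rewrite mulr0 add0r.
- by move=> x; rewrite mul1r addr0.
- by move=> x; rewrite mulr1 addr0.
- by move=> x y z; rewrite addrC addKr.
- by move=> x y z; rewrite addrC subrK.
Defined.

Definition ternary_of_rmorphism (R S : pzRingType) (p : {rmorphism R -> S}) :
  ternary_hom (ternary_of_ring R) (ternary_of_ring S).
Proof.
refine (@TernaryHom (ternary_of_ring R) (ternary_of_ring S) p _ _ _ _).
- by move=> x y z /=; rewrite rmorphD rmorphM.
- by move=> x y z /=; rewrite rmorphB rmorphM.
- exact: rmorph0.
- exact: rmorph1.
Defined.

Definition comring_effective_codescent (R S : comPzRingType)
    (p : {rmorphism R -> S}) : Prop :=
  @effective_codescent comring comring_pushouts R S p.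

Definition ternary_effective_codescent (R S : comPzRingType)
    (p : {rmorphism R -> S}) : Prop :=
  @effective_codescent ternary ternary_pushouts
    (ternary_of_ring R) (ternary_of_ring S) (ternary_of_rmorphism p).

Definition is_ideal (R : comPzRingType) (I : R -> Prop) : Prop :=
  [/\ I 0, forall x y, I x -> I y -> I (x + y) & forall r x, I x -> I (r * x)].

Definition principal_ideal_domain (R : comPzRingType) : Prop :=
  [/\ (1 : R) <> 0,
      forall x y : R, x * y = 0 -> x = 0 \/ y = 0
    & forall I : R -> Prop, is_ideal I ->
        exists a, forall x, I x <-> exists r, x = r * a].

Definition projective (R : pzRingType) (P : lmodType R) : Prop :=
  forall (M N : lmodType R) (g : {linear M -> N}) (f : {linear P -> N}),
    (forall y, exists x, g x = y) ->
    exists h : {linear P -> M}, forall x, g (h x) = f x.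

(* S as an R-module: the otherwise unused argument p lets the R-module
   structure be inferred. *)
Definition restrict_scalars (R S : pzRingType) (p : {rmorphism R -> S}) : Type :=
  S.

Section RestrictScalars.
Variables (R S : pzRingType) (p : {rmorphism R -> S}).
Local Notation M := (restrict_scalars p).

HB.instance Definition _ := GRing.Zmodule.copy M S.

Definition restrict_scale (r : R) (s : M) : M :=
  p r * (s : S).

Lemma restrict_scalerA a b v :
  restrict_scale a (restrict_scale b v) = restrict_scale (a * b) v.
Proof. by rewrite /restrict_scale rmorphM mulrA. Qed.
Lemma restrict_scale1r : left_id 1 restrict_scale.
Proof. by move=> v; rewrite /restrict_scale rmorph1 mul1r. Qed.
Lemma restrict_scalerDr : right_distributive restrict_scale +%R.
Proof. by move=> r u v; apply: mulrDr. Qed.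
Lemma restrict_scalerDl v : {morph restrict_scale^~ v : a b / a + b}.
Proof. by move=> a b; rewrite /restrict_scale rmorphD; apply: mulrDl. Qed.

HB.instance Definition _ := GRing.Zmodule_isLmodule.Build R M
  restrict_scalerA restrict_scale1r restrict_scalerDr restrict_scalerDl.

End RestrictScalars.

(* Main.v *)
(* Call p cyclically pure if IS \cap R = I for every ideal I of R. If p is
   effective codescent, in either category, then p_* reflects isomorphisms;
   applied to X -> X / ker(X -> S +_R X) this makes the unit X -> S +_R X
   injective for every ring X under R, and X = R / I gives cyclic purity.

   For ternary rings cyclic purity is also sufficient. Elements of S +_R X have
   unique normal forms over the amalgam of X and S / IS, where I is the kernel
   of R -> X, and an injective X -> Y acts on them letter by letter. Hence the
   coassociativity of a coaction xi says that all letters of xi(c) lie in the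
   equalizer of xi and the unit, and this equalizer is the descended object.

   For commutative rings purity is sufficient. Each instance of the descent
   identities involves finitely many R-linear relations in S, so that it can be
   checked with a map S -> R fixing 1 and respecting these relations only.
   Cyclic purity implies purity if R is a principal ideal domain, by Gaussian
   elimination localized at a maximal ideal, and if S is projective, because
   its trace ideal T satisfies TS = S, so that 1 is in T and p splits.

   For (b), let R = F_2[x, y] / (x, y)^2 map to R/x * R/y * R/(x + y). An ideal
   of R that misses a nonzero element of the socle dies in one of the factors
   where that element survives, so this is cyclically pure; but the socle of the
   injective hull E of the residue field dies in S (x) E, and the unit at the
   square-zero extension of R by E is not injective. *)

From HB Require Import structures.
From mathcomp Require Import all_boot all_order all_algebra.
From mathcomp Require Import boolp classical_sets functions ring.
Require Import Defs.

Set Implicit Arguments.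
Unset Strict Implicit.
Unset Printing Implicit Defensive.

Import GRing.Theory.
Local Open Scope ring_scope.
Local Open Scope cat_scope.

(** * Comonadicity of the change of cobase *)

Section Equivalence.
Variables (C D : category) (F : functor C D).

Definition faithful : Prop :=
  forall (X Y : C) (f g : hom X Y), fmap F f = fmap F g -> f = g.
Definition full : Prop :=
  forall (X Y : C) (g : hom (F X) (F Y)), exists f, fmap F f = g.
Definition essentially_surjective : Prop :=
  forall Y : D, exists X, exists u : hom (F X) Y, is_iso u.

(** Choice selects a preimage of each object together with an isomorphism. A morphism is conjugated
    by these isomorphisms and then lifted along [F], and faithfulness turns every identity to be
    checked into one in [D]. *)
Lemma equivalence_of_ffes :
  faithful -> full -> essentially_surjective -> is_equivalence F.
Proof.
move=> Ff Ffull Fes.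
have choice_inv Y : {X : C & {u : hom (F X) Y & {v : hom Y (F X) |
    v ∘ u = idm _ /\ u ∘ v = idm _}}}.
  by have [X /cid[u /cid[v uv]]] := cid (Fes Y); exists X, u, v.
pose G0 Y := projT1 (choice_inv Y).
pose u Y : hom (F (G0 Y)) Y := projT1 (projT2 (choice_inv Y)).
pose v Y : hom Y (F (G0 Y)) := proj1_sig (projT2 (projT2 (choice_inv Y))).
have vu Y : v Y ∘ u Y = idm _.
  by case: (proj2_sig (projT2 (projT2 (choice_inv Y)))).
have uv Y : u Y ∘ v Y = idm _.
  by case: (proj2_sig (projT2 (projT2 (choice_inv Y)))).
pose pre X Y (g : hom (F X) (F Y)) : hom X Y := proj1_sig (cid (Ffull X Y g)).
have preE X Y (g : hom (F X) (F Y)) : fmap F (pre X Y g) = g.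
  exact: proj2_sig (cid (Ffull X Y g)).
pose G1 Y Y' (g : hom Y Y') : hom (G0 Y) (G0 Y') := pre _ _ (v Y' ∘ g ∘ u Y).
have G1id Y : G1 Y Y (idm Y) = idm (G0 Y).
  by apply: Ff; rewrite preE fmap_id cmpm1 vu.
have G1cmp X Y Z (g : hom Y Z) (f : hom X Y) :
    G1 _ _ (g ∘ f) = G1 _ _ g ∘ G1 _ _ f.
  apply: Ff; rewrite fmap_cmp !preE -!cmpA (cmpA (u Y)) uv cmp1m.
  by rewrite !cmpA.
pose G := Functor G1id G1cmp.
exists G; split.
- have nat X Y (f : hom X Y) :
      pre _ _ (u (F Y)) ∘ fmap (functor_cmp G F) f
      = fmap (functor_id C) f ∘ pre _ _ (u (F X)).
    apply: Ff; rewrite /= [LHS]fmap_cmp [RHS]fmap_cmp !preE !cmpA uv.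
    by rewrite cmp1m.
  exists (NatTrans (F := functor_cmp G F) (G := functor_id C) nat) => X /=.
  exists (pre _ _ (v (F X))); split; apply: Ff; rewrite /=.
    by rewrite fmap_cmp !preE vu fmap_id.
  by rewrite fmap_cmp !preE uv fmap_id.
- have nat X Y (f : hom X Y) :
      u Y ∘ fmap (functor_cmp F G) f = fmap (functor_id D) f ∘ u X.
    by rewrite /= preE !cmpA uv cmp1m.
  exists (NatTrans (F := functor_cmp F G) (G := functor_id D) nat) => X /=.
  by exists (v X).
Qed.

(** Through the natural isomorphism of [G F] with the identity, [g] is conjugate to [G (F g)], and
    functors preserve isomorphisms. *)
Lemma equivalence_reflects_iso (X Y : C) (g : hom X Y) :
  is_equivalence F -> is_iso (fmap F g) -> is_iso g.
Proof.
move=> [G [[a aiso] _]] [h [hg gh]].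
have [aX [aY [na [[b [bX aXb]] [b' [bY aYb]]]]]] :
    exists (aX : hom (G (F X)) X) (aY : hom (G (F Y)) Y),
      g ∘ aX = aY ∘ fmap G (fmap F g) /\ is_iso aX /\ is_iso aY.
  by exists (a X), (a Y); split; [exact: esym (naturality a g) | split; apply: aiso].
have e : b' ∘ g = fmap G (fmap F g) ∘ b.
  by rewrite -[LHS]cmpm1 -aXb cmpA -(cmpA b') na cmpA bY cmp1m.
exists (aX ∘ fmap G h ∘ b'); split.
- by rewrite -cmpA e -(cmpA aX) (cmpA (fmap G h)) -fmap_cmp hg fmap_id cmp1m.
- by rewrite !cmpA na -(cmpA aY) -fmap_cmp gh fmap_id cmpm1.
Qed.

End Equivalence.

Definition epic (C : category) (X Y : C) (g : hom X Y) : Prop :=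
  forall (Z : C) (h h' : hom Y Z), h ∘ g = h' ∘ g -> h = h'.

Section Effective.
Variables (C : category) (po : has_pushouts C) (B E : C) (p : hom B E).

Local Notation F := (cobase po p).

(* [p_*] inverts such a [g], the pushout of its target being already a
   quotient of that of its source. *)
Lemma effective_codescent_iso (X Y : coslice B) (g : hom X Y)
    (h : hom (under Y) (po_obj (po p (arrow X)))) :
  effective_codescent po p -> epic (cosl_val g) ->
  h ∘ cosl_val g = po_inr (po p (arrow X)) -> is_iso (cosl_val g).
Proof.
move=> eff gepi hg.
suff /(equivalence_reflects_iso eff) [k [kg gk]] :
    is_iso (fmap (comparison (cobase_adjunction po p)) g).
  by exists (cosl_val k); split;
    [move/(congr1 (@cosl_val _ _ _ _)): kg | move/(congr1 (@cosl_val _ _ _ _)): gk].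
(* Because [h] extends the unit along [g], it forms a cocone with the inclusion of [E]; the induced
   map [k0] is the inverse of [p_* g]. *)
have sq : po_inl (po p (arrow X)) ∘ p = h ∘ arrow Y.
  by rewrite -(cosl_arrow g) cmpA hg po_square.
pose k0 := po_desc (po p (arrow Y)) sq.
have k0l : k0 ∘ arrow (F Y) = arrow (F X) by rewrite /= po_desc_inl.
pose k : hom (F Y) (F X) := @CosliceHom C E (F Y) (F X) k0 k0l.
have kg : k ∘ fmap F g = idm (F X).
  apply: coslice_hom_eq; apply: po_unique => /=; rewrite -cmpA.
    by rewrite !po_desc_inl cmp1m.
  by rewrite po_desc_inr cmpA po_desc_inr hg cmp1m.
have gk : fmap F g ∘ k = idm (F Y).
  apply: coslice_hom_eq; apply: po_unique => /=; rewrite -cmpA.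
    by rewrite !po_desc_inl cmp1m.
  rewrite po_desc_inr cmp1m; apply: gepi.
  by rewrite -cmpA hg po_desc_inr.
pose W := adj_comonad (cobase_adjunction po p).
pose cX : hom (F X) (W (F X)) := coact (comparison (cobase_adjunction po p) X).
pose cY : hom (F Y) (W (F Y)) := coact (comparison (cobase_adjunction po p) Y).
have e : cY ∘ fmap F g = fmap W (fmap F g) ∘ cX.
  exact: cohom_coact (fmap (comparison (cobase_adjunction po p)) g).
(* An inverse of a coalgebra morphism commutes with the coactions as well. *)
have ke : cX ∘ k = fmap W k ∘ cY.
  rewrite -[LHS]cmp1m -(fmap_id W) -kg fmap_cmp -cmpA (cmpA _ cX) -e.
  by rewrite -(cmpA cY) gk cmpm1.
exists (@CoalgebraHom _ _ (comparison (cobase_adjunction po p) Y)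
          (comparison (cobase_adjunction po p) X) k ke).
by split; apply: coalgebra_hom_eq.
Qed.

(* The first hypothesis says that [po_inr] is the equalizer of [p_*] of itself
   and of the unit at its target, hence full faithfulness of the comparison;
   in the second, [xi] is a coalgebra structure and [D] its descended object. *)
Lemma effective_codescentI :
  (forall (D : C) (f : hom B D),
     let P := po p f in let P' := po p (po_inl P ∘ p) in
     (forall (Z : C) (h h' : hom Z D), po_inr P ∘ h = po_inr P ∘ h' -> h = h') /\
     (forall (Z : C) (g : hom Z (po_obj P))
          (e : po_inl P' ∘ p = po_inr P' ∘ po_inr P ∘ f),
        po_desc P e ∘ g = po_inr P' ∘ g -> exists h, po_inr P ∘ h = g)) ->
  (forall (Y : C) (psi : hom E Y),
     let P := po p (psi ∘ p) in let P' := po p (po_inl P ∘ p) in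
     forall (xi : hom Y (po_obj P))
       (e0 : psi ∘ p = idm Y ∘ (psi ∘ p))
       (e1 : po_inl P' ∘ p = po_inr P' ∘ po_inr P ∘ (psi ∘ p))
       (e2 : po_inl P' ∘ p = po_inr P' ∘ xi ∘ (psi ∘ p)),
     xi ∘ psi = po_inl P -> po_desc P e0 ∘ xi = idm Y ->
     po_desc P e1 ∘ xi = po_desc P e2 ∘ xi ->
     exists (D : C) (d : hom B D) (i : hom D Y) (e : psi ∘ p = i ∘ d),
       xi ∘ i = po_inr P ∘ i /\ is_iso (po_desc (po p d) e)) ->
  effective_codescent po p.
Proof.
move=> eqlz desc; apply: equivalence_of_ffes.
- move=> X Y f g /(congr1 (@cohom_val _ _ _ _)) /(congr1 (@cosl_val _ _ _ _)) e.
  apply: coslice_hom_eq; apply: (proj1 (eqlz _ (arrow Y))).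
  have := congr1 (fun z => z ∘ po_inr (po p (arrow X))) e.
  by rewrite /= !po_desc_inr.
- move=> X Y [g gco].
  have gco' := congr1 (@cosl_val _ _ _ _) gco; rewrite /= in gco'.
  (* For this cocone [po_desc] is the coaction of [comparison Y]. A coalgebra morphism restricted to
     [X] equalizes it with the unit and so factors through [Y]. *)
  have [|h hg] := proj2 (eqlz _ (arrow Y)) _ (cosl_val g ∘ po_inr (po p (arrow X)))
                    (cobase_fmap_proof po p (cobase_unit po p Y)).
    rewrite cmpA; move: gco'; rewrite /= => ->.
    by rewrite -cmpA po_desc_inr cmpA po_desc_inr cmpA.
  have ha : h ∘ arrow X = arrow Y.
    apply: (proj1 (eqlz _ (arrow Y))).
    rewrite cmpA hg -[LHS]cmpA -(po_square (po p (arrow X))) cmpA.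
    exact: etrans (congr1 (fun z => z ∘ p) (cosl_arrow g)) (po_square _).
  exists (CosliceHom ha); apply: coalgebra_hom_eq; apply: coslice_hom_eq.
  apply: po_unique => /=.
    by rewrite po_desc_inl; exact: esym (cosl_arrow g).
  by rewrite po_desc_inr hg.
- move=> [Y xi xi1 xi2]; rewrite /= in xi xi1 xi2 *.
  have [D [d [i [e [xii [w [wl wr]]]]]]] :=
    desc _ (arrow Y) (cosl_val xi) _ _ _ (cosl_arrow xi)
      (congr1 (@cosl_val _ _ _ _) xi1) (congr1 (@cosl_val _ _ _ _) xi2).
  pose X : coslice B := CosliceObj d.
  exists X.
  have cl : po_desc (po p d) e ∘ arrow (F X) = arrow Y by rewrite /= po_desc_inl.
  pose c : hom (F X) Y := @CosliceHom C E (F X) Y (po_desc (po p d) e) cl.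
  have wa : w ∘ arrow Y = arrow (F X) by rewrite -cl cmpA wl cmp1m.
  pose w' : hom Y (F X) := @CosliceHom C E Y (F X) w wa.
  have cw : c ∘ w' = idm Y by apply: coslice_hom_eq.
  have wc : w' ∘ c = idm (F X) by apply: coslice_hom_eq.
  set W := adj_comonad (cobase_adjunction po p).
  pose A := @Coalgebra _ W Y xi xi1 xi2.
  pose cX := coact (comparison (cobase_adjunction po p) X).
  have cco : coact A ∘ c = fmap W c ∘ cX.
    apply: coslice_hom_eq; apply: po_unique => /=; rewrite -!cmpA.
      rewrite !po_desc_inl; exact: (cosl_arrow xi).
    by rewrite !po_desc_inr xii cmpA po_desc_inr -cmpA po_desc_inr.
  have wco : cX ∘ w' = fmap W w' ∘ coact A.
    rewrite -[LHS]cmp1m -(fmap_id W) -wc fmap_cmp -!cmpA (cmpA (fmap W c)) -cco.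
    by rewrite -cmpA cw cmpm1.
  exists (@CoalgebraHom _ _ (comparison _ X) A c cco).
  exists (@CoalgebraHom _ _ A (comparison _ X) w' wco).
  by split; apply: coalgebra_hom_eq.
Qed.

End Effective.

(** * Cyclic purity *)

Section Ideals.
Variable R : comPzRingType.
Implicit Type I : R -> Prop.

Lemma ideal0 I : is_ideal I -> I 0. Proof. by case. Qed.
Lemma ideal_sub00 I : is_ideal I -> I (0 - 0).
Proof. by rewrite subrr; apply: ideal0. Qed.
Lemma ideal_eq I x y : I x -> x = y -> I y. Proof. by move=> + <-. Qed.
Lemma idealD I x y : is_ideal I -> I x -> I y -> I (x + y).
Proof. by case=> _ + _; apply. Qed.
Lemma idealM I r x : is_ideal I -> I x -> I (r * x).
Proof. by case=> _ _; apply. Qed.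
Lemma idealN I x : is_ideal I -> I x -> I (- x).
Proof. by move=> Ii /(idealM (-1) Ii); rewrite mulN1r. Qed.
Lemma idealB I x y : is_ideal I -> I x -> I y -> I (x - y).
Proof. by move=> Ii Ix Iy; apply: idealD => //; apply: idealN. Qed.

Lemma ideal_subC I x y : is_ideal I -> I (x - y) -> I (y - x).
Proof. by move=> Ii /(idealN Ii); rewrite opprB. Qed.
Lemma ideal_sub_trans I y x z :
  is_ideal I -> I (x - y) -> I (y - z) -> I (x - z).
Proof. by move=> Ii Ixy Iyz; rewrite -(subrKA y); apply: idealD. Qed.
Lemma ideal_subMD I a b c a' b' c' : is_ideal I ->
  I (a - a') -> I (b - b') -> I (c - c') -> I (a * b + c - (a' * b' + c')).
Proof.
move=> Ii Ia Ib Ic.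
rewrite opprD addrACA; apply: idealD => //.
apply: (ideal_sub_trans (y := a * b')) => //.
  by rewrite -mulrBr; apply: idealM.
by rewrite -mulrBl mulrC; apply: idealM.
Qed.
End Ideals.

Section CyclicPurity.
Variables (R S : comPzRingType) (p : {rmorphism R -> S}).

(** The ideal [IS] generated by [p(I)], as an intersection instead of a set of finite sums:
    membership is then used by exhibiting one ideal of [S], often a kernel. *)
Definition extended_ideal (I : R -> Prop) (s : S) : Prop :=
  forall K : S -> Prop, is_ideal K -> (forall r, I r -> K (p r)) -> K s.

Definition cyclically_pure : Prop :=
  forall I, is_ideal I -> forall r, extended_ideal I (p r) -> I r.

Lemma extended_is_ideal I : is_ideal (extended_ideal I).
Proof.
split=> [K Ki _|x y Ix Iy K Ki Kp|r x Ix K Ki Kp]; first exact: ideal0.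
- by apply: idealD => //; [apply: Ix | apply: Iy].
- by apply: idealM => //; apply: Ix.
Qed.

Lemma mem_extended_ideal (I : R -> Prop) r : I r -> extended_ideal I (p r).
Proof. by move=> Ir K _; apply. Qed.

End CyclicPurity.

Section TernaryFacts.
Variable X : ternary_ring.
Implicit Types x y z : X.

Lemma ttK x y z w : tt x y z = w <-> tq x y w = z.
Proof. by split=> <-; rewrite ?tqt ?ttq. Qed.

Lemma tq1l x : tq tone x x = tzero.
Proof. by apply/ttK; rewrite tt1l. Qed.

End TernaryFacts.

Section HomFromRing.
Variables (R : comPzRingType) (X : ternary_ring).
Variable f : ternary_hom (ternary_of_ring R) X.

(** In a ring [tq tone b a] is [a - b], and in any ternary ring it vanishes only if [a = b]. A
    homomorphism out of a ring is thus governed by its kernel even though its target has no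
    subtraction. *)
Lemma ring_hom_subE (a b : R) : f a = f b <-> f (a - b) = tzero.
Proof.
have fB : f (a - b) = tq tone (f b) (f a).
  have := tfun_q f (1 : R) b a; rewrite /= mul1r => ->.
  by rewrite -(tfun_1 f).
rewrite fB; split=> [->|e]; first exact: tq1l.
by have /ttK := e; rewrite tt1l.
Qed.

(** Sums and products are values of [t], namely [x + y = t(x, 1, y)] and [r x = t(r, x, 0)]. *)
Lemma ring_hom_ker_ideal : is_ideal (fun r : R => f r = tzero).
Proof.
split=> [|x y fx fy|r x fx]; first exact: tfun_0 f.
- have := tfun_t f x (1 : R) y; rewrite /= mulr1 => ->.
  by rewrite fx tt0l.
- have := tfun_t f r x (0 : R); rewrite /= addr0 => ->.
  by rewrite fx tt0r; exact: tfun_0 f.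
Qed.

End HomFromRing.

(** * Normal forms in pushouts of ternary rings *)

Section NormalForms.
Variables (R S : comPzRingType) (p : {rmorphism R -> S}).
Variable I : R -> Prop.
Hypothesis purI : forall r, extended_ideal p I (p r) -> I r.

Local Notation IS := (extended_ideal p I).
Let ISi : is_ideal IS := extended_is_ideal p I.
Let pt := ternary_of_rmorphism p.

(** The value of [choose] depends only on the predicate, here the coset of [s], and not on the
    default [s]; this makes the representative canonical. *)
Definition coset_repr (s : S) : S := choose (fun s' => `[< IS (s - s') >]) s.

Lemma coset_reprP s : IS (s - coset_repr s).
Proof.
apply/asboolP; apply: (@chooseP _ (fun s' => `[< IS (s - s') >])).
by apply/asboolP; rewrite subrr; exact: ideal0 ISi.
Qed.

Lemma coset_repr_eq s s' : IS (s - s') -> coset_repr s = coset_repr s'.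
Proof.
move=> ss'; rewrite /coset_repr.
have -> : (fun x => `[< IS (s - x) >]) = (fun x => `[< IS (s' - x) >]).
  apply: funext => x; apply: asbool_equiv_eq; split.
    by apply: (ideal_sub_trans ISi); apply: (ideal_subC ISi).
  by move=> h; apply: (ideal_sub_trans ISi ss').
apply: choose_id; apply/asboolP; last by rewrite subrr; exact: ideal0 ISi.
exact: (ideal_subC ISi).
Qed.

Section Target.
Variables (X : ternary_ring) (f : ternary_hom (ternary_of_ring R) X).
Hypothesis kerf : forall r, f r = tzero <-> I r.

Local Notation term := (ternary_term (ternary_of_ring S) X).
Local Notation T0 := (TRr tzero : term).
Local Notation T1 := (TRr tone : term).
Local Notation cong := (ternary_cong pt f).

(* The letters of a normal form are the elements of [X] and chosen
   representatives of the cosets of [IS] that do not meet the image of [R]. *)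
Definition letter (s : S) : term :=
  match pselect (exists r, IS (s - p r)) with
  | left h => TRr (f (sval (cid h)))
  | right _ => TRl (coset_repr s : ternary_of_ring S)
  end.

Lemma hom_ker_eq r r' : f r = f r' <-> I (r - r').
Proof. by rewrite ring_hom_subE kerf. Qed.

(** Purity of [I] enters here: [R / I] embeds in both [X] and [S / IS], so that the two can be
    amalgamated over it. *)
Lemma hom_eq_extended r r' : IS (p r - p r') -> f r = f r'.
Proof. by move=> h; apply/hom_ker_eq/purI; rewrite rmorphB. Qed.

Lemma letter_base s r : IS (s - p r) -> letter s = TRr (f r).
Proof.
move=> sr; rewrite /letter; case: pselect => [h|[]]; last by exists r.
congr TRr; case: cid => r' /= sr'; apply: hom_eq_extended.
by apply: (ideal_sub_trans ISi) sr; exact: (ideal_subC ISi).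
Qed.

Lemma letter_p r : letter (p r) = TRr (f r).
Proof. by apply: letter_base; rewrite subrr; exact: ideal0 ISi. Qed.
Lemma letter0 : letter 0 = T0.
Proof. by rewrite -(rmorph0 p) letter_p; congr TRr; exact: tfun_0 f. Qed.
Lemma letter1 : letter 1 = T1.
Proof. by rewrite -(rmorph1 p) letter_p; congr TRr; exact: tfun_1 f. Qed.

Lemma letterP s :
  (exists2 r, IS (s - p r) & letter s = TRr (f r)) \/
  letter s = TRl (coset_repr s : ternary_of_ring S).
Proof.
rewrite /letter; case: pselect => [h|h]; last by right.
by left; exists (sval (cid h)) => //; case: cid.
Qed.

Lemma letter_eq s s' : IS (s - s') -> letter s = letter s'.
Proof.
move=> ss'; case: (letterP s) => [[r sr ->]|e].
  by rewrite (@letter_base s' r) //; apply: (ideal_sub_trans ISi) sr; exact: (ideal_subC ISi).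
case: (letterP s') => [[r sr e']|->]; last by rewrite e (coset_repr_eq ss').
by rewrite (@letter_base s r) //; apply: (ideal_sub_trans ISi) sr.
Qed.

Lemma letter_inj s s' : letter s = letter s' -> IS (s - s').
Proof.
case: (letterP s) => [[r sr ->]|->].
  case: (letterP s') => [[r' sr' ->]|-> //] [] /hom_ker_eq Irr'.
  have := @mem_extended_ideal R S p I _ Irr'; rewrite rmorphB => rr'.
  apply: (ideal_sub_trans ISi (y := p r)) => //.
  by apply: (ideal_sub_trans ISi (y := p r')) => //; exact: (ideal_subC ISi).
case: (letterP s') => [[r' sr' -> //]|->] [] e.
apply: (ideal_sub_trans ISi (y := coset_repr s)) => //; first exact: coset_reprP.
by rewrite e; exact: ideal_subC ISi (coset_reprP _).
Qed.

Lemma letter_TRr s x : letter s = TRr x -> exists2 r, IS (s - p r) & f r = x.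
Proof. by case: (letterP s) => [[r sr ->]|-> //] [<-]; exists r. Qed.

(* [t(x, y, z) = w] holds without forming a new node: these are the operations
   of the partial ternary ring obtained by amalgamating [X] and [S / IS]. *)
Definition basic (x y z w : term) : Prop :=
  (x = T0 \/ y = T0) /\ w = z \/
  x = T1 /\ z = T0 /\ w = y \/
  y = T1 /\ z = T0 /\ w = x \/
  (exists a b c, [/\ x = TRr a, y = TRr b, z = TRr c & w = TRr (tt a b c)]) \/
  (exists a b c, [/\ x = letter a, y = letter b, z = letter c
                   & w = letter (a * b + c)]).

(** A node is irreducible if no clause of [basic] evaluates it and neither [tqt] nor [ttq] cancels
    it. The condition on [TRl s] says that [s] is the chosen representative of a coset not meeting
    the image of [R]. *)
Fixpoint normal (t : term) : Prop :=
  match t with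
  | TRl s => letter s = TRl s
  | TRr _ => True
  | TRt x y z => [/\ normal x, normal y, normal z,
      ~ exists w, basic x y z w & ~ exists w, z = TRq x y w]
  | TRq x y w => [/\ normal x, normal y, normal w,
      ~ exists z, basic x y z w & ~ exists z, w = TRt x y z]
  end.

Lemma normal_letter s : normal (letter s).
Proof.
case: (letterP s) => [[r _ ->] //|e]; rewrite e /= -[RHS]e.
by apply: letter_eq; apply: (ideal_subC ISi); apply: coset_reprP.
Qed.

(** If [0 = 1] in [X], then [1] is in [I], both [X] and [S / IS] are trivial and every node can be
    evaluated. This disposes of the conflicts between the unit laws in [basic]. *)
Lemma normal_trivial t : T0 = T1 -> normal t -> t = T0.
Proof.
move=> [e01].
have inX (x : X) : x = tzero by rewrite -(tt1l x) -e01 tt0l.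
have basic0 (x y z : term) : x = T0 -> exists w, basic x y z w.
  by move=> ->; exists z; left; split=> //; left.
have basic0' (x y w : term) : x = T0 -> exists z, basic x y z w.
  by move=> ->; exists w; left; split=> //; left.
elim: t => [s|x|x IHx y _ z _|x IHx y _ z _] /=.
- move=> e; rewrite -e -letter0; apply: letter_eq.
  have I1 : I 1 by apply/kerf/inX.
  have := @mem_extended_ideal R S p I _ I1; rewrite rmorph1 => IS1.
  by rewrite subr0 -(mulr1 s); apply: (idealM s ISi).
- by rewrite (inX x).
- by case=> nx _ _ nb _; case: nb; apply: basic0; apply: IHx.
- by case=> nx _ _ nb _; case: nb; apply: basic0'; apply: IHx.
Qed.

(** The clauses of [basic] overlap, and each must agree with the operations of [X] on elements of
    [X]. The unit clauses do so by the axioms; in the last clause, letters that are elements of [X]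
    come from [R]. *)
Lemma basic_TRr a b (z w : term) c :
  basic (TRr a) (TRr b) z w ->
  (z = TRr c -> w = TRr (tt a b c)) /\ (w = TRr c -> z = TRr (tq a b c)).
Proof.
case=> [[[[->]|[->]] ->]|[[[->] [-> ->]]|[[[->] [-> ->]]|[]]]].
- by split=> ->; congr TRr; [rewrite tt0l | apply/esym/ttK; rewrite tt0l].
- by split=> ->; congr TRr; [rewrite tt0r | apply/esym/ttK; rewrite tt0r].
- split=> -[<-]; congr TRr; first by rewrite tt1l.
  by apply/esym/ttK; rewrite tt1l.
- split=> -[<-]; congr TRr; first by rewrite tt1r.
  by apply/esym/ttK; rewrite tt1r.
- move=> [a' [b' [c' [[<-] [<-] -> ->]]]].
  by split=> -[<-] //; rewrite tqt.
- move=> [a' [b' [c' [/esym/letter_TRr[r ar <-] /esym/letter_TRr[r' br <-] -> ->]]]].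
  have mulE u v : IS (u - p v) -> IS (a' * b' + u - p (r * r' + v)).
    by move=> uv; rewrite rmorphD rmorphM; apply: (ideal_subMD ISi).
  split=> /letter_TRr [q cq <-].
    by rewrite -(tfun_t f) (letter_base (mulE _ _ cq)).
  rewrite -(tfun_q f); apply: letter_base; rewrite /= rmorphB rmorphM.
  have := idealB ISi cq (ideal_subMD ISi ar br (ideal_sub00 ISi)).
  by move/ideal_eq; apply; ring.
Qed.

(** The same consistency with the operations of [S / IS]: equalities of letters become congruences
    modulo [IS], and letters lying in [X] are replaced by elements of [R]. *)
Lemma basic_letter a b c (z w : term) :
  basic (letter a) (letter b) z w ->
  (z = letter c -> w = letter (a * b + c)) /\
  (w = letter c -> z = letter (c - a * b)).
Proof.
case=> [[e ->]|[[e [-> ->]]|[[e [-> ->]]|[]]]].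
- have ab : IS (a * b).
    rewrite -!letter0 in e; case: e => /letter_inj; rewrite subr0 => h.
      by rewrite mulrC; apply: (idealM _ ISi).
    by apply: (idealM _ ISi).
  split=> ->; apply: letter_eq.
    by apply: (ideal_eq (idealN ISi ab)); ring.
  by apply: (ideal_eq ab); ring.
- have a1 : IS (a - 1) by apply: letter_inj; rewrite letter1.
  have ab := idealM b ISi a1.
  rewrite -letter0; split=> /letter_inj h; apply: letter_eq.
    by apply: (ideal_eq (idealD ISi (idealN ISi ab) h)); ring.
  by apply: (ideal_eq (idealD ISi ab h)); ring.
- have b1 : IS (b - 1) by apply: letter_inj; rewrite letter1.
  have ab := idealM a ISi b1.
  rewrite -letter0; split=> /letter_inj h; apply: letter_eq.
    by apply: (ideal_eq (idealD ISi (idealN ISi ab) h)); ring.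
  by apply: (ideal_eq (idealD ISi ab h)); ring.
- move=> [a' [b' [c' [/letter_TRr[r ar fr] /letter_TRr[r' br fr'] -> ->]]]].
  rewrite -fr -fr'; split=> /esym/letter_TRr [q cq fq].
    rewrite -fq -(tfun_t f); apply/esym/letter_base; rewrite /= rmorphD rmorphM.
    exact: (ideal_subMD ISi).
  have -> : c' = f (q - r * r').
    by have := tfun_q f r r' q; rewrite /= => ->; apply/esym/ttK.
  apply/esym/letter_base; rewrite rmorphB rmorphM.
  by apply: (ideal_eq (idealB ISi cq (ideal_subMD ISi ar br (ideal_sub00 ISi)))); ring.
- move=> [a' [b' [c' [/letter_inj aa' /letter_inj bb' -> ->]]]].
  split=> /letter_inj cc'; apply: letter_eq.
    by apply: (ideal_subC ISi); apply: (ideal_subMD ISi) => //; apply: (ideal_subC ISi).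
  by apply: (ideal_eq (idealD ISi cc' (ideal_subMD ISi aa' bb' (ideal_sub00 ISi)))); ring.
Qed.

(** The two preceding lemmas settle every case with an operation of [X] or [S / IS]. Two unit laws
    with different values can apply together only if [0 = 1], where all normal terms coincide. *)
Lemma basic_fun (x y z w w' : term) : normal x -> normal y ->
  basic x y z w -> basic x y z w' -> w = w'.
Proof.
move=> nx ny h h'; move: (h) (h').
case=> [[e ew]|[[ex [ez ew]]|[[ey [ez ew]]|[[a [b [c [ex ey ez ew]]]]|
  [a [b [c [ex ey ez ew]]]]]]]]; last 2 first.
- by move: h'; rewrite ex ey ew => /(basic_TRr c) [/(_ ez) ->].
- by move: h'; rewrite ex ey ew => /(basic_letter c) [/(_ ez) ->].
all: case=> [[e' ew']|[[ex' [ez' ew']]|[[ey' [ez' ew']]|[[a [b [c [ex' ey' ez' ew']]]]|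
  [a [b [c [ex' ey' ez' ew']]]]]]]].
all: try by move: h; rewrite ex' ey' ew' => /(basic_TRr c) [/(_ ez') ->].
all: try by move: h; rewrite ex' ey' ew' => /(basic_letter c) [/(_ ez') ->].
all: rewrite ew ew' //.
- rewrite ez'; case: e => [e|-> //].
  by rewrite (normal_trivial _ ny) // -ex' e.
- rewrite ez'; case: e => [-> //|e].
  by rewrite (normal_trivial _ nx) // -ey' e.
- rewrite ez; case: e' => [e|-> //].
  by rewrite (normal_trivial _ ny) // -ex e.
- by rewrite ex ey'.
- rewrite ez; case: e' => [-> //|e].
  by rewrite (normal_trivial _ nx) // -ey e.
- by rewrite ex' ey.
Qed.

Lemma basic_inj (x y z z' w : term) : normal x -> normal y ->
  basic x y z w -> basic x y z' w -> z = z'.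
Proof.
move=> nx ny h h'; move: (h) (h').
case=> [[e ew]|[[ex [ez ew]]|[[ey [ez ew]]|[[a [b [c [ex ey ez ew]]]]|
  [a [b [c [ex ey ez ew]]]]]]]]; last 2 first.
- move: h'; rewrite ex ey ez => /(basic_TRr (tt a b c)) [_ /(_ ew) ->].
  by rewrite tqt.
- move: h'; rewrite ex ey ez => /(basic_letter (a * b + c)) [_ /(_ ew) ->].
  by rewrite addrC addKr.
all: case=> [[e' ew']|[[ex' [ez' ew']]|[[ey' [ez' ew']]|[[a [b [c [ex' ey' ez' ew']]]]|
  [a [b [c [ex' ey' ez' ew']]]]]]]].
all: try by move: h; rewrite ex' ey' ez' => /(basic_TRr (tt a b c)) [_ /(_ ew') ->];
  rewrite tqt.
all: try by move: h; rewrite ex' ey' ez' => /(basic_letter (a * b + c)) [_ /(_ ew') ->];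
  rewrite addrC addKr.
all: rewrite ?ez ?ez' //.
- by rewrite -ew.
- rewrite -ew ew'; case: e => [e|-> //].
  by rewrite (normal_trivial _ ny) // -ex' e.
- rewrite -ew ew'; case: e => [-> //|e].
  by rewrite (normal_trivial _ nx) // -ey' e.
- rewrite -ew' ew; case: e' => [e|-> //].
  by rewrite (normal_trivial _ ny) // -ex e.
- rewrite -ew' ew; case: e' => [-> //|e].
  by rewrite (normal_trivial _ nx) // -ey e.
Qed.

Lemma basic_normal_t (x y z w : term) :
  normal x -> normal y -> normal z -> basic x y z w -> normal w.
Proof.
move=> nx ny nz.
case=> [[_ ->//]|[[_ [_ ->//]]|[[_ [_ ->//]]|[]]] [a [b [c [_ _ _ ->]]]] //].
exact: normal_letter.
Qed.

Lemma basic_normal_q (x y z w : term) :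
  normal w -> basic x y z w -> normal z.
Proof.
move=> nw; case=> [[_ <-//]|[[_ [-> _//]]|[[_ [-> _//]]|[]]]].
  by move=> [a [b [c [_ _ -> _]]]].
by move=> [a [b [c [_ _ -> _]]]]; apply: normal_letter.
Qed.

(** The elements of [S] that vanish in the pushout form an ideal containing [p(I)], hence all of
    [IS]. *)
Lemma letter_sound s : cong (letter s) (TRl (s : ternary_of_ring S)).
Proof.
pose inl := tr_inl pt f.
have ker_inl x : IS x -> inl x = tzero.
  move=> /(_ _ (ring_hom_ker_ideal inl)); apply.
  move=> r /kerf fr; transitivity (tr_inr pt f tzero).
    by rewrite -fr; apply: tr_piP; apply: tr_glue.
  exact: tfun_0 (tr_inr pt f).
apply: tr_pi_eq; case: (letterP s) => [[r sr ->]|->].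
  transitivity (inl (p r)); first by apply/esym/tr_piP; apply: tr_glue.
  by apply: (proj2 (ring_hom_subE inl (p r) s)); apply: ker_inl; apply: (ideal_subC ISi).
apply: (proj2 (ring_hom_subE inl (coset_repr s) s)); apply: ker_inl.
by apply: (ideal_subC ISi); apply: coset_reprP.
Qed.

Lemma T0_sound : cong T0 (TRl tzero). Proof. exact: tr_r0. Qed.
Lemma T1_sound : cong T1 (TRl tone). Proof. exact: tr_r1. Qed.

Lemma basic_sound (x y z w : term) : basic x y z w -> cong (TRt x y z) w.
Proof.
have r := tr_refl pt f.
case=> [[[]-> ->]|[[-> [-> ->]]|[[-> [-> ->]]|[]]]].
- exact: tr_trans (tr_t T0_sound (r _) (r _)) (tr_t0l _ _ _ _).
- exact: tr_trans (tr_t (r _) T0_sound (r _)) (tr_t0r _ _ _ _).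
- exact: tr_trans (tr_t T1_sound (r _) T0_sound) (tr_t1l _ _ _).
- exact: tr_trans (tr_t (r _) T1_sound T0_sound) (tr_t1r _ _ _).
- by move=> [a [b [c [-> -> -> ->]]]]; apply: tr_sym; apply: tr_rt.
- move=> [a [b [c [-> -> -> ->]]]].
  apply: tr_trans (tr_t (letter_sound a) (letter_sound b) (letter_sound c)) _.
  apply: tr_trans (tr_sym (letter_sound _)).
  by apply: tr_sym; apply: (tr_lt pt f a b c).
Qed.

Lemma cong_ttq x y z w : cong (TRt x y z) w <-> cong (TRq x y w) z.
Proof.
have r := tr_refl pt f.
split=> h.
  by apply: tr_trans (tr_q (r _) (r _) (tr_sym h)) _; apply: tr_qt.
by apply: tr_trans (tr_t (r _) (r _) (tr_sym h)) _; apply: tr_tq.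
Qed.

(** The operation [t] on normal forms: evaluate, else cancel, else form a node. By [basic_fun] the
    choice of the value is no choice. *)
Definition smart_t (x y z : term) : term :=
  match pselect (exists w, basic x y z w) with
  | left h => sval (cid h)
  | right _ => match pselect (exists w, z = TRq x y w) with
    | left h => sval (cid h)
    | right _ => TRt x y z
    end
  end.

Definition smart_q (x y w : term) : term :=
  match pselect (exists z, basic x y z w) with
  | left h => sval (cid h)
  | right _ => match pselect (exists z, w = TRt x y z) with
    | left h => sval (cid h)
    | right _ => TRq x y w
    end
  end.

Lemma smart_t_basic x y z w :
  normal x -> normal y -> basic x y z w -> smart_t x y z = w.
Proof.
move=> nx ny h; rewrite /smart_t; case: pselect => [h'|[]]; last by exists w.
by case: cid => w' /= h''; apply: (basic_fun nx ny h'' h).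
Qed.

Lemma smart_q_basic x y z w :
  normal x -> normal y -> basic x y z w -> smart_q x y w = z.
Proof.
move=> nx ny h; rewrite /smart_q; case: pselect => [h'|[]]; last by exists z.
by case: cid => w' /= h''; apply: (basic_inj nx ny h'' h).
Qed.

Lemma smart_tP x y z :
  [\/ basic x y z (smart_t x y z),
      ~ (exists w, basic x y z w) /\ z = TRq x y (smart_t x y z) |
      [/\ ~ (exists w, basic x y z w), ~ (exists w, z = TRq x y w) &
          smart_t x y z = TRt x y z]].
Proof.
rewrite /smart_t; case: pselect => [h|h]; first by constructor 1; case: cid.
case: pselect => [h'|h']; last by constructor 3.
by constructor 2; split=> //; case: cid.
Qed.

Lemma smart_qP x y w :
  [\/ basic x y (smart_q x y w) w,
      ~ (exists z, basic x y z w) /\ w = TRt x y (smart_q x y w) |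
      [/\ ~ (exists z, basic x y z w), ~ (exists z, w = TRt x y z) &
          smart_q x y w = TRq x y w]].
Proof.
rewrite /smart_q; case: pselect => [h|h]; first by constructor 1; case: cid.
case: pselect => [h'|h']; last by constructor 3.
by constructor 2; split=> //; case: cid.
Qed.

Lemma normal_smart_t x y z :
  normal x -> normal y -> normal z -> normal (smart_t x y z).
Proof.
move=> nx ny nz; case: (smart_tP x y z) => [h|[_ h]|[h h' ->]].
- exact: basic_normal_t h.
- by move: nz; rewrite {1}h => -[].
- by split.
Qed.

Lemma normal_smart_q x y z :
  normal x -> normal y -> normal z -> normal (smart_q x y z).
Proof.
move=> nx ny nz; case: (smart_qP x y z) => [h|[_ h]|[h h' ->]].
- exact: basic_normal_q h.
- by move: nz; rewrite {1}h => -[].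
- by split.
Qed.

Lemma smart_t_sound x y z : cong (smart_t x y z) (TRt x y z).
Proof.
apply: tr_sym; case: (smart_tP x y z) => [h|[_ h]|[_ _ ->]].
- exact: basic_sound.
- by rewrite {1}h; apply: tr_tq.
- exact: tr_refl.
Qed.

Lemma smart_q_sound x y z : cong (smart_q x y z) (TRq x y z).
Proof.
apply: tr_sym; case: (smart_qP x y z) => [h|[_ h]|[_ _ ->]].
- by apply/cong_ttq; apply: basic_sound.
- by rewrite {1}h; apply: tr_qt.
- exact: tr_refl.
Qed.

Fixpoint tsize (t : term) : nat :=
  match t with
  | TRl _ | TRr _ => 0
  | TRt x y z | TRq x y z => (tsize x + tsize y + tsize z).+1
  end.

(** This prevents a new node from being the value of [t(1, y, 0) = y] or [t(x, 1, 0) = x]. *)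
Lemma TRt_acyclic (x y z : term) : x <> TRt x y z /\ y <> TRt x y z.
Proof.
split=> /(congr1 tsize)/eqP; rewrite /= ltn_eqF // ltnS.
  by rewrite -addnA leq_addr.
by rewrite addnAC leq_addl.
Qed.

Lemma letter_notTRt s (x y z : term) :
  letter s <> TRt x y z /\ letter s <> TRq x y z.
Proof. by case: (letterP s) => [[r _ ->]|->]. Qed.

Lemma smart_qK x y z : normal x -> normal y -> normal z ->
  smart_q x y (smart_t x y z) = z.
Proof.
move=> nx ny nz; case: (smart_tP x y z) => [h|[h e]|[h h' e]].
- exact: smart_q_basic h.
(* Here [z] is the node [TRq x y w] with [w = smart_t x y z]. Its normality excludes evaluation and
   cancellation, so [smart_q] forms this node again. *)
- move: nz; rewrite {1}e /= => -[_ _ _ nb nq].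
  by case: (smart_qP x y (smart_t x y z)) => [b|[_ b]|[_ _ ->//]];
    [case: nb; eexists; exact: b | case: nq; eexists; exact: b].
- rewrite e; case: (smart_qP x y (TRt x y z)) => [b|[_ []] //|[_ []]]; last by exists z.
  (* Among the clauses of [basic], only the one for a zero factor can have the node [TRt x y z] as
     value, and it would have evaluated that node. *)
  case: h; case: b => [[e0 _]|[[_ [_ /esym b]]|[[_ [_ /esym b]]|[]]]].
  + by exists z; left.
  + by case: (TRt_acyclic x y z).
  + by case: (TRt_acyclic x y z).
  + by move=> [a [b [c []]]].
  + by move=> [a [b [c [_ _ _ /esym k]]]]; case: (letter_notTRt (a * b + c) x y z).
Qed.

Lemma smart_tK x y w : normal x -> normal y -> normal w ->
  smart_t x y (smart_q x y w) = w.
Proof.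
move=> nx ny nw; case: (smart_qP x y w) => [h|[h e]|[h h' e]].
- exact: smart_t_basic h.
- move: nw; rewrite {1}e /= => -[_ _ _ nb nq].
  by case: (smart_tP x y (smart_q x y w)) => [b|[_ b]|[_ _ ->//]];
    [case: nb; eexists; exact: b | case: nq; eexists; exact: b].
- rewrite e; case: (smart_tP x y (TRq x y w)) => [b|[_ []] //|[_ []]]; last by exists w.
  case: h; case: b => [[e0 _]|[[_ [b _]]|[[_ [b _]]|[]]]] //.
  + by exists w; left.
  + by move=> [a [b [c []]]].
  + by move=> [a [b [c [_ _ /esym k]]]]; case: (letter_notTRt c x y w).
Qed.

Fixpoint nf (t : term) : term :=
  match t with
  | TRl s => letter s
  | TRr x => TRr x
  | TRt x y z => smart_t (nf x) (nf y) (nf z)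
  | TRq x y z => smart_q (nf x) (nf y) (nf z)
  end.

Lemma normal_nf t : normal (nf t).
Proof.
elim: t => //= [s|x nx y ny z nz|x nx y ny z nz].
- exact: normal_letter.
- exact: normal_smart_t.
- exact: normal_smart_q.
Qed.

Lemma nf_sound t : cong (nf t) t.
Proof.
elim: t => /= [s|x|x cx y cy z cz|x cx y cy z cz].
- exact: letter_sound.
- exact: tr_refl.
- exact: tr_trans (smart_t_sound _ _ _) (tr_t cx cy cz).
- exact: tr_trans (smart_q_sound _ _ _) (tr_q cx cy cz).
Qed.

Lemma basic_letters a b c :
  basic (letter a) (letter b) (letter c) (letter (a * b + c)).
Proof. by do 4!right; exists a, b, c. Qed.

Lemma basic_bases a b c :
  basic (TRr a) (TRr b) (TRr c) (TRr (tt a b c)).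
Proof. by do 3!right; left; exists a, b, c. Qed.

(** The normal forms with the smart operations are a model of the pushout: they satisfy each
    generating law of the congruence. *)
Lemma nf_complete t t' : cong t t' -> nf t = nf t'.
Proof.
have nl := normal_letter; have nn := normal_nf.
elim=> //=.
- by move=> {}t {}t' u _ -> _ ->.
- by move=> x x' y y' z z' _ -> _ -> _ ->.
- by move=> x x' y y' z z' _ -> _ -> _ ->.
- by move=> x y; rewrite letter0; apply: smart_t_basic => //; left; split=> //; left.
- by move=> x y; rewrite letter0; apply: smart_t_basic => //; left; split=> //; right.
- by move=> x; rewrite letter0 letter1; apply: smart_t_basic => //; right; left.
- by move=> x; rewrite letter0 letter1; apply: smart_t_basic => //; right; right; left.
- by move=> x y z; apply: smart_qK.
- by move=> x y z; apply: smart_tK.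
- by move=> a b c; apply/esym/smart_t_basic/basic_letters.
- move=> a b c; apply/esym/smart_q_basic => //.
  have := basic_letters a b (c - a * b).
  by rewrite addrCA subrr addr0.
- by move=> a b c; apply/esym/smart_t_basic/basic_bases.
- move=> a b c; apply/esym/smart_q_basic => //.
  have := basic_bases a b (tq a b c).
  by rewrite ttq.
- by rewrite letter0.
- by rewrite letter1.
- by move=> b; apply: letter_p.
Qed.

Lemma nf_congE t t' : cong t t' <-> nf t = nf t'.
Proof.
split=> [|e]; first exact: nf_complete.
by apply: tr_trans (tr_sym (nf_sound t)) _; rewrite e; apply: nf_sound.
Qed.

End Target.
End NormalForms.

(** * Substitution of letters along an injective homomorphism *)

Fixpoint term_map (S X Y : ternary_ring) (u : X -> Y) (t : ternary_term S X) :
    ternary_term S Y :=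
  match t with
  | TRl s => TRl s
  | TRr x => TRr (u x)
  | TRt x y z => TRt (term_map u x) (term_map u y) (term_map u z)
  | TRq x y z => TRq (term_map u x) (term_map u y) (term_map u z)
  end.

Lemma term_map_inj (S X Y : ternary_ring) (u : X -> Y) :
  injective u -> injective (@term_map S X Y u).
Proof.
move=> ui; elim=> [s|x|x IHx y IHy z IHz|x IHx y IHy z IHz] [] //=.
- by move=> s' [->].
- by move=> x' [/ui ->].
- by move=> x' y' z' [/IHx-> /IHy-> /IHz->].
- by move=> x' y' z' [/IHx-> /IHy-> /IHz->].
Qed.

Fixpoint term_in (S X : ternary_ring) (P : X -> Prop) (t : ternary_term S X) :
    Prop :=
  match t with
  | TRl _ => True
  | TRr x => P x
  | TRt x y z | TRq x y z => [/\ term_in P x, term_in P y & term_in P z]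
  end.

Lemma term_map_eq (S X Y : ternary_ring) (u v : X -> Y) (t : ternary_term S X) :
  term_map u t = term_map v t -> term_in (fun x => u x = v x) t.
Proof.
elim: t => //= [x [->] //|x IHx y IHy z IHz|x IHx y IHy z IHz] [/IHx ? /IHy ? /IHz ?];
  by split.
Qed.

Section Substitution.
Variables (R S : comPzRingType) (p : {rmorphism R -> S}).
Variable I : R -> Prop.
Hypothesis purI : forall r, extended_ideal p I (p r) -> I r.
Variables (X Y : ternary_ring) (f : ternary_hom (ternary_of_ring R) X).
Variables (g : ternary_hom (ternary_of_ring R) Y) (u : ternary_hom X Y).
Hypothesis kerf : forall r, f r = tzero <-> I r.
Hypothesis ufg : forall r, u (f r) = g r.
Hypothesis u_inj : injective u.

Local Notation map := (@term_map (ternary_of_ring S) X Y u).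

(** An injective homomorphism under [R] leaves the kernel [I] unchanged, so terms over [X] and over
    [Y] use the same representatives modulo [IS]. *)
Lemma comp_kernel r : g r = tzero <-> I r.
Proof.
rewrite -ufg -kerf; split=> [e|->]; last exact: tfun_0.
by apply: u_inj; rewrite e tfun_0.
Qed.
Local Notation kerg := comp_kernel.

Lemma map_letter s : map (letter p I f s) = letter p I g s.
Proof.
rewrite /letter; case: pselect => // h; case: cid => r /= sr.
by rewrite ufg -(letter_base purI kerg sr) /letter; case: pselect.
Qed.

Lemma map_inv_letter t s : map t = letter p I g s -> t = letter p I f s.
Proof. by rewrite -map_letter => /(term_map_inj u_inj). Qed.

Lemma map_inv0 t : map t = TRr tzero -> t = TRr tzero.
Proof. by rewrite -(tfun_0 u) => /(@term_map_inj _ _ _ _ u_inj t (TRr _)). Qed.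
Lemma map_inv1 t : map t = TRr tone -> t = TRr tone.
Proof. by rewrite -(tfun_1 u) => /(@term_map_inj _ _ _ _ u_inj t (TRr _)). Qed.
Lemma map_invr t y : map t = TRr y -> exists2 x, t = TRr x & y = u x.
Proof. by case: t => //= x [<-]; exists x. Qed.

Lemma basic_map x y z w :
  basic p I f x y z w -> basic p I g (map x) (map y) (map z) (map w).
Proof.
case=> [[[]-> ->]|[[-> [-> ->]]|[[-> [-> ->]]|[]]]] /=; rewrite ?tfun_0 ?tfun_1.
- by left; split=> //; left.
- by left; split=> //; right.
- by right; left.
- by right; right; left.
- move=> [a [b [c [-> -> -> ->]]]] /=; rewrite tfun_t.
  by do 3!right; left; exists (u a), (u b), (u c).
- move=> [a [b [c [-> -> -> ->]]]] /=; rewrite !map_letter.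
  by do 4!right; exists a, b, c.
Qed.

(** An injective [u] reflects [0], [1], letters and membership in the base, so a clause that applies
    after substitution applied before. Substitution thus creates no new evaluation. *)
Lemma basic_map_inv_t x y z w :
  basic p I g (map x) (map y) (map z) w -> exists w', basic p I f x y z w'.
Proof.
case=> [[[]/map_inv0 ->]|[[/map_inv1 -> [/map_inv0 ->]]|[[/map_inv1 -> [/map_inv0 ->]]|[]]]].
- by exists z; left; split=> //; left.
- by exists z; left; split=> //; right.
- by exists y; right; left.
- by exists x; right; right; left.
- move=> [a [b [c [/map_invr[a' -> _] /map_invr[b' -> _] /map_invr[c' -> _] _]]]].
  by eexists; apply: basic_bases.
- move=> [a [b [c [/map_inv_letter -> /map_inv_letter -> /map_inv_letter -> _]]]].
  by eexists; apply: basic_letters.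
Qed.

Lemma basic_map_inv_q x y z w :
  basic p I g (map x) (map y) z (map w) -> exists z', basic p I f x y z' w.
Proof.
case=> [[[]/map_inv0 -> _]|[[/map_inv1 -> [_ /(term_map_inj u_inj) ->]]|
  [[/map_inv1 -> [_ /(term_map_inj u_inj) ->]]|[]]]].
- by exists w; left; split=> //; left.
- by exists w; left; split=> //; right.
- by exists (TRr tzero); right; left.
- by exists (TRr tzero); right; right; left.
- move=> [a [b [c [/map_invr[a' -> _] /map_invr[b' -> _] _ /map_invr[d' -> _]]]]].
  by exists (TRr (tq a' b' d')); rewrite -{2}[d'](ttq a' b'); apply: basic_bases.
- move=> [a [b [c [/map_inv_letter -> /map_inv_letter -> _ /map_inv_letter ->]]]].
  by eexists; apply: basic_letters.
Qed.

Lemma map_normal t : normal p I f t -> normal p I g (map t).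
Proof.
elim: t => //= [s e|x IHx y IHy z IHz|x IHx y IHy z IHz].
- by rewrite -map_letter e.
- move=> [/IHx nx /IHy ny /IHz nz nb nq]; split=> // -[w].
    by move/basic_map_inv_t.
  case: (z) nq => //= a b c nq [/(term_map_inj u_inj) ea /(term_map_inj u_inj) eb _].
  by apply: nq; exists c; rewrite ea eb.
- move=> [/IHx nx /IHy ny /IHz nz nb nq]; split=> // -[w].
    by move/basic_map_inv_q.
  case: (z) nq => //= a b c nq [/(term_map_inj u_inj) ea /(term_map_inj u_inj) eb _].
  by apply: nq; exists c; rewrite ea eb.
Qed.

Lemma map_smart_t x y z : normal p I f x -> normal p I f y ->
  map (smart_t p I f x y z) = smart_t p I g (map x) (map y) (map z).
Proof.
move=> /map_normal nx /map_normal ny; case: (smart_tP p I f x y z).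
- by move/basic_map => b; rewrite (smart_t_basic purI kerg nx ny b).
- case=> nb e; case: (smart_tP p I g (map x) (map y) (map z)).
  + by move/basic_map_inv_t.
  + by case=> _; rewrite {1}e /= => -[].
  + by case=> _ []; exists (map (smart_t p I f x y z)); rewrite {1}e.
- case=> nb nq ->; case: (smart_tP p I g (map x) (map y) (map z)).
  + by move/basic_map_inv_t.
  + case=> _; move: (smart_t _ _ _ _ _ _) => w.
    case: (z) nq => //= a b c nq [/(term_map_inj u_inj) ea /(term_map_inj u_inj) eb _].
    by case: nq; exists c; rewrite ea eb.
  + by case=> _ _ ->.
Qed.

Lemma map_smart_q x y z : normal p I f x -> normal p I f y ->
  map (smart_q p I f x y z) = smart_q p I g (map x) (map y) (map z).
Proof.
move=> /map_normal nx /map_normal ny; case: (smart_qP p I f x y z).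
- by move/basic_map => b; rewrite (smart_q_basic purI kerg nx ny b).
- case=> nb e; case: (smart_qP p I g (map x) (map y) (map z)).
  + by move/basic_map_inv_q.
  + by case=> _; rewrite {1}e /= => -[].
  + by case=> _ []; exists (map (smart_q p I f x y z)); rewrite {1}e.
- case=> nb nq ->; case: (smart_qP p I g (map x) (map y) (map z)).
  + by move/basic_map_inv_q.
  + case=> _; move: (smart_q _ _ _ _ _ _) => w.
    case: (z) nq => //= a b c nq [/(term_map_inj u_inj) ea /(term_map_inj u_inj) eb _].
    by case: nq; exists c; rewrite ea eb.
  + by case=> _ _ ->.
Qed.

(** Irreducible terms stay irreducible under an injective substitution, hence each branch of the
    smart operations is preserved. *)
Lemma nf_map t : nf p I g (map t) = map (nf p I f t).
Proof.
have nn := normal_nf purI kerf.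
elim: t => //= [s|x -> y -> z ->|x -> y -> z ->].
- by rewrite map_letter.
- by rewrite map_smart_t.
- by rewrite map_smart_q.
Qed.

End Substitution.

(** * Lifting, isomorphisms and equalizers of ternary rings *)

Lemma ternary_lift (A B Z : ternary_ring) (u : ternary_hom A B)
    (g : ternary_hom Z B) :
  injective u -> (forall z, exists a, u a = g z) ->
  exists h : ternary_hom Z A, forall z, u (h z) = g z.
Proof.
move=> ui us; pose v z := sval (cid (us z)).
have uv z : u (v z) = g z by rewrite /v; case: cid.
have vt x y z : v (tt x y z) = tt (v x) (v y) (v z).
  by apply: ui; rewrite tfun_t !uv tfun_t.
have vq x y z : v (tq x y z) = tq (v x) (v y) (v z).
  by apply: ui; rewrite tfun_q !uv tfun_q.
have v0 : v tzero = tzero by apply: ui; rewrite uv !tfun_0.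
have v1 : v tone = tone by apply: ui; rewrite uv !tfun_1.
by exists (TernaryHom vt vq v0 v1).
Qed.

Lemma ternary_iso (A B : ternary_ring) (u : ternary_hom A B) :
  injective u -> (forall b, exists a, u a = b) -> @is_iso ternary A B u.
Proof.
move=> ui us; have [h uh] := ternary_lift (g := ternary_id B) ui us.
by exists h; split; apply: ternary_hom_eq => x //=; apply: ui; rewrite uh.
Qed.

Section TernaryEqualizer.
Variables (A B : ternary_ring) (u v : ternary_hom A B).

Lemma equalizer_t x y z : u x = v x -> u y = v y -> u z = v z ->
  u (tt x y z) = v (tt x y z).
Proof. by rewrite !tfun_t => -> -> ->. Qed.
Lemma equalizer_q x y z : u x = v x -> u y = v y -> u z = v z ->
  u (tq x y z) = v (tq x y z).
Proof. by rewrite !tfun_q => -> -> ->. Qed.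
Lemma equalizer_0 : u tzero = v tzero. Proof. by rewrite !tfun_0. Qed.
Lemma equalizer_1 : u tone = v tone. Proof. by rewrite !tfun_1. Qed.

Definition ternary_equalizer : ternary_ring.
Proof.
refine (@TernaryRing {x | u x = v x}
  (fun x y z => exist _ _ (equalizer_t (svalP x) (svalP y) (svalP z)))
  (fun x y z => exist _ _ (equalizer_q (svalP x) (svalP y) (svalP z)))
  (exist _ _ equalizer_0) (exist _ _ equalizer_1) _ _ _ _ _ _).
- by move=> x [y hy]; apply: eq_exist; rewrite /= tt0l.
- by move=> x [y hy]; apply: eq_exist; rewrite /= tt0r.
- by move=> [x hx]; apply: eq_exist; rewrite /= tt1l.
- by move=> [x hx]; apply: eq_exist; rewrite /= tt1r.
- by move=> x y [z hz]; apply: eq_exist; rewrite /= tqt.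
- by move=> x y [z hz]; apply: eq_exist; rewrite /= ttq.
Defined.

Definition ternary_incl : ternary_hom ternary_equalizer A.
Proof.
by refine (@TernaryHom ternary_equalizer A (fun x => sval (x : {x | u x = v x})) _ _ _ _).
Defined.

Lemma ternary_incl_inj : injective ternary_incl.
Proof. by move=> [x hx] [y hy]; apply: eq_exist. Qed.

Lemma ternary_inclP x : u (ternary_incl x) = v (ternary_incl x).
Proof. by case: x. Qed.

Lemma term_in_incl (S : ternary_ring) (t : ternary_term S A) :
  term_in (fun x => u x = v x) t -> exists t', term_map ternary_incl t' = t.
Proof.
elim: t => /= [s|x ux|x IHx y IHy z IHz|x IHx y IHy z IHz].
- by exists (TRl s).
- by exists (TRr (exist _ x ux : ternary_equalizer)).
- move=> [/IHx[x' <-] /IHy[y' <-] /IHz[z' <-]]; by exists (TRt x' y' z').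
- move=> [/IHx[x' <-] /IHy[y' <-] /IHz[z' <-]]; by exists (TRq x' y' z').
Qed.

End TernaryEqualizer.

Lemma tr_eval_hom (S X Y Z : ternary_ring) (a : ternary_hom S Y)
    (b : ternary_hom X Y) (h : ternary_hom Y Z) (t : ternary_term S X) :
  h (tr_eval a b t) = tr_eval (ternary_cmp h a) (ternary_cmp h b) t.
Proof.
by elim: t => //= [x <- y <- z <-|x <- y <- z <-]; rewrite ?tfun_t ?tfun_q.
Qed.

Lemma tr_eval_map (S X Y Z : ternary_ring) (a : ternary_hom S Z)
    (b : ternary_hom Y Z) (u : ternary_hom X Y) (t : ternary_term S X) :
  tr_eval a b (term_map u t) = tr_eval a (ternary_cmp b u) t.
Proof. by elim: t => //= [x -> y -> z ->|x -> y -> z ->]. Qed.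

(** * Elements of an arbitrary ternary pushout as terms *)

Section TernaryPushoutElements.
Variables (R S X : ternary_ring) (p : ternary_hom R S) (f : ternary_hom R X).
Variable P : @pushout ternary R S X p f.

Definition po_pi (t : ternary_term S X) : po_obj P :=
  tr_eval (po_inl P) (po_inr P) t.

(** The universal map from [P] to the quotient of terms sends [po_pi s] to the class of [s], so an
    equation in [P] gives a derivation of the congruence. *)
Lemma po_piP t t' : po_pi t = po_pi t' <-> ternary_cong p f t t'.
Proof.
have e : @cmp ternary _ _ _ (tr_inl p f) p = @cmp ternary _ _ _ (tr_inr p f) f.
  by apply: ternary_hom_eq => b; apply: tr_piP; apply: tr_glue.
split=> [h|]; last first.
  by apply: tr_eval_cong => b; apply: (ternary_hom_app b (po_square P)).
apply: tr_pi_eq; have pi_eval s : po_desc P e (po_pi s) = tr_pi p f s.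
  rewrite /po_pi tr_eval_hom.
  have -> : ternary_cmp (po_desc P e) (po_inl P) = tr_inl p f := po_desc_inl P e.
  have -> : ternary_cmp (po_desc P e) (po_inr P) = tr_inr p f := po_desc_inr P e.
  elim: s => //= [x -> y -> z ->|x -> y -> z ->].
    exact: tr_tquotE.
  exact: tr_qquotE.
by rewrite -!pi_eval h.
Qed.

Lemma po_pi_surj y : exists t, po_pi t = y.
Proof.
have e : @cmp ternary _ _ _ (tr_inl p f) p = @cmp ternary _ _ _ (tr_inr p f) f.
  by apply: ternary_hom_eq => b; apply: tr_piP; apply: tr_glue.
have eP b : (po_inl P : ternary_hom _ _) (p b) = (po_inr P : ternary_hom _ _) (f b).
  exact: (ternary_hom_app b (po_square P)).
exists (tr_repr (po_desc P e y)).
have : @cmp ternary _ _ _ (tr_desc eP) (po_desc P e) = idm (po_obj P).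
  apply: po_unique; rewrite -cmpA ?po_desc_inl ?po_desc_inr cmp1m;
    apply: ternary_hom_eq => x;
    [exact: (tr_evalE eP (TRl x)) | exact: (tr_evalE eP (TRr x))].
exact: ternary_hom_app.
Qed.

Lemma po_descE (Z : ternary_ring) (u : ternary_hom S Z) (v : ternary_hom X Z)
    (e : @cmp ternary _ _ _ u p = @cmp ternary _ _ _ v f) t :
  po_desc P e (po_pi t) = tr_eval u v t.
Proof.
rewrite /po_pi tr_eval_hom.
have -> : ternary_cmp (po_desc P e) (po_inl P) = u := po_desc_inl P e.
by have -> : ternary_cmp (po_desc P e) (po_inr P) = v := po_desc_inr P e.
Qed.

End TernaryPushoutElements.

(** * Descent for ternary rings *)

Section TernaryDescent.
Variables (R S : comPzRingType) (p : {rmorphism R -> S}).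
Hypothesis pure : cyclically_pure p.
Local Notation Rt := (ternary_of_ring R : ternary).
Local Notation St := (ternary_of_ring S : ternary).
Let pt : hom Rt St := ternary_of_rmorphism p.

Lemma pure_kernel (X : ternary_ring) (f : ternary_hom (ternary_of_ring R) X) r :
  extended_ideal p (fun r => f r = tzero) (p r) -> f r = tzero.
Proof. exact: (pure (ring_hom_ker_ideal f)). Qed.

Lemma po_inr_inj (X : ternary) (f : hom Rt X) (P : pushout pt f) :
  injective (po_inr P : ternary_hom _ _).
Proof.
move=> x x' /(po_piP P (TRr x) (TRr x')).
pose I r := (f : ternary_hom _ _) r = tzero.
have kerf r : (f : ternary_hom _ _) r = tzero <-> I r by [].
have purI r : extended_ideal p I (p r) -> I r by apply: pure_kernel.
by move/(nf_congE purI kerf) => /= -[].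
Qed.

Section Functoriality.
Variables (X Y : ternary) (f : hom Rt X) (g : hom Rt Y).
Variables (P : pushout pt f) (Q : pushout pt g) (u : ternary_hom X Y).
Hypothesis u_inj : injective u.
Hypothesis ufg : @cmp ternary _ _ _ u f = g.

Let I r := (f : ternary_hom _ _) r = tzero.
Let kerf r : (f : ternary_hom _ _) r = tzero <-> I r. Proof. by []. Qed.
Let purI r : extended_ideal p I (p r) -> I r. Proof. exact: pure_kernel. Qed.
Let uf r : u ((f : ternary_hom _ _) r) = (g : ternary_hom _ _) r.
Proof. exact: ternary_hom_app r ufg. Qed.

(** By [nf_map] the two sides have the normal form of [t] with its letters sent through [u] and
    through [v]. Equal terms have equal letters, so the normal form of [t] is the required [t']. *)
Lemma po_pi_map_eq (v : ternary_hom X Y) t :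
  injective v -> @cmp ternary _ _ _ v f = g ->
  po_pi Q (term_map u t) = po_pi Q (term_map v t) ->
  exists2 t', po_pi P t' = po_pi P t & term_in (fun x => u x = v x) t'.
Proof.
move=> v_inj vfg /po_piP /(nf_congE purI (comp_kernel kerf uf u_inj)).
have vf r := ternary_hom_app r vfg.
rewrite (nf_map purI kerf uf u_inj) (nf_map purI kerf vf v_inj) => /term_map_eq h.
by exists (nf p I f t) => //; apply/po_piP; apply: nf_sound.
Qed.

Lemma po_pi_map_inj t t' :
  po_pi Q (term_map u t) = po_pi Q (term_map u t') -> po_pi P t = po_pi P t'.
Proof.
move=> /po_piP /(nf_congE purI (comp_kernel kerf uf u_inj)).
rewrite !(nf_map purI kerf uf u_inj) => /(term_map_inj u_inj) h.
by apply/po_piP/(nf_congE purI kerf).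
Qed.

(** Substitution preserves the shape of a normal form: if the image is a single letter from [Y], the
    normal form of [t] is a single letter from [X]. *)
Lemma po_pi_map_inr t y :
  po_pi Q (term_map u t) = (po_inr Q : ternary_hom _ _) y ->
  exists x, (po_inr P : ternary_hom _ _) x = po_pi P t.
Proof.
move=> /(po_piP Q _ (TRr y)) /(nf_congE purI (comp_kernel kerf uf u_inj)).
rewrite !(nf_map purI kerf uf u_inj) /= => /map_invr[x tx _].
exists x; apply/(po_piP P (TRr x)); rewrite -tx.
exact: nf_sound.
Qed.

End Functoriality.

Theorem ternary_effective_of_pure (po : has_pushouts ternary) :
  effective_codescent po pt.
Proof.
apply: effective_codescentI => [X f|Y psi].
  move=> P P'; have inr_inj := @po_inr_inj X f P.
  split=> [Z h h' e|Z h e eh].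
    by apply: ternary_hom_eq => z; apply: inr_inj; exact: ternary_hom_app z e.
  have [z|k hk] := @ternary_lift _ _ Z (po_inr P) h inr_inj; last first.
    by exists k; apply: ternary_hom_eq => z; apply: hk.
  have [t tz] := po_pi_surj (P := P) ((h : ternary_hom _ _) z).
  (* The equalizing condition, read on a term [t] for [h z]: with its letters moved by the unit, [t]
     becomes a single element of the base. *)
  have et : po_pi P' (term_map (po_inr P) t) = (po_inr P' : ternary_hom _ _) (po_pi P t).
    have := ternary_hom_app z eh; rewrite /= -tz (po_descE _ e) => <-.
    exact: tr_eval_map.
  have [x xt] := po_pi_map_inr P inr_inj (esym (po_square P)) et.
  by exists x; rewrite -tz.
move=> P P' u e0 e1 e2 upsi epsu fuv.
pose f := psi ∘ pt; pose g := po_inl P ∘ pt.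
pose v := po_inr P.
have uf : u ∘ f = g by rewrite cmpA upsi.
have vf : v ∘ f = g := esym (po_square P).
pose eps : ternary_hom (po_obj P) Y := po_desc P e0.
have {}epsu c : eps ((u : ternary_hom _ _) c) = c := ternary_hom_app c epsu.
have u_inj : injective (u : ternary_hom _ _) by apply: can_inj epsu.
have v_inj : injective (v : ternary_hom _ _) by apply: po_inr_inj.
(* Coassociativity on a term [t] for [u c]: the coaction and the unit, applied to the letters of
   [t], give the same element. *)
have uv_pi t c : po_pi P t = (u : ternary_hom _ _) c ->
    po_pi P' (term_map u t) = po_pi P' (term_map v t).
  move=> tc; have := ternary_hom_app c fuv.
  rewrite /= -tc (po_descE _ e1) (po_descE _ e2) => euv.
  by rewrite /po_pi !tr_eval_map; exact: esym euv.
pose D := ternary_equalizer u v.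
pose i : ternary_hom D Y := ternary_incl u v.
have fD r : exists a : D, i a = (f : ternary_hom _ _) r.
  by exists (exist _ _ (ternary_hom_app r (etrans uf (esym vf))) : D).
have [d di] := ternary_lift (@ternary_incl_inj _ _ u v) fD.
have e : psi ∘ pt = @cmp ternary _ _ _ i d.
  by apply: ternary_hom_eq => r; rewrite [RHS](di r).
exists D, d, i, e; split.
  by apply: ternary_hom_eq => c; apply: ternary_inclP.
(* On [D] the coaction agrees with the unit. Hence the comparison map followed by [u] is the
   substitution along [i], whose injectivity is known. *)
have u_eval s : (u : ternary_hom _ _) (tr_eval (psi : ternary_hom _ _) i s)
              = po_pi P (term_map i s).
  rewrite tr_eval_hom /po_pi tr_eval_map.
  congr tr_eval; first exact: upsi.
  by apply: ternary_hom_eq => x; apply: ternary_inclP.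
apply: ternary_iso => [x x'|c].
  have [t <-] := po_pi_surj (P := po _ _ _ pt d) x.
  have [t' <-] := po_pi_surj (P := po _ _ _ pt d) x'.
  rewrite !(po_descE _ e) => /(congr1 (u : ternary_hom _ _)); rewrite !u_eval.
  by apply: po_pi_map_inj => //; apply: ternary_incl_inj.
have [t tc] := po_pi_surj (P := P) ((u : ternary_hom _ _) c).
(* All letters of [t'] lie in the equalizer [D], and the counit [eps] recovers [c] by evaluating
   [t']. *)
have [t' tt' /term_in_incl[n nt']] := po_pi_map_eq P u_inj uf v_inj vf (uv_pi _ _ tc).
exists (po_pi _ n); rewrite (po_descE _ e) -[RHS]epsu -tc -tt' /eps po_descE.
by rewrite -nt' tr_eval_map; congr tr_eval; apply: ternary_hom_eq.
Qed.

End TernaryDescent.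

(** * Injectivity of the unit *)

Section QuotientRing.
Variables (R : comPzRingType) (I : R -> Prop).
Hypothesis Ii : is_ideal I.

Definition ideal_rel : rel R := fun x y => `[< I (x - y) >].

Lemma ideal_rel_equiv : equiv_class_of ideal_rel.
Proof.
split=> [x|x y|y x z /asboolP xy /asboolP yz].
- by apply/asboolP; rewrite subrr; apply: ideal0.
- by apply: asbool_equiv_eq; split; apply: ideal_subC.
- by apply/asboolP; apply: (ideal_sub_trans Ii xy yz).
Qed.

Canonical ideal_equiv := EquivRelPack ideal_rel_equiv.

Definition quot_ring := {eq_quot ideal_equiv}%qT.
HB.instance Definition _ := Choice.on quot_ring.
HB.instance Definition _ := EqQuotient.on quot_ring.

Definition quot_pi (x : R) : quot_ring := \pi_quot_ring%qT x.

Lemma quot_piP x y : quot_pi x = quot_pi y <-> I (x - y).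
Proof.
by split=> [/eqmodP/asboolP|h] //; apply/eqmodP/asboolP.
Qed.

Definition quot_repr (x : quot_ring) : R := repr x.

Lemma quot_reprK x : quot_pi (quot_repr x) = x.
Proof. exact: reprK. Qed.

Lemma quot_repr_pi x : I (quot_repr (quot_pi x) - x).
Proof. by apply/quot_piP; apply: quot_reprK. Qed.

Definition quot_add x y := quot_pi (quot_repr x + quot_repr y).
Definition quot_mul x y := quot_pi (quot_repr x * quot_repr y).
Definition quot_opp x := quot_pi (- quot_repr x).

Lemma quot_addE x y : quot_add (quot_pi x) (quot_pi y) = quot_pi (x + y).
Proof.
apply/quot_piP; rewrite opprD addrACA.
by apply: (idealD Ii); apply: quot_repr_pi.
Qed.
Lemma quot_mulE x y : quot_mul (quot_pi x) (quot_pi y) = quot_pi (x * y).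
Proof.
apply/quot_piP.
have := ideal_subMD Ii (quot_repr_pi x) (quot_repr_pi y) (ideal_sub00 Ii).
by rewrite !addr0.
Qed.
Lemma quot_oppE x : quot_opp (quot_pi x) = quot_pi (- x).
Proof.
by apply/quot_piP; rewrite -opprD; apply: (idealN Ii); apply: quot_repr_pi.
Qed.

Let quotE := (quot_addE, quot_mulE, quot_oppE).

Lemma quot_addA : associative quot_add.
Proof.
move=> x y z; rewrite -(quot_reprK x) -(quot_reprK y) -(quot_reprK z).
by rewrite !quotE addrA.
Qed.
Lemma quot_addC : commutative quot_add.
Proof. by move=> x y; rewrite /quot_add addrC. Qed.
Lemma quot_add0 : left_id (quot_pi 0) quot_add.
Proof. by move=> x; rewrite -(quot_reprK x) quotE add0r. Qed.
Lemma quot_addN : left_inverse (quot_pi 0) quot_opp quot_add.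
Proof. by move=> x; rewrite -(quot_reprK x) !quotE addNr. Qed.

HB.instance Definition _ := GRing.isZmodule.Build quot_ring
  quot_addA quot_addC quot_add0 quot_addN.

Lemma quot_mulA : associative quot_mul.
Proof.
move=> x y z; rewrite -(quot_reprK x) -(quot_reprK y) -(quot_reprK z).
by rewrite !quotE mulrA.
Qed.
Lemma quot_mulC : commutative quot_mul.
Proof. by move=> x y; rewrite /quot_mul mulrC. Qed.
Lemma quot_mul1 : left_id (quot_pi 1) quot_mul.
Proof. by move=> x; rewrite -(quot_reprK x) quotE mul1r. Qed.
Lemma quot_mulDl : left_distributive quot_mul quot_add.
Proof.
move=> x y z; rewrite -(quot_reprK x) -(quot_reprK y) -(quot_reprK z).
by rewrite !quotE mulrDl.
Qed.

HB.instance Definition _ := GRing.Zmodule_isComPzRing.Build quot_ring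
  quot_mulA quot_mulC quot_mul1 quot_mulDl.

Lemma quot_pi_zmod : zmod_morphism quot_pi.
Proof. by move=> x y; rewrite -quot_addE -quot_oppE. Qed.
Lemma quot_pi_monoid : monoid_morphism quot_pi.
Proof. by split=> // x y; rewrite -quot_mulE. Qed.

HB.instance Definition _ :=
  GRing.isZmodMorphism.Build R quot_ring quot_pi quot_pi_zmod.
HB.instance Definition _ :=
  GRing.isMonoidMorphism.Build R quot_ring quot_pi quot_pi_monoid.

Section Lift.
Variables (T : comPzRingType) (h : {rmorphism R -> T}).
Hypothesis hI : forall x, I x -> h x = 0.

Definition quot_lift (x : quot_ring) : T := h (quot_repr x).

Lemma quot_liftE x : quot_lift (quot_pi x) = h x.
Proof.
by apply/eqP; rewrite -subr_eq0 -rmorphB; apply/eqP/hI/quot_repr_pi.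
Qed.

Lemma quot_lift_zmod : zmod_morphism quot_lift.
Proof.
move=> x y; rewrite -(quot_reprK x) -(quot_reprK y).
by rewrite -rmorphB !quot_liftE rmorphB.
Qed.
Lemma quot_lift_monoid : monoid_morphism quot_lift.
Proof.
split=> [|x y]; first by rewrite [LHS]quot_liftE rmorph1.
rewrite -(quot_reprK x) -(quot_reprK y).
by rewrite -rmorphM !quot_liftE rmorphM.
Qed.
Definition quot_lift_rmorphism : {rmorphism quot_ring -> T} :=
  HB.pack quot_lift
    (GRing.isZmodMorphism.Build quot_ring T quot_lift quot_lift_zmod)
    (GRing.isMonoidMorphism.Build quot_ring T quot_lift quot_lift_monoid).
End Lift.

Section TernaryLift.
Variables (T : ternary_ring) (h : ternary_hom (ternary_of_ring R) T).
Hypothesis hI : forall x, I x -> h x = tzero.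

Lemma quot_tliftE x : h (quot_repr (quot_pi x)) = h x.
Proof. by apply/(ring_hom_subE h)/hI/quot_repr_pi. Qed.

Definition quot_ternary_lift : ternary_hom (ternary_of_ring quot_ring) T.
Proof.
refine (@TernaryHom (ternary_of_ring quot_ring) T (fun x => h (quot_repr x)) _ _ _ _).
- move=> x y z; rewrite -(tfun_t h) -[RHS]quot_tliftE; congr (h (quot_repr _)).
  by rewrite /= rmorphD rmorphM /= !quot_reprK.
- move=> x y z; rewrite -(tfun_q h) -[RHS]quot_tliftE; congr (h (quot_repr _)).
  by rewrite /= rmorphB rmorphM /= !quot_reprK.
- by rewrite [LHS]quot_tliftE; exact: tfun_0 h.
- by rewrite [LHS]quot_tliftE; exact: tfun_1 h.
Defined.
End TernaryLift.

End QuotientRing.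

Lemma rmorph_ker_ideal (R T : comPzRingType) (h : {rmorphism R -> T}) :
  is_ideal (fun x => h x = 0).
Proof.
split=> [|x y hx hy|r x hx]; first exact: rmorph0.
- by rewrite rmorphD hx hy addr0.
- by rewrite rmorphM hx mulr0.
Qed.

Section UnitInjective.
Variables (R S : comPzRingType) (p : {rmorphism R -> S}).

(** The quotient of [X] by the kernel of the unit is an epimorphism through which the unit factors,
    hence an isomorphism by [effective_codescent_iso]. *)
Lemma comring_unit_injective (X : comPzRingType) (f : {rmorphism R -> X}) :
  comring_effective_codescent p -> injective (cr_inr p f).
Proof.
move=> eff.
pose inr : {rmorphism X -> _} := cr_inr p f.
pose K := rmorph_ker_ideal inr.
pose Y := quot_ring K : comPzRingType.
pose pi : {rmorphism X -> Y} := quot_pi K.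
have piE x x' : pi x = pi x' <-> inr x = inr x'.
  rewrite quot_piP; split=> [/=|e]; last by rewrite rmorphB e subrr.
  by rewrite rmorphB => /eqP; rewrite subr_eq0 => /eqP.
have lift0 x : inr x = 0 -> inr x = 0 by [].
pose h : {rmorphism Y -> _} := quot_lift_rmorphism K lift0.
have hpi : @cmp comring _ _ _ h pi = inr.
  by apply: rmorphism_eq => x; apply: quot_liftE.
pose X' : @coslice comring R := @CosliceObj comring R X f.
pose Y' : @coslice comring R := @CosliceObj comring R Y (@cmp comring _ _ _ pi f).
pose g : hom X' Y' := @CosliceHom comring R X' Y' pi erefl.
have gepi : @epic comring _ _ pi.
  move=> Z k k' e; apply: rmorphism_eq => y.
  rewrite -(quot_reprK y); exact: comring_hom_app e.
have [k [kg _]] := effective_codescent_iso (g := g) eff gepi hpi.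
move=> x x' /(piE x x') e.
have kx z : (k : {rmorphism _ -> _}) (pi z) = z := comring_hom_app z kg.
by rewrite -(kx x) -(kx x') e.
Qed.

(** The pushout need not be a ring, but [X] is one. The kernel of the unit is therefore an ideal and
    the argument for commutative rings applies. *)
Lemma ternary_unit_injective (X : comPzRingType) (f : {rmorphism R -> X}) :
  ternary_effective_codescent p ->
  injective (tr_inr (ternary_of_rmorphism p) (ternary_of_rmorphism f)).
Proof.
move=> eff.
pose inr := tr_inr (ternary_of_rmorphism p) (ternary_of_rmorphism f).
pose K := ring_hom_ker_ideal inr.
pose Y := quot_ring K : comPzRingType.
pose pi : {rmorphism X -> Y} := quot_pi K.
have piE x x' : pi x = pi x' <-> inr x = inr x'.
  by rewrite quot_piP ring_hom_subE.
have lift0 x : inr x = tzero -> inr x = tzero by [].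
pose h := quot_ternary_lift K lift0.
pose pit := ternary_of_rmorphism pi.
have hpi : @cmp ternary _ _ _ h pit = inr.
  by apply: ternary_hom_eq => x; apply: quot_tliftE.
pose X' := @CosliceObj ternary (ternary_of_ring R) (ternary_of_ring X)
  (ternary_of_rmorphism f).
pose Y' := @CosliceObj ternary (ternary_of_ring R) (ternary_of_ring Y)
  (@cmp ternary _ _ _ pit (ternary_of_rmorphism f)).
pose g : @hom (@coslice ternary _) X' Y' := @CosliceHom ternary _ X' Y' pit erefl.
have gepi : @epic ternary _ _ pit.
  move=> Z k k' e; apply: ternary_hom_eq => y.
  rewrite -(quot_reprK y); exact: (ternary_hom_app _ e).
have [k [kg _]] := effective_codescent_iso (g := g) eff gepi hpi.
move=> x x' /(piE x x') e.
have kx z : (k : ternary_hom _ _) (pit z) = z := ternary_hom_app z kg.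
by rewrite -(kx x) -(kx x'); congr (tfun _ _).
Qed.

End UnitInjective.

Section EffectivePure.
Variables (R S : comPzRingType) (p : {rmorphism R -> S}).

Lemma comring_effective_pure : comring_effective_codescent p -> cyclically_pure p.
Proof.
move=> eff I Ii r pr.
pose f : {rmorphism R -> quot_ring Ii} := quot_pi Ii.
have glue a : cr_inl p f (p a) = cr_inr p f (f a) by apply: cr_piP; apply: cr_glue.
suff /quot_piP : f r = f 0 by rewrite subr0.
apply: (comring_unit_injective (f := f) eff); rewrite -!glue rmorph0.
rewrite (rmorph0 (cr_inl p f)); apply: (pr _ (rmorph_ker_ideal (cr_inl p f))).
move=> a Ia; apply: etrans (glue a) _; have -> : f a = f 0 by apply/quot_piP; rewrite subr0.
by rewrite rmorph0 (rmorph0 (cr_inr p f)).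
Qed.

Lemma ternary_effective_pure : ternary_effective_codescent p -> cyclically_pure p.
Proof.
move=> eff I Ii r pr.
pose f : {rmorphism R -> quot_ring Ii} := quot_pi Ii.
pose pt := ternary_of_rmorphism p; pose ft := ternary_of_rmorphism f.
have glue a : tr_inl pt ft (p a) = tr_inr pt ft (f a).
  by apply: tr_piP; apply: (tr_glue pt ft).
suff /quot_piP : f r = f 0 by rewrite subr0.
apply: (ternary_unit_injective (f := f) eff); rewrite -[LHS]glue -[RHS]glue rmorph0.
rewrite [RHS](tfun_0 (tr_inl pt ft)); apply: (pr _ (ring_hom_ker_ideal (tr_inl pt ft))).
move=> a Ia; apply: etrans (glue a) _; have -> : f a = f 0 by apply/quot_piP; rewrite subr0.
by rewrite rmorph0 (tfun_0 (tr_inr pt ft)).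
Qed.

End EffectivePure.

(** * Tensor products of commutative rings *)

Section NearBilinear.
Variables (B E D : comPzRingType) (p : {rmorphism B -> E})
  (f : {rmorphism B -> D}).

(* The list of the [(s_i, c_i)] stands for the sum of the [s_i (x) c_i]. *)
Fixpoint expand (t : comring_term E D) : seq (E * D) :=
  match t with
  | CRl s => [:: (s, 1)]
  | CRr c => [:: (1, c)]
  | CRadd x y => expand x ++ expand y
  | CRopp x => [seq (a.1, - a.2) | a <- expand x]
  | CRmul x y => [seq (a.1 * b.1, a.2 * b.2) | a <- expand x, b <- expand y]
  end.

Variables (F : Type) (near : (F -> Prop) -> Prop).
Hypothesis nearT : forall P : F -> Prop, (forall r, P r) -> near P.
Hypothesis near2 : forall P Q T : F -> Prop,
  near P -> near Q -> (forall r, P r -> Q r -> T r) -> near T.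

Lemma near1 (P Q : F -> Prop) : near P -> (forall r, P r -> Q r) -> near Q.
Proof. by move=> nP PQ; apply: (near2 nP nP) => r Pr _; apply: PQ. Qed.

Lemma near_and (P Q : F -> Prop) :
  near P -> near Q -> near (fun r => P r /\ Q r).
Proof. by move=> nP nQ; apply: (near2 nP nQ). Qed.

Lemma near_seq (A : eqType) (s : seq A) (P : A -> F -> Prop) :
  (forall a, near (P a)) -> near (fun r => forall a, a \in s -> P a r).
Proof.
move=> nP; elim: s => [|b s IHs]; first exact: nearT.
apply: (near2 (nP b) IHs) => r Pb Ps a; rewrite inE => /orP[/eqP->//|].
exact: Ps.
Qed.

Variable A : zmodType.
Implicit Type phi : F -> E -> D -> A.

(** No single [phi r] need be bilinear. Each instance of the identities holds for nearly all [r],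
    and finitely many such conditions hold nearly always together; a derivation in [comring_cong]
    calls for no more than that. *)
Record near_bilinear phi : Prop := NearBilinear {
  nb_addl : forall s s' c, near (fun r => phi r (s + s') c = phi r s c + phi r s' c);
  nb_addr : forall s c c', near (fun r => phi r s (c + c') = phi r s c + phi r s c');
  nb_bal : forall b s c, near (fun r => phi r (p b * s) c = phi r s (f b * c)) }.

Definition lsum phi r (l : seq (E * D)) : A := \sum_(a <- l) phi r a.1 a.2.

Lemma lsum_cat phi r l m : lsum phi r (l ++ m) = lsum phi r l + lsum phi r m.
Proof. exact: big_cat. Qed.

Lemma lsum1 phi r a : lsum phi r [:: a] = phi r a.1 a.2.
Proof. exact: big_seq1. Qed.

Lemma lsum_mul phi r l m :
  lsum phi r [seq (a.1 * b.1, a.2 * b.2) | a <- l, b <- m]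
  = \sum_(a <- l) \sum_(b <- m) phi r (a.1 * b.1) (a.2 * b.2).
Proof. exact: big_allpairs_dep. Qed.

Lemma near_bilinear_mul phi a : near_bilinear phi ->
  near_bilinear (fun r s c => phi r (s * a.1) (c * a.2)).
Proof.
case=> hl hr hb; split=> [s s' c|s c c'|b s c].
- by apply: near1 (hl (s * a.1) (s' * a.1) (c * a.2)) _ => r; rewrite mulrDl.
- by apply: near1 (hr (s * a.1) (c * a.2) (c' * a.2)) _ => r; rewrite mulrDl.
- by apply: near1 (hb b (s * a.1) (c * a.2)) _ => r; rewrite !mulrA.
Qed.

Lemma near_bil0l phi c : near_bilinear phi -> near (fun r => phi r 0 c = 0).
Proof.
case=> hl _ _; apply: near1 (hl 0 0 c) _ => r.
by rewrite addr0 => /eqP; rewrite addrC -subr_eq subrr eq_sym => /eqP.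
Qed.

Lemma near_bil0r phi s : near_bilinear phi -> near (fun r => phi r s 0 = 0).
Proof.
case=> _ hr _; apply: near1 (hr s 0 0) _ => r.
by rewrite addr0 => /eqP; rewrite addrC -subr_eq subrr eq_sym => /eqP.
Qed.

Lemma near_bilN phi s c :
  near_bilinear phi -> near (fun r => phi r s (- c) = - phi r s c).
Proof.
move=> nb; apply: near2 (near_bil0r s nb) (nb_addr nb s (- c) c) _ => r.
by rewrite addNr => -> /eqP; rewrite eq_sym addr_eq0 => /eqP.
Qed.

Lemma near_lsumN phi l : near_bilinear phi ->
  near (fun r => lsum phi r [seq (a.1, - a.2) | a <- l] = - lsum phi r l).
Proof.
move=> nb; apply: near1 (near_seq l (fun a => near_bilN a.1 a.2 nb)) _ => r h.
by rewrite /lsum big_map -sumrN; apply: eq_big_seq => a /h.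
Qed.

Lemma lsum_mull phi r l m :
  lsum phi r [seq (a.1 * b.1, a.2 * b.2) | a <- l, b <- m]
  = \sum_(b <- m) lsum (fun r s c => phi r (s * b.1) (c * b.2)) r l.
Proof. by rewrite lsum_mul exchange_big. Qed.

Lemma lsum_mulr phi r l m :
  lsum phi r [seq (a.1 * b.1, a.2 * b.2) | a <- l, b <- m]
  = \sum_(a <- l) lsum (fun r s c => phi r (s * a.1) (c * a.2)) r m.
Proof.
rewrite lsum_mul; apply: eq_bigr => a _; apply: eq_bigr => b _.
by rewrite (mulrC a.1) (mulrC a.2).
Qed.

(** Induction on the derivation for all [phi] at once, since the product case passes from [phi] to
    its translates by elements of the other factor. *)
Lemma near_lsum_cong phi x y : near_bilinear phi -> comring_cong p f x y ->
  near (fun r => lsum phi r (expand x) = lsum phi r (expand y)).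
Proof.
move=> + xy; elim: xy phi => {x y}.
- by move=> x phi _; apply: nearT.
- by move=> x y _ IH phi nb; apply: near1 (IH _ nb) _.
- by move=> x y z _ IH1 _ IH2 phi nb; apply: near2 (IH1 _ nb) (IH2 _ nb) _ => r -> ->.
- move=> x x' y y' _ IH1 _ IH2 phi nb.
  by apply: near2 (IH1 _ nb) (IH2 _ nb) _ => r /= e e'; rewrite !lsum_cat e e'.
- move=> x x' _ IH phi nb.
  apply: near2 (near_and (near_lsumN (expand x) nb) (near_lsumN (expand x') nb)) (IH _ nb) _.
  by move=> r /= [-> ->] ->.
(* The factors are exchanged one at a time, with one translate of [phi] for each summand of the
   factor held fixed. *)
- move=> x x' y y' _ IH1 _ IH2 phi nb.
  have n1 := near_seq (expand y) (fun b => IH1 _ (near_bilinear_mul b nb)).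
  have n2 := near_seq (expand x') (fun a => IH2 _ (near_bilinear_mul a nb)).
  apply: near2 n1 n2 _ => r e1 e2 /=.
  transitivity (lsum phi r (expand (CRmul x' y))).
    by rewrite /= !lsum_mull; apply: eq_big_seq.
  by rewrite /= !lsum_mulr; apply: eq_big_seq.
- by move=> x y z phi nb; apply: nearT => r /=; rewrite catA.
- by move=> x y phi nb; apply: nearT => r /=; rewrite !lsum_cat addrC.
- move=> x phi nb; apply: near1 (near_bil0l 1 nb) _ => r e /=.
  by rewrite (lsum_cat _ _ [:: _]) lsum1 e add0r.
- move=> x phi nb; apply: near2 (near_bil0l 1 nb) (near_lsumN (expand x) nb) _.
  by move=> r e e' /=; rewrite lsum_cat e' addNr lsum1 e.
- move=> x y z phi nb; apply: nearT => r /=; rewrite lsum_mull [RHS]lsum_mull.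
  rewrite [in LHS]/lsum.
  rewrite big_allpairs_dep /= exchange_big /=; apply: eq_bigr => c _.
  rewrite lsum_mull; apply: eq_bigr => b _.
  by apply: eq_bigr => a _ /=; rewrite !mulrA.
- move=> x y phi nb; apply: nearT => r /=; rewrite lsum_mull lsum_mulr.
  by apply: eq_bigr => b _.
- move=> x phi nb; apply: nearT => r /=; rewrite cats0 /lsum big_map.
  by apply: eq_bigr => b _ /=; rewrite !mul1r.
- move=> x y z phi nb; apply: nearT => r /=.
  by rewrite lsum_cat !lsum_mulr big_cat.
- move=> a b phi nb; apply: near1 (nb_addl nb a b 1) _ => r e.
  by rewrite /lsum /= !big_cons !big_nil !addr0.
- by move=> a b phi nb; apply: nearT => r /=; rewrite !lsum1 /= mulr1.
- move=> a b phi nb; apply: near1 (nb_addr nb 1 a b) _ => r e.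
  by rewrite /lsum /= !big_cons !big_nil !addr0.
- by move=> a b phi nb; apply: nearT => r /=; rewrite !lsum1 /= mulr1.
- by move=> phi nb; apply: nearT.
- move=> b phi nb; apply: near1 (nb_bal nb b 1 1) _ => r /=.
  by rewrite !lsum1 /= !mulr1.
Qed.

End NearBilinear.

Lemma comring_desc_eq (B E D : comPzRingType) (p : {rmorphism B -> E})
    (f : {rmorphism B -> D}) :
  @cmp comring _ _ _ (cr_inl p f : {rmorphism _ -> _}) p
  = @cmp comring _ _ _ (cr_inr p f : {rmorphism _ -> _}) f.
Proof. by apply: rmorphism_eq => b; apply: cr_piP; apply: cr_glue. Qed.

Section PushoutElements.
Variables (R S X : comPzRingType) (p : {rmorphism R -> S}) (f : {rmorphism R -> X}).
Variable P : @pushout comring R S X p f.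
Let T : comPzRingType := po_obj P.
Let inl : {rmorphism S -> T} := po_inl P.
Let inr : {rmorphism X -> T} := po_inr P.

Definition tensor_sum (l : seq (S * X)) : T := \sum_(a <- l) inl a.1 * inr a.2.

Lemma po_glue b : inl (p b) = inr (f b).
Proof. exact: (comring_hom_app b (po_square P)). Qed.

Lemma cr_eval_expand t : cr_eval inl inr t = tensor_sum (expand t).
Proof.
rewrite /tensor_sum; elim: t => /= [s|c|x -> y ->|x ->|x -> y ->].
- by rewrite big_seq1 /= rmorph1 mulr1.
- by rewrite big_seq1 /= rmorph1 mul1r.
- by rewrite big_cat.
- by rewrite big_map -sumrN; apply: eq_bigr => a _; rewrite /= rmorphN mulrN.
- rewrite big_allpairs_dep big_distrl; apply: eq_bigr => a _.
  rewrite big_distrr; apply: eq_bigr => b _ /=.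
  by rewrite !rmorphM mulrACA.
Qed.

Lemma tensor_sum_surj (y : T) : exists l, tensor_sum l = y.
Proof.
pose d := po_desc P (comring_desc_eq p f) : {rmorphism T -> _}.
exists (expand (cr_repr (d y))); rewrite -cr_eval_expand.
have : @cmp comring _ _ _ (cr_desc_rmorphism po_glue) d = idm (po_obj P).
  apply: po_unique; rewrite -cmpA ?po_desc_inl ?po_desc_inr cmp1m;
    apply: rmorphism_eq => x;
    [exact: (cr_descE po_glue (CRl x)) | exact: (cr_descE po_glue (CRr x))].
exact: comring_hom_app.
Qed.

Definition term_of_list (l : seq (S * X)) : comring_term S X :=
  foldr (fun a t => CRadd (CRmul (CRl a.1) (CRr a.2)) t) (CRl 0) l.

Section Near.
Variables (F : Type) (near : (F -> Prop) -> Prop).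
Hypothesis nearT : forall P : F -> Prop, (forall r, P r) -> near P.
Hypothesis near2 : forall P Q T : F -> Prop,
  near P -> near Q -> (forall r, P r -> Q r -> T r) -> near T.
Variables (A : zmodType) (phi : F -> S -> X -> A).
Hypothesis nb : near_bilinear p f near phi.

Lemma near_lsum_term l :
  near (fun r => lsum phi r (expand (term_of_list l)) = lsum phi r l).
Proof.
elim: l => [|a l IHl] /=.
  apply: (near1 near2) (near_bil0l near2 1 nb) _ => r e.
  by rewrite lsum1 e /lsum big_nil.
apply: (near1 near2) IHl _ => r e.
by rewrite (lsum_cat _ _ [:: _]) lsum1 /= mulr1 mul1r e /lsum big_cons.
Qed.

(** The universal property of the tensor product for nearly bilinear families: an equation in [P] is
    carried to the quotient of terms, where it is a derivation. *)
Lemma near_tensor_sum l l' : tensor_sum l = tensor_sum l' ->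
  near (fun r => lsum phi r l = lsum phi r l').
Proof.
pose d := po_desc P (comring_desc_eq p f) : {rmorphism T -> _}.
have dE m : d (tensor_sum m) = cr_pi p f (term_of_list m).
  have dl s : d (inl s) = cr_inl p f s.
    exact: (comring_hom_app s (po_desc_inl P (comring_desc_eq p f))).
  have dr s : d (inr s) = cr_inr p f s.
    exact: (comring_hom_app s (po_desc_inr P (comring_desc_eq p f))).
  rewrite /tensor_sum; elim: m => [|a m IHm]; first by rewrite big_nil rmorph0.
  by rewrite big_cons rmorphD rmorphM dl dr IHm [_ * _]cr_mulqE [LHS]cr_addqE.
move=> /(congr1 d); rewrite !dE => /cr_pi_eq cll'.
have n := near_lsum_cong nearT near2 nb cll'.
apply: near2 (near2 (near_lsum_term l) (near_lsum_term l') (fun r => @conj _ _)) n _.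
by move=> r [-> ->].
Qed.

End Near.

Lemma po_desc_tensor_sum (Z : comPzRingType) (u : {rmorphism S -> Z})
    (v : {rmorphism X -> Z})
    (e : @cmp comring _ _ _ u p = @cmp comring _ _ _ v f) l :
  (po_desc P e : {rmorphism _ -> _}) (tensor_sum l) = \sum_(a <- l) u a.1 * v a.2.
Proof.
pose d : {rmorphism T -> Z} := po_desc P e.
have dl s : d (inl s) = u s := comring_hom_app s (po_desc_inl P e).
have dr s : d (inr s) = v s := comring_hom_app s (po_desc_inr P e).
rewrite -[LHS]/(d _) /tensor_sum raddf_sum; apply: eq_bigr => a _.
by rewrite [LHS](rmorphM d) dl dr.
Qed.

End PushoutElements.

(** * Descent along pure ring homomorphisms *)

Section Purity.
Variables (R S : comPzRingType) (p : {rmorphism R -> S}).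
Implicit Types (r : S -> R) (rel : seq (R * S)).

Definition linear_relation rel : Prop := \sum_(a <- rel) p a.1 * a.2 = 0.

Definition satisfies r rel : Prop := \sum_(a <- rel) a.1 * r a.2 = 0.

(* The equational form of purity of [p] as a monomorphism of [R]-modules. *)
Definition pure : Prop := forall rels : seq (seq (R * S)),
  (forall rel, rel \in rels -> linear_relation rel) ->
  exists2 r, r 1 = 1 & forall rel, rel \in rels -> satisfies r rel.

(** The condition holds for all functions [r] that fix [1] and respect some finite set of linear
    relations of [S]. Purity of [p] says that the impossible condition does not hold nearly. *)
Definition near_retraction (P : (S -> R) -> Prop) : Prop :=
  exists2 rels : seq (seq (R * S)),
    (forall rel, rel \in rels -> linear_relation rel) &
    forall r, r 1 = 1 -> (forall rel, rel \in rels -> satisfies r rel) -> P r.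

Local Notation near := near_retraction.

Lemma near_retractionT (P : (S -> R) -> Prop) : (forall r, P r) -> near P.
Proof. by move=> hP; exists [::]. Qed.

Lemma near_retraction2 (P Q T : (S -> R) -> Prop) :
  near P -> near Q -> (forall r, P r -> Q r -> T r) -> near T.
Proof.
move=> [l lP hP] [m mQ hQ] PQT; exists (l ++ m) => [rel|r r1 rlm].
  by rewrite mem_cat => /orP[/lP|/mQ].
apply: PQT; [apply: hP|apply: hQ] => // rel h; apply: rlm; rewrite mem_cat h //.
by rewrite orbT.
Qed.

Lemma near_one : near (fun r => r 1 = 1).
Proof. by exists [::]. Qed.

Lemma near_relation rel : linear_relation rel -> near (fun r => satisfies r rel).
Proof.
move=> hrel; exists [:: rel] => [rel'|r _ h]; first by rewrite inE => /eqP ->.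
by apply: h; rewrite inE.
Qed.

Lemma near_ex (P : (S -> R) -> Prop) : pure -> near P -> exists r, P r.
Proof. by move=> pp [l lP hP]; have [r r1 rl] := pp l lP; exists r; apply: hP. Qed.

Section Scalars.
Variables (X : comPzRingType) (f : {rmorphism R -> X}).

(** The contraction [s (x) c -> r(s) c] of [S (x) X] to [X] that an [R]-linear [r] would induce. *)
Definition retract_scale r (s : S) (c : X) : X := f (r s) * c.

(** Additivity of [r] at two given elements and its linearity at one are each a single linear
    relation among elements of [S]. *)
Lemma near_bilinear_retract : near_bilinear p f near retract_scale.
Proof.
rewrite /retract_scale; split=> [s s' c|s c c'|b s c].
- have /near_relation : linear_relation [:: (1, s + s'); (-1, s); (-1, s')].
    by rewrite /linear_relation !big_cons big_nil /= rmorphN rmorph1; ring.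
  move=> h; apply: (near1 near_retraction2) h _ => r.
  rewrite /satisfies !big_cons big_nil /= mul1r !mulN1r addr0 -opprD => /eqP.
  by rewrite subr_eq0 => /eqP ->; rewrite rmorphD mulrDl.
- by apply: near_retractionT => r; rewrite mulrDr.
- have /near_relation : linear_relation [:: (1, p b * s); (- b, s)].
    by rewrite /linear_relation !big_cons big_nil /= rmorphN rmorph1; ring.
  move=> h; apply: (near1 near_retraction2) h _ => r.
  rewrite /satisfies !big_cons big_nil /= mul1r addr0 mulNr => /eqP.
  by rewrite subr_eq0 => /eqP ->; rewrite rmorphM; ring.
Qed.

End Scalars.

End Purity.

Lemma comring_lift (A B Z : comPzRingType) (u : {rmorphism A -> B})
    (g : {rmorphism Z -> B}) :
  injective u -> (forall z, exists a, u a = g z) ->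
  exists h : {rmorphism Z -> A}, forall z, u (h z) = g z.
Proof.
move=> ui us; pose v z := sval (cid (us z)).
have uv z : u (v z) = g z by rewrite /v; case: cid.
have vB : zmod_morphism v by move=> x y; apply: ui; rewrite rmorphB !uv rmorphB.
have vM : monoid_morphism v.
  by split=> [|x y]; apply: ui; rewrite ?rmorph1 ?rmorphM !uv ?rmorph1 ?rmorphM.
pose h : {rmorphism Z -> A} := HB.pack v
  (GRing.isZmodMorphism.Build Z A v vB) (GRing.isMonoidMorphism.Build Z A v vM).
by exists h.
Qed.

Lemma comring_iso (A B : comPzRingType) (u : {rmorphism A -> B}) :
  injective u -> (forall b, exists a, u a = b) -> @is_iso comring A B u.
Proof.
move=> ui us.
have [h uh] := comring_lift (g := idfun : {rmorphism B -> B}) ui us.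
by exists h; split; apply: rmorphism_eq => x //=; apply: ui; rewrite uh.
Qed.

Section ComringEqualizer.
Variables (A B : comPzRingType) (u v : {rmorphism A -> B}).

Definition equalizer_pred : {pred A} := fun x => u x == v x.

Lemma equalizer_subring : subring_closed equalizer_pred.
Proof.
by split=> [|x y|x y]; rewrite !unfold_in ?rmorph1 // ?rmorphB ?rmorphM
  => /eqP -> /eqP ->.
Qed.

Record comring_equalizer :=
  ComringEqualizer { equalizer_val : A; _ : equalizer_val \in equalizer_pred }.

HB.instance Definition _ := [isSub for equalizer_val].
HB.instance Definition _ := [Choice of comring_equalizer by <:].
HB.instance Definition _ :=
  GRing.SubChoice_isSubComPzRing.Build A _ comring_equalizer equalizer_subring.

Definition comring_incl : {rmorphism comring_equalizer -> A} :=
  val : {rmorphism comring_equalizer -> A}.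

Lemma comring_inclP x : u (comring_incl x) = v (comring_incl x).
Proof. by case: x => x /= /eqP. Qed.

Lemma comring_incl_surj a : u a = v a -> exists x, comring_incl x = a.
Proof. by move=> /eqP ua; exists (ComringEqualizer ua). Qed.

End ComringEqualizer.

Section ComringDescent.
Variables (R S : comPzRingType) (p : {rmorphism R -> S}).
Hypothesis p_pure : pure p.
Local Notation near := (near_retraction p).
Let pc : @hom comring R S := p.

Lemma near_retract_sum (X : comPzRingType) (f : {rmorphism R -> X})
    (P : @pushout comring R S X p f) l l' :
  tensor_sum P l = tensor_sum P l' ->
  near (fun r => lsum (retract_scale f) r l = lsum (retract_scale f) r l').
Proof.
exact: (near_tensor_sum (@near_retractionT _ _ p) (@near_retraction2 _ _ p)
  (near_bilinear_retract p f)).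
Qed.

Lemma tensor_sum1 (X : comPzRingType) (f : {rmorphism R -> X})
    (P : @pushout comring R S X p f) x :
  tensor_sum P [:: (1, x)] = (po_inr P : {rmorphism _ -> _}) x.
Proof. by rewrite /tensor_sum big_seq1 rmorph1 mul1r. Qed.

Lemma comring_po_inr_inj (X : comPzRingType) (f : {rmorphism R -> X})
    (P : @pushout comring R S X p f) :
  injective (po_inr P : {rmorphism _ -> _}).
Proof.
move=> x x'; rewrite -!tensor_sum1 => /near_retract_sum h.
have [r [r1]] := near_ex p_pure (near_and (@near_retraction2 _ _ p) (near_one p) h).
by rewrite !lsum1 /retract_scale /= r1 rmorph1 !mul1r.
Qed.

Lemma lsum_retract_map (X Y : comPzRingType) (f : {rmorphism R -> X})
    (g : {rmorphism R -> Y}) (u : {rmorphism X -> Y}) (r : S -> R) (l : seq (S * X)) :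
  (forall b, u (f b) = g b) ->
  lsum (retract_scale g) r [seq (a.1, u a.2) | a <- l]
  = u (lsum (retract_scale f) r l).
Proof.
move=> ufg; rewrite /lsum big_map [RHS]raddf_sum; apply: eq_bigr => a _.
by rewrite /retract_scale [RHS](rmorphM u) ufg.
Qed.

Lemma tensor_sum_map (X Y : comPzRingType) (f : {rmorphism R -> X})
    (g : {rmorphism R -> Y}) (u : {rmorphism X -> Y})
    (P : @pushout comring R S X p f) (Q : @pushout comring R S Y p g)
    (e : po_inl Q ∘ pc = po_inr Q ∘ u ∘ (f : @hom comring _ _)) l :
  (po_desc P e : {rmorphism _ -> _}) (tensor_sum P l)
  = tensor_sum Q [seq (a.1, u a.2) | a <- l].
Proof. by rewrite po_desc_tensor_sum /tensor_sum big_map. Qed.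

Section Coalgebra.
Variables (Y : comPzRingType) (psi : {rmorphism S -> Y}) (f : {rmorphism R -> Y}).
Hypothesis psif : forall b, psi (p b) = f b.
Variable P : @pushout comring R S Y p f.
Local Notation T := (po_obj P : comPzRingType).
Let inl : {rmorphism S -> T} := po_inl P.
Let inr : {rmorphism Y -> T} := po_inr P.
Variable g : {rmorphism R -> T}.
Hypothesis inlg : forall b, inl (p b) = g b.
Variable P' : @pushout comring R S T p g.
Local Notation T' := (po_obj P' : comPzRingType).
Let inl' : {rmorphism S -> T'} := po_inl P'.
Let inr' : {rmorphism T -> T'} := po_inr P'.
Variables (u : {rmorphism Y -> T}) (eps : {rmorphism T -> Y}).
Hypothesis upsi : forall s, u (psi s) = inl s.
Hypothesis eps_inl : forall s, eps (inl s) = psi s.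
Hypothesis eps_inr : forall y, eps (inr y) = y.
Hypothesis epsu : forall y, eps (u y) = y.
Hypothesis coassoc : forall l c, tensor_sum P l = u c ->
  tensor_sum P' [seq (a.1, inr a.2) | a <- l]
  = tensor_sum P' [seq (a.1, u a.2) | a <- l].

Let inrf b : inr (f b) = g b.
Proof. by rewrite -inlg; apply: esym (po_glue P b). Qed.
Let uf b : u (f b) = g b.
Proof. by rewrite -psif upsi inlg. Qed.

Definition coaction_list (c : Y) : seq (S * Y) :=
  sval (cid (tensor_sum_surj (P := P) (u c))).
Local Notation L := coaction_list.

Lemma coaction_listE c : tensor_sum P (L c) = u c.
Proof. by rewrite /coaction_list; case: cid. Qed.

(** The coaction followed by the contraction along [r]. It is computed from one chosen expansion of
    [u c]; by [near_retract] any other gives nearly the same. *)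
Definition retract (r : S -> R) (c : Y) : Y := lsum (retract_scale f) r (L c).

Lemma near_retract l c : tensor_sum P l = u c ->
  near (fun r => retract r c = lsum (retract_scale f) r l).
Proof. by rewrite -coaction_listE => /esym /near_retract_sum. Qed.

(** Contracting the outer copy of [S] in the coassociativity equation gives exactly this
    equation. *)
Lemma near_retract_descended c :
  near (fun r => u (retract r c) = inr (retract r c)).
Proof.
have /near_retract_sum h := coassoc (coaction_listE c).
apply: (near1 (@near_retraction2 _ _ p)) h _ => r.
by rewrite (lsum_retract_map _ _ inrf) (lsum_retract_map _ _ uf).
Qed.

Lemma near_retractD c c' :
  near (fun r => retract r (c + c') = retract r c + retract r c').
Proof.
have h : tensor_sum P (L c ++ L c') = u (c + c').
  by rewrite /tensor_sum big_cat rmorphD -!coaction_listE.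
by apply: (near1 (@near_retraction2 _ _ p)) (near_retract h) _ => r ->; rewrite lsum_cat.
Qed.

Lemma near_retractZ b c :
  near (fun r => retract r (f b * c) = f b * retract r c).
Proof.
have h : tensor_sum P [seq (a.1, f b * a.2) | a <- L c] = u (f b * c).
  rewrite rmorphM uf -coaction_listE /tensor_sum big_map big_distrr /=.
  by apply: eq_bigr => a _; rewrite -[po_inr P]/inr rmorphM inrf mulrCA.
apply: (near1 (@near_retraction2 _ _ p)) (near_retract h) _ => r ->.
rewrite /retract /lsum big_map big_distrr; apply: eq_bigr => a _.
by rewrite /retract_scale mulrCA.
Qed.

Lemma near_retract_id c : u c = inr c -> near (fun r => retract r c = c).
Proof.
move=> uc; have h : tensor_sum P [:: (1, c)] = u c by rewrite tensor_sum1 uc.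
apply: (@near_retraction2 _ _ p) (near_one p) (near_retract h) _ => r r1 ->.
by rewrite lsum1 /retract_scale /= r1 rmorph1 mul1r.
Qed.

(* The coassociativity equation in [S (x) S (x) Y], read after exchanging the
   two copies of [S], so that the retraction is applied to the inner one. *)
Lemma near_coaction_retract c :
  near (fun r => u c = \sum_(a <- L c) inl a.1 * inr (retract r a.2)).
Proof.
have inlg' b : inl' (p b) = inr' (g b) := po_glue P' b.
pose inr2 : {rmorphism Y -> T'} := inr' \o inr.
have e1 : @cmp comring _ _ _ inl' p = @cmp comring _ _ _ inr2 f.
  by apply: rmorphism_eq => b; rewrite /= inrf.
pose F1 : {rmorphism T -> T'} := po_desc P e1.
have F1l s : F1 (inl s) = inl' s := comring_hom_app s (po_desc_inl P e1).
have F1r y : F1 (inr y) = inr' (inr y) := comring_hom_app y (po_desc_inr P e1).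
pose inl2 : {rmorphism S -> T'} := inr' \o inl.
have e2 : @cmp comring _ _ _ inl2 p = @cmp comring _ _ _ F1 g.
  by apply: rmorphism_eq => b; rewrite /= -inlg F1l inlg' inlg.
(* The endomorphism [po_desc P' e2] of the double tensor product exchanges the two copies of [S]. *)
have /(congr1 (po_desc P' e2 : {rmorphism _ -> _})) := coassoc (coaction_listE c).
rewrite !po_desc_tensor_sum !big_map /=.
have -> : \sum_(a <- L c) inr' (inl a.1) * F1 (inr a.2)
        = tensor_sum P' [:: (1, u c)].
  rewrite tensor_sum1 -coaction_listE /tensor_sum [RHS](raddf_sum inr').
  by apply: eq_bigr => a _; rewrite F1r [RHS](rmorphM inr').
have -> : \sum_(a <- L c) inr' (inl a.1) * F1 (u a.2)
        = tensor_sum P' [seq (b.1, inl a.1 * inr b.2) | a <- L c, b <- L a.2].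
  rewrite /tensor_sum big_allpairs_dep; apply: eq_bigr => a _.
  rewrite -coaction_listE po_desc_tensor_sum big_distrr; apply: eq_bigr => b _.
  by rewrite /= -[po_inr P']/inr' rmorphM mulrCA.
move=> /near_retract_sum h.
apply: (@near_retraction2 _ _ p) (near_one p) h _ => r r1.
rewrite lsum1 /retract_scale /= r1 rmorph1 mul1r => ->.
rewrite /lsum big_allpairs_dep; apply: eq_bigr => a _.
rewrite /retract /lsum (raddf_sum inr) big_distrr; apply: eq_bigr => b _ /=.
by rewrite /retract_scale rmorphM inrf mulrCA.
Qed.

Let D : comPzRingType := comring_equalizer u inr.
Let i : {rmorphism D -> Y} := comring_incl u inr.

(** The value [0] is only a default: [retract r c] lies in [D] for nearly all [r], not for all. *)
Definition descend (y : Y) : D :=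
  match pselect (u y = inr y) with
  | left h => ComringEqualizer (introT eqP h)
  | right _ => 0
  end.

Lemma descendK y : u y = inr y -> i (descend y) = y.
Proof. by rewrite /descend; case: pselect. Qed.

Variable d : {rmorphism R -> D}.
Hypothesis di : forall b, i (d b) = f b.
Variable Q : @pushout comring R S D p d.
Local Notation TQ := (po_obj Q : comPzRingType).
Let inlQ : {rmorphism S -> TQ} := po_inl Q.
Let inrQ : {rmorphism D -> TQ} := po_inr Q.
Variable w : {rmorphism TQ -> Y}.
Hypothesis wl : forall s, w (inlQ s) = psi s.
Hypothesis wr : forall x, w (inrQ x) = i x.

(** For a single [r] meeting finitely many conditions, [u c] is the sum of the [s_i (x) r(y_i)] with
    all [r(y_i)] in [D]. The counit turns this into an expression of [c] in the image of [w]. *)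
Lemma coalgebra_generated c : exists z, w z = c.
Proof.
have h := near_and (@near_retraction2 _ _ p) (near_coaction_retract c)
  (near_seq (@near_retractionT _ _ p) (@near_retraction2 _ _ p) (L c)
    (fun a => near_retract_descended a.2)).
have [r [uc rD]] := near_ex p_pure h.
exists (\sum_(a <- L c) inlQ a.1 * inrQ (descend (retract r a.2))).
rewrite -[RHS]epsu uc [LHS](raddf_sum w) [RHS](raddf_sum eps).
apply: eq_big_seq => a /rD ra; rewrite [LHS](rmorphM w) [RHS](rmorphM eps).
by rewrite wl wr eps_inl eps_inr descendK.
Qed.

Lemma descended_incl_inj : injective i. Proof. exact: val_inj. Qed.

(** The family approximates a map from [S (x) Y] to [S (x) D] that is left inverse to the one
    induced by [i]. *)
Lemma near_bilinear_descend :
  near_bilinear p f near (fun r s c => inlQ s * inrQ (descend (retract r c))).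
Proof.
split=> [s s' c|s c c'|b s c].
- by apply: near_retractionT => r; rewrite rmorphD mulrDl.
- have n := near_and (@near_retraction2 _ _ p) (near_retract_descended c)
    (near_retract_descended c').
  have n' := near_and (@near_retraction2 _ _ p) (near_retract_descended (c + c'))
    (near_retractD c c').
  apply: (@near_retraction2 _ _ p) n n' _ => r [h h'] [h'' e].
  rewrite -mulrDr -rmorphD; congr (_ * inrQ _); apply: descended_incl_inj.
  by rewrite rmorphD !descendK.
- have n := near_and (@near_retraction2 _ _ p) (near_retract_descended c)
    (near_retract_descended (f b * c)).
  apply: (@near_retraction2 _ _ p) n (near_retractZ b c) _ => r [h h'] e.
  have -> : descend (retract r (f b * c)) = d b * descend (retract r c).
    by apply: descended_incl_inj; rewrite rmorphM di !descendK.
  rewrite !rmorphM; have -> : inlQ (p b) = inrQ (d b) := po_glue Q b.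
  by rewrite mulrCA mulrA.
Qed.

(** If [w z = 0], then applying [u] shows that [z] dies in [S (x) Y]. The approximate left inverse
    recovers [z], because [retract] nearly fixes the finitely many elements of [D] in its
    expansion. *)
Lemma coalgebra_desc_inj : injective w.
Proof.
apply: raddf_inj => z; have [l <-] := tensor_sum_surj (P := Q) z.
move=> wz; have {}wz : \sum_(a <- l) psi a.1 * i a.2 = 0.
  rewrite -[RHS]wz [RHS](raddf_sum w); apply: eq_bigr => a _.
  by rewrite [RHS](rmorphM w) wl wr.
have uz : tensor_sum P [seq (a.1, i a.2) | a <- l] = tensor_sum P [::].
  rewrite /tensor_sum big_nil big_map.
  transitivity (u (\sum_(a <- l) psi a.1 * i a.2)); last by rewrite wz rmorph0.
  rewrite [RHS](raddf_sum u); apply: eq_bigr => a _; rewrite [RHS](rmorphM u) upsi.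
  by rewrite (comring_inclP (u := u) (v := inr)).
have n := near_tensor_sum (@near_retractionT _ _ p) (@near_retraction2 _ _ p)
  near_bilinear_descend uz.
have n' := near_seq (@near_retractionT _ _ p) (@near_retraction2 _ _ p) l
  (fun a => near_retract_id (comring_inclP a.2)).
have [r [+ h]] := near_ex p_pure (near_and (@near_retraction2 _ _ p) n n').
rewrite /lsum big_nil big_map => <-; apply: eq_big_seq => a al.
have e : retract r (i a.2) = i a.2 := h a al.
have -> : descend (retract r (i a.2)) = a.2; last by [].
by apply: descended_incl_inj; rewrite e descendK //; apply: comring_inclP.
Qed.

End Coalgebra.

Theorem comring_effective_of_pure (po : has_pushouts comring) :
  effective_codescent po pc.
Proof.
apply: effective_codescentI => [X f|Y psi].
  move=> P P'; have inr_inj := @comring_po_inr_inj X f P.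
  split=> [Z h h' e|Z h e eh].
    by apply: rmorphism_eq => z; apply: inr_inj; exact: comring_hom_app z e.
  pose inr : {rmorphism (X : comPzRingType) -> (po_obj P : comPzRingType)} := po_inr P.
  pose hz : {rmorphism (Z : comPzRingType) -> (po_obj P : comPzRingType)} := h.
  have [z|k hk] := @comring_lift _ _ _ inr hz inr_inj; last first.
    by exists k; apply: rmorphism_eq => z; apply: hk.
  have [l lz] := tensor_sum_surj (P := P) (hz z).
  have : tensor_sum P' [seq (a.1, inr a.2) | a <- l] = tensor_sum P' [:: (1, hz z)].
    rewrite -(tensor_sum_map P e) lz tensor_sum1.
    exact: comring_hom_app z eh.
  move=> /near_retract_sum h1.
  (* Contraction by [r] leaves [hz z] on the right and an element of the image of [inr] on the
     left. *)
  have [r [r1]] := near_ex p_pure (near_and (@near_retraction2 _ _ p) (near_one p) h1).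
  have inrg b : inr ((f : {rmorphism _ -> _}) b) = (po_inl P ∘ pc : {rmorphism _ -> _}) b.
    exact: esym (po_glue P b).
  rewrite (lsum_retract_map _ _ inrg) lsum1.
  move=> e'; eexists; apply: etrans e' _; rewrite /retract_scale /= r1.
  have g1 : (po_inl P : {rmorphism S -> (po_obj P : comPzRingType)}) (p 1) = 1.
    by rewrite !rmorph1.
  by rewrite [X in X * _]g1 mul1r.
move=> P P' u e0 e1 e2 upsi epsu fuv.
pose f := psi ∘ pc; pose g := po_inl P ∘ pc.
pose inr : {rmorphism (Y : comPzRingType) -> (po_obj P : comPzRingType)} := po_inr P.
pose ur : {rmorphism (Y : comPzRingType) -> (po_obj P : comPzRingType)} := u.
pose eps : {rmorphism (po_obj P : comPzRingType) -> (Y : comPzRingType)} := po_desc P e0.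
have coassoc l c : tensor_sum P l = ur c ->
    tensor_sum P' [seq (a.1, inr a.2) | a <- l]
    = tensor_sum P' [seq (a.1, ur a.2) | a <- l].
  move=> lc; rewrite -(tensor_sum_map P e1) -(tensor_sum_map P e2) lc.
  exact: comring_hom_app c fuv.
pose uE := comring_inclP (u := ur) (v := inr).
have psif b : (psi : {rmorphism _ -> _}) (p b) = (f : {rmorphism _ -> _}) b by [].
have inlg b : (po_inl P : {rmorphism _ -> _}) (p b) = (g : {rmorphism _ -> _}) b by [].
have {}upsi s : ur ((psi : {rmorphism _ -> _}) s) = (po_inl P : {rmorphism _ -> _}) s.
  exact: comring_hom_app s upsi.
have {}epsu y : eps (ur y) = y := comring_hom_app y epsu.
have eps_inl s : eps ((po_inl P : {rmorphism _ -> _}) s) = (psi : {rmorphism _ -> _}) s.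
  exact: comring_hom_app s (po_desc_inl P e0).
have eps_inr y : eps (inr y) = y := comring_hom_app y (po_desc_inr P e0).
pose D : comPzRingType := comring_equalizer ur inr.
pose i : {rmorphism D -> (Y : comPzRingType)} := comring_incl ur inr.
have uf b : ur ((f : {rmorphism _ -> _}) b) = inr ((f : {rmorphism _ -> _}) b).
  by rewrite [LHS]upsi; exact: po_glue P b.
have [d di] := comring_lift (u := i) (g := f) val_inj
  (fun b => comring_incl_surj (uf b)).
have e : psi ∘ pc = @cmp comring _ _ _ i d.
  by apply: rmorphism_eq => b; rewrite [RHS](di b).
exists D, d, i, e; split; first by apply: rmorphism_eq => x; apply: uE.
pose Q := po _ _ _ pc (d : @hom comring _ _).
pose w : {rmorphism (po_obj Q : comPzRingType) -> (Y : comPzRingType)} := po_desc Q e.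
have wl s : w ((po_inl Q : {rmorphism _ -> _}) s) = (psi : {rmorphism _ -> _}) s.
  exact: comring_hom_app s (po_desc_inl Q e).
have wr x : w ((po_inr Q : {rmorphism _ -> _}) x) = i x.
  exact: comring_hom_app x (po_desc_inr Q e).
apply: comring_iso.
  exact: (coalgebra_desc_inj psif inlg upsi coassoc di wl wr).
exact: (coalgebra_generated psif inlg upsi eps_inl eps_inr epsu coassoc wl wr).
Qed.

End ComringDescent.

(** * From cyclic purity to purity *)

Section MaximalIdeal.
Variable R : comPzRingType.
Implicit Types I J : R -> Prop.

Lemma maximal_ideal J : is_ideal J -> ~ J 1 ->
  exists M, [/\ is_ideal M, ~ M 1, (forall x, J x -> M x) &
    forall a, ~ M a -> exists2 m, M m & exists r, m + r * a = 1].
Proof.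
move=> Ji J1.
(* Asking that the union of [K] and [J] be an ideal, and not [K] itself, admits the empty set, which
   is the union of the empty chain. *)
pose Q (K : set R) := is_ideal (fun x => K x \/ J x) /\ ~ K 1.
have [F FQ Ftot|A [[Ai A1] Amax]] := @Zorn_bigcup R Q.
  split; last by move=> [K /FQ[]].
  split=> [|x y [[K FK Kx]|Jx] [[L FL Ly]|Jy]|r x [[K FK Kx]|Jx]].
  - by right; apply: ideal0.
  - have [KL|LK] := Ftot K L FK FL.
      have [Li _] := FQ L FL.
      have [|Jxy] := idealD Li (or_introl (KL _ Kx)) (or_introl Ly); last by right.
      by left; exists L.
    have [Ki _] := FQ K FK.
    have [|Jxy] := idealD Ki (or_introl Kx) (or_introl (LK _ Ly)); last by right.
    by left; exists K.
  - have [Ki _] := FQ K FK.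
    have [|Jxy] := idealD Ki (or_introl Kx) (or_intror Jy); last by right.
    by left; exists K.
  - have [Li _] := FQ L FL.
    have [|Jxy] := idealD Li (or_intror Jx) (or_introl Ly); last by right.
    by left; exists L.
  - by right; apply: idealD.
  - have [Ki _] := FQ K FK.
    have [|Jxy] := idealM r Ki (or_introl Kx); last by right.
    by left; exists K.
  - by right; apply: idealM.
pose M x := A x \/ J x.
exists M; split=> [//|[/A1|/J1]//|x Jx|a Ma]; first by right.
pose B x := exists2 m, M m & exists r, x = m + r * a.
have [B1|B1] := pselect (B 1).
  by have [m Mm [r e]] := B1; exists m => //; exists r.
case: (Amax B).
  split; first by move=> x Ax; exists x; [left|exists 0; rewrite mul0r addr0].
  move=> BA; apply: Ma; left; apply: BA.
  by exists 0; [exact: ideal0 Ai | exists 1; rewrite mul1r add0r].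
have Bi : is_ideal B.
  split; first by exists 0; [exact: ideal0 Ai | exists 0; rewrite mul0r addr0].
    move=> x y [m Mm [r ->]] [m' Mm' [r' ->]].
    by exists (m + m'); [exact: idealD Ai _ _ | exists (r + r'); ring].
  move=> s x [m Mm [r ->]].
  by exists (s * m); [exact: idealM Ai _ | exists (s * r); ring].
split=> //; have -> // : (fun x => B x \/ J x) = B.
apply: funext => x; apply: propext; split; last by left.
by case=> // Jx; exists x; [right | exists 0; rewrite mul0r addr0].
Qed.

End MaximalIdeal.

(** * Linear systems over a principal ideal domain *)

Section Principal.
Variables (R S : comPzRingType) (p : {rmorphism R -> S}).
Hypothesis pp : cyclically_pure p.

Definition principal (a x : R) : Prop := exists r, x = r * a.

Lemma principal_ideal a : is_ideal (principal a).
Proof.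
split; first by exists 0; rewrite mul0r.
  by move=> x y [r ->] [s ->]; exists (r + s); rewrite mulrDl.
by move=> r x [s ->]; exists (r * s); rewrite mulrA.
Qed.

Lemma cyclically_pure_dvd a x (s : S) :
  p x = p a * s -> exists r, x = r * a.
Proof.
move=> e; apply: (pp (principal_ideal a)) => K Ki Kp.
by rewrite e mulrC; apply: (idealM s Ki); apply: Kp; exists 1; rewrite mul1r.
Qed.

Section PID.
Hypothesis pid : principal_ideal_domain R.

(** A generator [g] of the ideal of [a] and [b] is a combination of them; unless [g = 0], cancelling
    it makes the cofactors comaximal. *)
Lemma pid_bezout (a b : R) : exists g a' b',
  [/\ a = a' * g, b = b' * g & g = 0 \/ exists x y, x * a' + y * b' = 1].
Proof.
have [_ dom princ] := pid.
have Ii : is_ideal (fun z => exists x y, z = x * a + y * b).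
  split; first by exists 0, 0; ring.
    by move=> z z' [x [y ->]] [x' [y' ->]]; exists (x + x'), (y + y'); ring.
  by move=> r z [x [y ->]]; exists (r * x), (r * y); ring.
have [g gP] := princ _ Ii.
have [a' ea] : exists r, a = r * g by apply/gP; exists 1, 0; ring.
have [b' eb] : exists r, b = r * g by apply/gP; exists 0, 1; ring.
have [x [y eg]] : exists x y, g = x * a + y * b by apply/gP; exists 1; ring.
exists g, a', b'; split=> //.
have e : g * (x * a' + y * b' - 1) = 0.
  have -> : g * (x * a' + y * b' - 1) = x * (a' * g) + y * (b' * g) - g by ring.
  by rewrite -ea -eb -eg subrr.
case: (dom _ _ e) => [->|/eqP]; first by left.
by rewrite subr_eq0 => /eqP e1; right; exists x, y.
Qed.

Section Local.
Variable M : R -> Prop.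
Hypotheses (Mi : is_ideal M) (M1 : ~ M 1).
Hypothesis Mmax : forall a, ~ M a -> exists2 m, M m & exists r, m + r * a = 1.

Lemma local_mul u v : ~ M u -> ~ M v -> ~ M (u * v).
Proof.
move=> /Mmax[m Mm [r e]] Mv Muv; apply: Mv.
rewrite -(mul1r v) -e mulrDl; apply: idealD Mi _ _.
  by rewrite mulrC; apply: idealM.
by rewrite -mulrA; apply: idealM.
Qed.

(** The localization at [M] is a valuation ring: of two comaximal cofactors at least one is outside
    [M]. Multipliers outside [M] stand for denominators, so the localization is not constructed. *)
Lemma local_total a b : exists2 u, ~ M u &
  (exists c, u * b = c * a) \/ (exists c, u * a = c * b).
Proof.
have [g [a' [b' [-> -> h]]]] := pid_bezout a b.
case: h => [->|[x [y e]]]; first by exists 1 => //; left; exists 1; ring.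
have [Ma|] := pselect (M a'); last by exists a' => //; left; exists b'; ring.
have [Mb|] := pselect (M b'); last by exists b' => //; right; exists a'; ring.
by case: M1; rewrite -e; apply: idealD => //; apply: idealM.
Qed.

Definition local_dvd a b : Prop := exists2 u, ~ M u & exists c, u * b = c * a.

Lemma local_dvd_trans a b c : local_dvd a b -> local_dvd b c -> local_dvd a c.
Proof.
move=> [u Mu [x e]] [v Mv [y e']]; exists (u * v); first exact: local_mul.
by exists (y * x); rewrite -mulrA e' mulrCA e mulrA.
Qed.

Lemma local_dvd_refl a : local_dvd a a.
Proof. by exists 1 => //; exists 1. Qed.

Lemma local_dvd_min (l : seq R) : l != [::] ->
  exists2 m, m \in l & forall x, x \in l -> local_dvd m x.
Proof.
elim: l => // a [_ _|b l IH _].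
  by exists a; rewrite ?inE // => x; rewrite inE => /eqP ->; apply: local_dvd_refl.
have [//|m ml mP] := IH.
have [u Mu [h|h]] := local_total a m.
  exists a; first by rewrite inE eqxx.
  move=> x; rewrite inE => /orP[/eqP ->|/mP]; first exact: local_dvd_refl.
  by apply: local_dvd_trans; exists u.
exists m; first by rewrite inE ml orbT.
by move=> x; rewrite inE => /orP[/eqP ->|/mP //]; exists u.
Qed.

Lemma local_common (T : seq S) (a : S -> R) m :
  (forall t, t \in T -> local_dvd m (a t)) ->
  exists2 u, ~ M u & exists e : S -> R, forall t, t \in T -> u * a t = e t * m.
Proof.
elim: T => [_|t T IH h]; first by exists 1 => //; exists (fun=> 0).
have [|u Mu [e eP]] := IH.
  by move=> t' t'T; apply: h; rewrite inE t'T orbT.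
have [|v Mv [c cP]] := h t; first by rewrite inE eqxx.
exists (u * v); first exact: local_mul.
exists (fun t' => if t' == t then u * c else v * e t') => t'; rewrite inE.
case: eqP => [-> _|_ /= /eP e'] /=; first by rewrite -mulrA cP mulrA.
by rewrite mulrAC e' mulrC mulrA.
Qed.

(* Gaussian elimination over the localization at [M]: a pivot [a k l] dividing
   every coefficient, up to a factor outside [M], also divides the constant
   term [b k] because [p] is cyclically pure. *)
Lemma local_solution (T : seq S) n (a : 'I_n -> S -> R) (b : 'I_n -> R) :
  uniq T -> (forall i, \sum_(t <- T) p (a i t) * t = p (b i)) ->
  exists2 u, ~ M u & exists x : S -> R,
    forall i, \sum_(t <- T) a i t * x t = u * b i.
Proof.
have [_ dom _] := pid.
have [N TN] := ubnP (size T); elim: N => // N IH in T TN n a b *.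
move=> Tu sol.
case: n a b sol => [|n] a b sol.
  by exists 1 => //; exists (fun=> 0) => -[].
have [T0|T0] := eqVneq T [::].
  exists 1 => //; exists (fun=> 0) => i; rewrite T0 big_nil mul1r.
  have := sol i; rewrite T0 big_nil => bi.
  (* Without unknowns the system says [p (b i) = 0], and cyclic purity for the zero ideal is
     injectivity of [p]. *)
  have [|r ->] := @cyclically_pure_dvd 0 (b i) 0; last by rewrite mulr0.
  by rewrite mulr0.
pose coefs := [seq a i t | i <- enum 'I_n.+1, t <- T].
have mem_coefs i t : t \in T -> a i t \in coefs.
  by move=> tT; apply/allpairsP; exists (i, t); rewrite mem_enum.
have [|m /allpairsP[[k l] /= [_ lT ->]] mP] := @local_dvd_min coefs.
  case: (T) T0 mem_coefs => // t T' _ /(_ ord0 t (mem_head _ _)).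
  by case: coefs.
have pivot i : exists u, exists c, ~ M u /\ u * a i l = c * a k l.
  by have [u Mu [c e]] := mP _ (mem_coefs i l lT); exists u, c.
pose U i := sval (cid (pivot i)).
pose cU i : {c | ~ M (U i) /\ U i * a i l = c * a k l} := cid (svalP (cid (pivot i))).
pose c i := sval (cU i).
have MU i : ~ M (U i) by have [] := svalP (cU i).
have Uc i : U i * a i l = c i * a k l by have [] := svalP (cU i).
pose T' := rem l T.
have bigT (V : zmodType) (F : S -> V) :
    \sum_(t <- T) F t = F l + \sum_(t <- T') F t by rewrite (big_rem l).
(* Row [i] minus a multiple of row [k], scaled by [U i] to avoid division, no longer involves the
   unknown [l]. *)
pose a' i t := U i * a i t - c i * a k t.
pose b' i := U i * b i - c i * b k.
have T'u : uniq T' by apply: rem_uniq.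
have T'N : (size T' < N)%N.
  by rewrite size_rem // -ltnS (leq_trans _ TN) // ltnS; case: (T) lT.
have sol' i : \sum_(t <- T') p (a' i t) * t = p (b' i).
  have e j : \sum_(t <- T') p (a j t) * t = p (b j) - p (a j l) * l.
    by rewrite -sol bigT addrC addKr.
  have -> : \sum_(t <- T') p (a' i t) * t
     = p (U i) * \sum_(t <- T') p (a i t) * t - p (c i) * \sum_(t <- T') p (a k t) * t.
    rewrite !big_distrr -sumrB; apply: eq_bigr => t _ /=.
    by rewrite rmorphB !rmorphM; ring.
  rewrite !e /b' rmorphB !rmorphM.
  have := congr1 p (Uc i); rewrite !rmorphM => Ucp.
  transitivity (p (U i) * p (b i) - p (c i) * p (b k)
    - (p (U i) * p (a i l) - p (c i) * p (a k l)) * l); first by ring.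
  by rewrite Ucp; ring.
have [v Mv [x xP]] := IH T' T'N _ a' b' T'u sol'.
have [|w Mw [e eP]] := @local_common T (a k) (a k l).
  by move=> t tT; apply: mP; apply: mem_coefs.
have [B BP] : exists B, w * b k = B * a k l.
  apply: (@cyclically_pure_dvd _ _ (\sum_(t <- T) p (e t) * t)).
  rewrite rmorphM -sol !big_distrr; apply: eq_big_seq => t /eP et /=.
  by rewrite mulrA -rmorphM et rmorphM; ring.
(* Back substitution: the solution of the reduced system is scaled by [w], and the pivot row then
   determines the unknown [l]. *)
pose y t := if t == l then v * B - \sum_(t <- T') e t * x t else w * x t.
exists (w * v); first exact: local_mul.
have yl : y l = v * B - \sum_(t <- T') e t * x t by rewrite /y eqxx.
have yT' i : \sum_(t <- T') a i t * y t = w * \sum_(t <- T') a i t * x t.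
  rewrite big_distrr; apply: eq_big_seq => t; rewrite mem_rem_uniq // inE /y.
  by case: eqP => //= _ _; ring.
have ekl : a k l * \sum_(t <- T') e t * x t = w * \sum_(t <- T') a k t * x t.
  rewrite !big_distrr; apply: eq_big_seq => t /mem_rem /eP et /=.
  by rewrite [RHS]mulrA et; ring.
have akl : a k l * y l = w * (v * b k) - w * \sum_(t <- T') a k t * x t.
  rewrite yl mulrBr ekl; congr (_ - _).
  transitivity (v * (B * a k l)); first by ring.
  by rewrite -BP; ring.
exists y => i; rewrite bigT yT'.
have xi : U i * \sum_(t <- T') a i t * x t
    = v * b' i + c i * \sum_(t <- T') a k t * x t.
  rewrite -xP !big_distrr -big_split; apply: eq_bigr => t _ /=.
  by rewrite /a'; ring.
set s := \sum_(t <- T') _ in xi *; set sk := \sum_(t <- T') _ in xi akl.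
(* The row equation is obtained only after multiplication by [U i], which is nonzero because it is
   outside [M]. *)
have UE : U i * (a i l * y l + w * s - w * v * b i) = 0.
  transitivity (U i * a i l * y l + w * (U i * s) - w * v * U i * b i); first by ring.
  rewrite xi Uc /b'.
  transitivity (c i * (a k l * y l) + w * (v * (U i * b i - c i * b k) + c i * sk)
    - w * v * U i * b i); first by ring.
  by rewrite akl; ring.
case: (dom _ _ UE) => [U0|/eqP]; first by case: (MU i); rewrite U0; apply: ideal0.
by rewrite subr_eq0 => /eqP.
Qed.

End Local.

(** The [v] for which the system with right-hand side [v b] is solvable form an ideal. By the local
    solutions it lies in no maximal ideal, so it contains [1]. *)
Lemma pid_solution (T : seq S) n (a : 'I_n -> S -> R) (b : 'I_n -> R) :
  uniq T -> (forall i, \sum_(t <- T) p (a i t) * t = p (b i)) ->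
  exists x : S -> R, forall i, \sum_(t <- T) a i t * x t = b i.
Proof.
move=> Tu sol.
pose J v := exists x : S -> R, forall i, \sum_(t <- T) a i t * x t = v * b i.
have Ji : is_ideal J.
  split; first by exists (fun=> 0) => i; rewrite mul0r big1 // => t _; rewrite mulr0.
    move=> v w [x xP] [y yP]; exists (fun t => x t + y t) => i.
    by rewrite mulrDl -xP -yP -big_split; apply: eq_bigr => t _; rewrite mulrDr.
  move=> r v [x xP]; exists (fun t => r * x t) => i.
  by rewrite -mulrA -xP big_distrr; apply: eq_bigr => t _; rewrite mulrCA.
have [[x xP]|J1] := pselect (J 1); first by exists x => i; rewrite xP mul1r.
have [M [Mi M1 JM Mmax]] := maximal_ideal Ji J1.
by have [u Mu /JM] := local_solution Mi M1 Mmax Tu sol.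
Qed.

(** The unknowns are the values of [r] at the elements other than [1] that occur in the relations.
    As [r 1 = 1], the coefficients of [1] go to the right-hand side, and the identity of [S]
    supplies the solution over [S]. *)
Lemma pid_pure : pure p.
Proof.
move=> rels relsP.
pose T := rem 1 (undup (1 :: flatten [seq [seq c.2 | c <- rel] | rel <- rels])).
pose T1 := undup (1 :: flatten [seq [seq c.2 | c <- rel] | rel <- rels]).
have T1u : uniq T1 by apply: undup_uniq.
have T11 : 1 \in T1 by rewrite mem_undup mem_head.
have T1E rel s : rel \in rels -> s \in [seq c.2 | c <- rel] -> s \in T1.
  move=> relP sP; rewrite mem_undup inE; apply/orP; right.
  by apply/flattenP; exists [seq c.2 | c <- rel] => //; apply: map_f.
pose rel_ (i : 'I_(size rels)) := nth [::] rels i.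
have relE i : rel_ i \in rels by apply: mem_nth.
pose coef i t : R := \sum_(c <- rel_ i | c.2 == t) c.1.
(* An element may occur repeatedly in one relation, so its coefficients are collected first. *)
have regroup (V : pzRingType) (h : R -> V) (y : S -> V) i :
    {morph h : u v / u + v} -> h 0 = 0 ->
    \sum_(c <- rel_ i) h c.1 * y c.2 = \sum_(t <- T1) h (coef i t) * y t.
  move=> hD h0.
  have -> : \sum_(t <- T1) h (coef i t) * y t
          = \sum_(t <- T1) \sum_(c <- rel_ i | c.2 == t) h c.1 * y c.2.
    apply: eq_bigr => t _; rewrite /coef (big_morph h hD h0) big_distrl.
    by apply: eq_bigr => c /eqP <-.
  rewrite (exchange_big_dep predT) //=; apply: eq_big_seq => c cr.
  rewrite -big_filter (_ : [seq t <- T1 | c.2 == t] = [:: c.2]) ?big_seq1 //.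
  rewrite (eq_filter (a2 := pred1 c.2)) ?filter_pred1_uniq //.
  by apply: (T1E (rel_ i)) => //; apply: map_f.
have bigT (V : zmodType) (F : S -> V) :
    \sum_(t <- T1) F t = F 1 + \sum_(t <- T) F t by rewrite (big_rem 1).
have [|i|x xP] := @pid_solution T _ coef (fun i => - coef i 1).
- exact: rem_uniq.
- have := relsP _ (relE i); rewrite /linear_relation.
  rewrite (regroup _ p id) //; [|exact: rmorphD|exact: rmorph0].
  rewrite bigT mulr1 => /eqP; rewrite addrC addr_eq0 => /eqP ->.
  by rewrite rmorphN.
exists (fun t => if t == 1 then 1 else x t); first by rewrite eqxx.
move=> rel /(nthP [::])[j js <-]; rewrite /satisfies.
pose i := Ordinal js; have := regroup R id (fun t => if t == 1 then 1 else x t) i.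
rewrite /rel_ /= => -> //; rewrite bigT eqxx mulr1.
have -> : \sum_(t <- T) coef i t * (if t == 1 then 1 else x t) = - coef i 1.
  rewrite -xP; apply: eq_big_seq => t; rewrite mem_rem_uniq // inE.
  by case: eqP.
by rewrite addrN.
Qed.

End PID.
End Principal.

(** * Free modules and projective extensions *)

Section FreeModule.
Variables (R : comPzRingType) (B : choiceType).

Definition finite_support : {pred B -> R^o} :=
  fun h => `[< exists l : seq B, forall s, s \notin l -> h s = 0 >].

Lemma finite_support_submod : submod_closed finite_support.
Proof.
split=> [|c h k /asboolP[l hl] /asboolP[m km]]; first by apply/asboolP; exists [::].
apply/asboolP; exists (l ++ m) => s; rewrite mem_cat negb_or => /andP[sl sm].
transitivity (c *: h s + k s) => //.
by rewrite hl // km // scaler0 addr0.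
Qed.

Record free_module := FreeModule {
  free_val : B -> R^o; _ : free_val \in finite_support }.

HB.instance Definition _ := [isSub for free_val].
HB.instance Definition _ := [Choice of free_module by <:].
HB.instance Definition _ :=
  GRing.SubChoice_isSubLmodule.Build R _ _ free_module finite_support_submod.

Lemma free_valZD (a : R) (h k : free_module) s :
  free_val (a *: h + k) s = a * free_val h s + free_val k s.
Proof. by []. Qed.

Lemma free_supportP (h : free_module) :
  exists l : seq B, forall s, s \notin l -> free_val h s = 0.
Proof. by case: h => h /= /asboolP. Qed.

Definition free_support (h : free_module) : seq B :=
  undup (sval (cid (free_supportP h))).

End FreeModule.

Section Projective.
Variables (R S : comPzRingType) (p : {rmorphism R -> S}).
Local Notation M := (free_module R S).
Local Notation SR := (restrict_scalars p).

Definition free_sum (h : M) : SR := \sum_(s <- free_support h) p (free_val h s) * s.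

Lemma free_sumE (h : M) l : uniq l ->
  (forall s, s \notin l -> free_val h s = 0) ->
  free_sum h = \sum_(s <- l) p (free_val h s) * s.
Proof.
move=> lu hl; rewrite /free_sum.
have hs s : s \notin free_support h -> free_val h s = 0.
  by rewrite /free_support mem_undup; case: cid => x; apply.
have su : uniq (free_support h) by apply: undup_uniq.
have E (l1 l2 : seq S) : uniq l1 -> uniq l2 ->
    (forall s, s \notin l2 -> free_val h s = 0) ->
    \sum_(s <- l1) p (free_val h s) * s
    = \sum_(s <- [seq s <- l1 | s \in l2]) p (free_val h s) * s.
  move=> _ _ hl2; rewrite big_filter [RHS]big_mkcond; apply: eq_bigr => s _.
  by case: ifPn => // /hl2 ->; rewrite rmorph0 mul0r.
rewrite (E _ l) // [RHS](E _ (free_support h)) //.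
apply: perm_big; apply: uniq_perm; rewrite ?filter_uniq // => s.
by rewrite !mem_filter andbC.
Qed.

Lemma free_sum_linear : linear free_sum.
Proof.
move=> a h k; pose l := undup (free_support h ++ free_support k).
have lu : uniq l by apply: undup_uniq.
have hl s : s \notin l -> free_val h s = 0.
  rewrite mem_undup mem_cat negb_or /free_support => /andP[+ _].
  by rewrite mem_undup; case: cid => /= x; apply.
have kl s : s \notin l -> free_val k s = 0.
  rewrite mem_undup mem_cat negb_or /free_support => /andP[_].
  by rewrite mem_undup; case: cid => /= x; apply.
have ahkl s : s \notin l -> free_val (a *: h + k) s = 0.
  move=> sl; apply: etrans (free_valZD a h k s) _.
  by rewrite hl // kl // mulr0 addr0.
rewrite (free_sumE lu hl) (free_sumE lu kl) (free_sumE lu ahkl).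
rewrite [X in _ = X + _](_ : _ = p a * \sum_(s <- l) p (free_val h s) * s) //.
rewrite big_distrr -[RHS]big_split; apply: eq_bigr => s _ /=.
transitivity (p (a * free_val h s + free_val k s) * s) => //.
by rewrite rmorphD rmorphM mulrDl mulrA.
Qed.

HB.instance Definition _ := GRing.isLinear.Build R M SR _ free_sum free_sum_linear.

Lemma delta_finite (s : S) :
  (fun t : S => if t == s then 1 else 0 : R^o) \in @finite_support R S.
Proof.
by apply/asboolP; exists [:: s] => t; rewrite inE => /negPf ->.
Qed.

Lemma free_sum_surj (s : SR) : exists h, free_sum h = s.
Proof.
exists (FreeModule (delta_finite s)).
rewrite (free_sumE (l := [:: s : S])) //; last first.
  by move=> t; rewrite inE => /negPf /= ->.
by rewrite big_seq1 /= eqxx rmorph1 mul1r.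
Qed.

(* The trace ideal of a projective [S] generates the unit ideal of [S], hence
   by cyclic purity contains 1, which gives a retraction of [p]. *)
Lemma projective_pure : cyclically_pure p -> projective SR -> pure p.
Proof.
move=> pp /(_ _ _ (free_sum : {linear M -> SR}) (idfun : {linear SR -> SR})).
move=> /(_ free_sum_surj)[h hK].
pose functional (phi : S -> R) :=
  (forall s t, phi (s + t) = phi s + phi t) /\ (forall a s, phi (p a * s) = a * phi s).
(* Each value [phi s] is the value at [1] of the functional sending [t] to [phi (s * t)], so this is
   the whole trace ideal. *)
pose T a := exists2 phi, functional phi & phi 1 = a.
have Ti : is_ideal T.
  split.
  - by exists (fun=> 0) => //; split=> *; rewrite ?addr0 ?mulr0.
  - move=> x y [f [fD fZ] <-] [g [gD gZ] <-]; exists (fun s => f s + g s) => //.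
    split=> [s t|a s]; first by rewrite fD gD addrACA.
    by rewrite fZ gZ mulrDr.
  - move=> r x [f [fD fZ] <-]; exists (fun s => r * f s) => //.
    split=> [s t|a s]; first by rewrite fD mulrDr.
    by rewrite fZ mulrCA.
have [|phi [phiD phiZ] phi1] := pp T Ti 1.
  move=> K Ki KT; rewrite rmorph1.
  (* The section [h] writes [1] as the sum of the [p(phi_s(1)) s], where [phi_s] is the coordinate
     of [h] at [s], a linear functional. *)
  suff : K (free_sum (h (1 : S))) by have /= -> := hK (1 : S).
  rewrite /free_sum; apply: (big_ind K) => [|x y|s _]; [exact: ideal0 | exact: idealD |].
  rewrite mulrC; apply: (idealM s Ki); apply: KT.
  exists (fun t => free_val (h t) s) => //; split=> [t u|a t].
    have hD : h ((t : SR) + u) = h t + h u by rewrite raddfD.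
    by apply: etrans (congr1 (fun k : M => free_val k s) hD) _.
  have hZ : h (a *: (t : SR)) = a *: h t by rewrite linearZ.
  by apply: etrans (congr1 (fun k : M => free_val k s) hZ) _.
move=> rels relsP; exists phi => // rel /relsP.
have phi0 : phi 0 = 0 by have := phiZ 0 0; rewrite rmorph0 !mul0r.
rewrite /linear_relation /satisfies => /(congr1 phi).
rewrite phi0 (big_morph phi phiD phi0) => e; rewrite -[RHS]e.
by apply: eq_bigr => c _; rewrite phiZ.
Qed.

End Projective.

(** * A cyclically pure homomorphism that is not pure *)

Section SquareZero.
Variables (k : comPzRingType) (V : lmodType k).

Definition sqzero : Type := (k * V)%type.
HB.instance Definition _ := GRing.Zmodule.copy sqzero (k * V)%type.

Definition sqzero_mul (x y : sqzero) : sqzero :=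
  (x.1 * y.1, x.1 *: y.2 + y.1 *: x.2).

Lemma sqzero_mulA : associative sqzero_mul.
Proof.
move=> [a u] [b v] [c w]; congr pair; rewrite /= ?mulrA //.
by rewrite !scalerDr !scalerA addrA (mulrC c a) (mulrC b c).
Qed.
Lemma sqzero_mulC : commutative sqzero_mul.
Proof. by move=> [a u] [b v]; rewrite /sqzero_mul /= mulrC addrC. Qed.
Lemma sqzero_mul1 : left_id (1, 0) sqzero_mul.
Proof. by move=> [a u]; rewrite /sqzero_mul /= mul1r scale1r scaler0 addr0. Qed.
Lemma sqzero_mulDl : left_distributive sqzero_mul +%R.
Proof.
move=> [a u] [b v] [c w]; congr pair; rewrite /= ?mulrDl //.
by rewrite scalerDl scalerDr addrACA.
Qed.

HB.instance Definition _ := GRing.Zmodule_isComPzRing.Build sqzero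
  sqzero_mulA sqzero_mulC sqzero_mul1 sqzero_mulDl.

Lemma sqzeroM (x y : sqzero) : x * y = (x.1 * y.1, x.1 *: y.2 + y.1 *: x.2).
Proof. by []. Qed.
Lemma sqzeroB (x y : sqzero) : x - y = (x.1 - y.1, x.2 - y.2).
Proof. by []. Qed.
Definition sqzero_base (a : k) : sqzero := (a, 0).
Lemma sqzero_base_zmod : zmod_morphism sqzero_base.
Proof. by move=> a b; rewrite sqzeroB /= subr0. Qed.
Lemma sqzero_base_monoid : monoid_morphism sqzero_base.
Proof. by split=> // a b; rewrite sqzeroM /= !scaler0 addr0. Qed.
HB.instance Definition _ :=
  GRing.isZmodMorphism.Build k sqzero sqzero_base sqzero_base_zmod.
HB.instance Definition _ :=
  GRing.isMonoidMorphism.Build k sqzero sqzero_base sqzero_base_monoid.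

End SquareZero.

Section SquareZeroMap.
Variables (k : comPzRingType) (V W : lmodType k) (f : V -> W).
Hypothesis f_lin : linear f.

Definition sqzero_map (x : sqzero V) : sqzero W := (x.1, f x.2).

Let fD u v : f (u + v) = f u + f v.
Proof. by have := f_lin 1 u v; rewrite !scale1r. Qed.
Let f0 : f 0 = 0.
Proof. by have := f_lin (-1) 0 0; rewrite !scaleN1r !addNr. Qed.
Let fZ a v : f (a *: v) = a *: f v.
Proof. by have := f_lin a v 0; rewrite f0 !addr0. Qed.

Lemma sqzero_map_zmod : zmod_morphism sqzero_map.
Proof.
by move=> x y; rewrite /sqzero_map !sqzeroB /= fD -scaleN1r fZ scaleN1r.
Qed.
Lemma sqzero_map_monoid : monoid_morphism sqzero_map.
Proof.
split=> [|x y]; first by rewrite /sqzero_map /= f0.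
by rewrite /sqzero_map !sqzeroM /= fD !fZ.
Qed.

Definition sqzero_map_rmorphism : {rmorphism sqzero V -> sqzero W} :=
  HB.pack sqzero_map
    (GRing.isZmodMorphism.Build (sqzero V) (sqzero W) sqzero_map sqzero_map_zmod)
    (GRing.isMonoidMorphism.Build (sqzero V) (sqzero W) sqzero_map sqzero_map_monoid).

End SquareZeroMap.

Section Pairing.
Variables (A B C : comPzRingType) (f : {rmorphism A -> B}) (g : {rmorphism A -> C}).

Definition pairing (x : A) : (B * C)%type := (f x, g x).

Lemma pairing_zmod : zmod_morphism pairing.
Proof. by move=> x y; rewrite /pairing !rmorphB. Qed.
Lemma pairing_monoid : monoid_morphism pairing.
Proof. by split=> [|x y]; rewrite /pairing ?rmorph1 ?rmorphM. Qed.

Definition pairing_rmorphism : {rmorphism A -> (B * C)%type} :=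
  HB.pack pairing
    (GRing.isZmodMorphism.Build A (B * C)%type pairing pairing_zmod)
    (GRing.isMonoidMorphism.Build A (B * C)%type pairing pairing_monoid).

End Pairing.

Section Example.
Variable k : comPzRingType.
Hypothesis k2 : forall x : k, x = 0 \/ x = 1.
Hypotheses (k11 : 1 + 1 = 0 :> k) (k10 : 1 <> 0 :> k).

Local Notation V := (k^o * k^o)%type.

(* [ex_ring] is k[x, y] / (x, y)^2, an element [(a, (u, v))] being a + u x + v y,
   and [ex_ext] is the product of its quotients by x, by y and by x + y. *)
Definition ex_ring : comPzRingType := sqzero V.
Definition dual_numbers : comPzRingType := sqzero k^o.
Definition ex_ext : comPzRingType := (dual_numbers * (dual_numbers * dual_numbers))%type.

Definition mod_x (z : V) : k^o := z.2.
Definition mod_y (z : V) : k^o := z.1.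
Definition mod_xy (z : V) : k^o := z.1 + z.2.

Lemma mod_x_linear : linear mod_x. Proof. by []. Qed.
Lemma mod_y_linear : linear mod_y. Proof. by []. Qed.
Lemma mod_xy_linear : linear mod_xy.
Proof. by move=> a z w; rewrite /mod_xy /= scalerDr addrACA. Qed.

Definition quotient_by (f : V -> k^o) (lf : linear f) : {rmorphism ex_ring -> dual_numbers} :=
  sqzero_map_rmorphism lf.

Definition ex_map : {rmorphism ex_ring -> ex_ext} :=
  pairing_rmorphism (quotient_by mod_x_linear)
    (pairing_rmorphism (quotient_by mod_y_linear) (quotient_by mod_xy_linear)).

Lemma ex_map_cyclically_pure : cyclically_pure ex_map.
Proof.
move=> I Ii [a [u v]] pr; apply: contrapT => nIr.
have ker0 (A : comPzRingType) (q : {rmorphism ex_ext -> A}) :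
    (forall z, I z -> q (ex_map z) = 0) -> q (ex_map (a, (u, v))) = 0.
  move=> qI; apply: (pr (fun s => q s = 0)) => //.
  exact: rmorph_ker_ideal.
pose q1 : {rmorphism ex_ext -> dual_numbers} := fst.
pose q2 : {rmorphism ex_ext -> dual_numbers} := fst \o snd.
pose q3 : {rmorphism ex_ext -> dual_numbers} := snd \o snd.
(* An element with constant term [1] is a unit, which would make [I] the whole ring. *)
have I1 z : I z -> z.1 = 0.
  move=> Iz; case: (k2 z.1) => // z1; case: nIr.
  have e : ((1, - z.2) : ex_ring) * z = 1.
    by rewrite sqzeroM /= z1 mulr1 !scale1r addrN.
  have := idealM ((a, (u, v)) : ex_ring) Ii (idealM ((1, - z.2) : ex_ring) Ii Iz).
  by rewrite e mulr1.
have a0 : a = 0.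
  apply: (pr (fun s : ex_ext => s.1.1 = 0)) => [|z /I1 //].
  split=> // [x y x0 y0|s x x0]; first by rewrite /= x0 y0 addr0.
  by rewrite /= x0 mulr0.
have mod_ker (f : V -> k^o) (lf : linear f) (q : {rmorphism ex_ext -> dual_numbers}) :
    (forall z, q (ex_map z) = quotient_by lf z) ->
    (forall u' v', I (0, (u', v')) -> f (u', v') = 0) -> f (u, v) = 0.
  move=> qE fI; suff : q (ex_map (a, (u, v))) = 0 by rewrite qE => -[].
  apply: ker0 => -[b [u' v']] Iz; rewrite qE.
  by have := I1 _ Iz; rewrite /= => b0; move: Iz; rewrite b0 => /fI e; congr pair.
pose P u' v' := I (0, (u', v')).
have PD u1 v1 u2 v2 : P u1 v1 -> P u2 v2 -> P (u1 + u2) (v1 + v2).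
  move=> h h'; have := idealD Ii h h'.
  by rewrite (_ : _ + _ = (0, (u1 + u2, v1 + v2))) //; congr pair; rewrite /= addr0.
have nP : ~ P u v by rewrite /P -a0.
have Hx : (forall u' v', P u' v' -> v' = 0) -> v = 0.
  exact: (mod_ker _ mod_x_linear q1).
have Hy : (forall u' v', P u' v' -> u' = 0) -> u = 0.
  exact: (mod_ker _ mod_y_linear q2).
have Hxy : (forall u' v', P u' v' -> u' + v' = 0) -> u + v = 0.
  exact: (mod_ker _ mod_xy_linear q3).
clear pr nIr ker0 mod_ker.
have cases4 (Z : k -> k -> Prop) : Z 0 0 -> Z 0 1 -> Z 1 0 -> Z 1 1 -> forall x y, Z x y.
  by move=> Z00 Z01 Z10 Z11 x y; case: (k2 x) => ->; case: (k2 y) => ->.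
(* A subspace of the two-dimensional socle over the field of two elements that misses [(u, v)] has
   at most one nonzero element. In each case the quotient by that element kills [I] but not
   [(u, v)]. *)
case: (k2 u) nP Hx Hy Hxy => ->; case: (k2 v) => -> nP Hx Hy Hxy.
- by case: nP; apply: ideal0 Ii.
- have [P10|P10] := pselect (P 1 0).
    apply: k10; apply: Hx; apply: cases4 => // P11.
    by case: nP; have := PD _ _ _ _ P10 P11; rewrite k11 add0r.
  apply: k10; rewrite -[RHS]Hxy ?add0r //.
  by apply: cases4 => //; rewrite addr0.
- have [P01|P01] := pselect (P 0 1).
    apply: k10; apply: Hy; apply: cases4 => // P11.
    by case: nP; have := PD _ _ _ _ P01 P11; rewrite k11 add0r.
  apply: k10; rewrite -[RHS]Hxy ?addr0 //.
  by apply: cases4 => //; rewrite addr0.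
- have [P10|P10] := pselect (P 1 0).
    apply: k10; apply: Hx; apply: cases4 => // P01.
    by case: nP; have := PD _ _ _ _ P10 P01; rewrite addr0 add0r.
  by apply: k10; apply: Hy; apply: cases4.
Qed.

(* The injective hull of k, with basis s, t, w: x s = y t = w and
   x t = y s = x w = y w = 0. *)
Definition injective_hull : Type := (k^o * k^o * k^o)%type.
HB.instance Definition _ := GRing.Zmodule.copy injective_hull (k^o * k^o * k^o)%type.
Definition injective_hull_scale (r : ex_ring) (z : injective_hull) : injective_hull :=
  (r.1 * z.1.1, r.1 * z.1.2, r.1 * z.2 + r.2.1 * z.1.1 + r.2.2 * z.1.2).
Lemma injective_hull_scaleA a b v :
  injective_hull_scale a (injective_hull_scale b v) = injective_hull_scale (a * b) v.
Proof.
rewrite /injective_hull_scale sqzeroM /=; congr (_, _, _); rewrite ?mulrA //=.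
by rewrite /GRing.scale /=; ring.
Qed.
Lemma injective_hull_scale1 : left_id 1 injective_hull_scale.
Proof.
move=> [[a b] c]; rewrite /injective_hull_scale /= !mul1r; congr (_, _, _).
by rewrite !mul0r !addr0.
Qed.
Lemma injective_hull_scaleDr : right_distributive injective_hull_scale +%R.
Proof. by move=> r z w; congr (_, _, _); rewrite /=; ring. Qed.
Lemma injective_hull_scaleDl v : {morph injective_hull_scale^~ v : a b / a + b}.
Proof. by move=> r z; congr (_, _, _); rewrite /=; ring. Qed.
HB.instance Definition _ := GRing.Zmodule_isLmodule.Build ex_ring injective_hull
  injective_hull_scaleA injective_hull_scale1 injective_hull_scaleDr injective_hull_scaleDl.

Definition ex_test : comPzRingType := sqzero injective_hull.
Definition ex_test_map : {rmorphism ex_ring -> ex_test} := @sqzero_base ex_ring injective_hull.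

Lemma ex_unit_not_injective : ~ injective (cr_inr ex_map ex_test_map).
Proof.
pose x : ex_ring := (0, (1, 0)); pose y : ex_ring := (0, (0, 1)).
pose s : ex_test := (0, (1, 0, 0)); pose t : ex_test := (0, (0, 1, 0)).
pose w : ex_test := (0, (0, 0, 1)).
(* The idempotents of the factors modulo [x] and modulo [x + y]. Since [d] kills [x], it kills
   [w = x s]; since [(1 - d) y = b x] and [x t = 0], also [1 - d] kills [w = y t]. *)
pose d : ex_ext := (1, (0, 0)); pose b : ex_ext := (0, (0, 1)).
have act (r : ex_ring) (z : injective_hull) :
    ex_test_map r * ((0, z) : ex_test) = (0, injective_hull_scale r z).
  by rewrite sqzeroM /= mulr0 scale0r addr0.
have [xs yt xt] : [/\ ex_test_map x * s = w, ex_test_map y * t = w & ex_test_map x * t = 0].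
  by rewrite !act /injective_hull_scale /= ?(mul0r, mulr0, mulr1, add0r, addr0).
have d1 : d * ex_map x = 0.
  rewrite /d; congr (_, (_, _)); rewrite ?mul0r //.
  by rewrite mul1r.
have db : (1 - d) * ex_map y = b * ex_map x.
  congr (_, (_, _)).
  - by rewrite /= subrr !mul0r.
  - by rewrite /= subr0 mul1r mul0r.
  - by rewrite /= subr0 !mul1r; congr pair; rewrite /mod_xy /= addr0 add0r.
pose inl : {rmorphism ex_ext -> _} := cr_inl ex_map ex_test_map.
pose inr : {rmorphism ex_test -> _} := cr_inr ex_map ex_test_map.
have glue r : inl (ex_map r) = inr (ex_test_map r).
  by apply: cr_piP; apply: (cr_glue ex_map ex_test_map r).
have dw : inl d * inr w = 0.
  by rewrite -xs (rmorphM inr) mulrA -glue -(rmorphM inl) d1 rmorph0 mul0r.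
have d'w : inl (1 - d) * inr w = 0.
  rewrite -yt (rmorphM inr) mulrA -glue -(rmorphM inl) db (rmorphM inl) -mulrA.
  by rewrite glue -(rmorphM inr) xt rmorph0 mulr0.
have inrw : inr w = inr 0.
  by rewrite rmorph0 -(mul1r (inr w)) -(rmorph1 inl) -(subrK d 1) rmorphD mulrDl dw d'w addr0.
by move=> /(_ _ _ inrw) [].
Qed.

Lemma ex_ternary_not_comring :
  ternary_effective_codescent ex_map /\ ~ comring_effective_codescent ex_map.
Proof.
split; first exact: (ternary_effective_of_pure ex_map_cyclically_pure ternary_pushouts).
by move/comring_unit_injective => /(_ _ ex_test_map) /ex_unit_not_injective.
Qed.

End Example.

Theorem proposition4p3 :
  (forall (R S : comPzRingType) (p : {rmorphism R -> S}),
     comring_effective_codescent p -> ternary_effective_codescent p) /\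
  (exists (R S : comPzRingType) (p : {rmorphism R -> S}),
     ternary_effective_codescent p /\ ~ comring_effective_codescent p) /\
  (forall (R S : comPzRingType) (p : {rmorphism R -> S}),
     principal_ideal_domain R \/ projective (restrict_scalars p) ->
     ternary_effective_codescent p -> comring_effective_codescent p).
Proof.
split=> [R S p /comring_effective_pure pp|]; last split.
- exact: (ternary_effective_of_pure pp ternary_pushouts).
- have F2P (x : 'F_2) : x = 0 \/ x = 1.
    by case: x => [[|[|]]] // h; [left|right]; apply: val_inj.
  by do 3!eexists; apply: (@ex_ternary_not_comring 'F_2); [|apply: val_inj|].
- move=> R S p h /ternary_effective_pure pp; apply: comring_effective_of_pure.
  by case: h => [/pid_pure|/projective_pure]; apply.
Qed.
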